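(* Let $G^{(13)}$ be the umbral group attached to the Niemeier root system $A_{12}^{\oplus 2}$ (cyclic of order $4$), let $W^{(13)}_{\mathrm{tw}}=A(\mathfrak e)_{\mathrm{tw}}\otimes A(\mathfrak a)_{\mathrm{tw}}\otimes \underline{A}(\mathfrak b)_{\mathrm{tw}}\otimes\underline A(\mathfrak b')_{\mathrm{tw}}$ (with $\mathfrak e,\mathfrak a,\mathfrak b,\mathfrak b'$ all $2$-dimensional) be the canonically twisted module, equipped with the action of $G^{(13)}$ and the operators $J_{\mathfrak e}(0)$, $(-1)^F$, $J(0)$, $L(0)$, specified in the context. For $g\in G^{(13)}$ define the formal series $$\widetilde\psi^{(13)}_g:=-\mathrm{tr}\left((g+g^{-1})\,J_{\mathfrak e}(0)\,(-1)^F\,y^{J(0)}q^{L(0)}\,\middle|\,W^{(13)}_{\mathrm{tw}}\right)\in\mathbb C[y][[y^{-1}]][[q]].$$ Then for every $g\in G^{(13)}$ the series $\widetilde\psi^{(13)}_g$ is the expansion of the meromorphic Jacobi form $\psi^{(13)}_g$ in the domain $0<-\mathrm{Im}(z)<\mathrm{Im}(\tau)$; that is, after the substitution $q=e^{2\pi i\tau}$, $y=e^{2\pi i z}$ the series (as a double series in powers of $y$ and $q$) converges to $\psi^{(13)}_g(\tau,z)$ for all $\tau\in\mathbb H$, $z\in\mathbb C$ with $0<-\mathrm{Im}(z)<\mathrm{Im}(\tau)$.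
   Context: **Clifford modules.** Let $\mathfrak a$ be a complex vector space of finite even dimension $d$ with a non-degenerate symmetric bilinear form $\langle\cdot,\cdot\rangle$ and a polarization $\mathfrak a=\mathfrak a^+\oplus\mathfrak a^-$ (both summands isotropic). For a space $\mathfrak u$ with symmetric form, $\mathrm{Cliff}(\mathfrak u)=T(\mathfrak u)/(u\otimes u'+u'\otimes u-\langle u,u'\rangle\mathbf 1)$. For $r\in\frac12\mathbb Z$ let $\mathfrak a(r)=\{a(r)\mid a\in\mathfrak a\}$ be a copy of $\mathfrak a$; put $\hat{\mathfrak a}=\bigoplus_{n\in\mathbb Z}\mathfrak a(n+\frac12)$, $\hat{\mathfrak a}_{\mathrm{tw}}=\bigoplus_{n\in\mathbb Z}\mathfrak a(n)$, with $\langle a(r),a'(r')\rangle=\langle a,a'\rangle\delta_{r+r',0}$. Put $\hat{\mathfrak a}^+=\bigoplus_{n\ge0}\mathfrak a(n+\frac12)$ and $\hat{\mathfrak a}_{\mathrm{tw}}^+=\mathfrak a^+(0)\oplus\bigoplus_{n>0}\mathfrak a(n)$. Then $A(\mathfrak a)=\mathrm{Cliff}(\hat{\mathfrak a})\otimes_{\langle\hat{\mathfrak a}^+\rangle}\mathbb C\mathbf v$ and $A(\mathfrak a)_{\mathrm{tw}}=\mathrm{Cliff}(\hat{\mathfrak a}_{\mathrm{tw}})\otimes_{\langle\hat{\mathfrak a}_{\mathrm{tw}}^+\rangle}\mathbb C\mathbf v_{\mathrm{tw}}$, where $\langle\cdot\rangle$ denotes the unital subalgebra generated, and $\hat{\mathfrak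 a}^+\mathbf v=0$, $\hat{\mathfrak a}_{\mathrm{tw}}^+\mathbf v_{\mathrm{tw}}=0$. $A(\mathfrak a)$ has the unique super vertex algebra structure with vacuum $\mathbf v$ and $Y(a(-\frac12)\mathbf v,z)=\sum_{n\in\mathbb Z}a(n+\frac12)z^{-n-1}$, and $A(\mathfrak a)_{\mathrm{tw}}$ has the unique canonically twisted $A(\mathfrak a)$-module structure with $Y_{\mathrm{tw}}(a(-\frac12)\mathbf v,z)=\sum_{n\in\mathbb Z}a(n)z^{-n-\frac12}$. With bases $\{a_i^\pm\}$ of $\mathfrak a^\pm$ such that $\langle a_i^\mp,a_j^\pm\rangle=\delta_{ij}$, put $\omega=\frac12\sum_i(a_i^+(-\frac32)a_i^-(-\frac12)-a_i^+(-\frac12)a_i^-(-\frac32))\mathbf v$ (Virasoro element, $c=\frac d2$) and $\jmath=\sum_i a_i^+(-\frac12)a_i^-(-\frac12)\mathbf v$. Writing $J(0)$ for the coefficient of $z^{-1}$ in $Y_{\mathrm{tw}}(\jmath,z)$ and $L(0)$ for that of $z^{-2}$ in $Y_{\mathrm{tw}}(\omega,z)$, $$\mathrm{tr}(y^{J(0)}q^{L(0)-c/24}|A(\mathfrak a)_{\mathrm{tw}})=y^{d/4}q^{d/24}\prod_{n>0}(1+y^{-1}q^{n-1})^{d/2}(1+yq^n)^{d/2}.$$ **Weyl modules.** Let $\mathfrak b$ be a complex vector space of finite even dimension $d$ with a non-degenerate anti-symmetric form $\langle\!\langle\cdot,\cdot\rangle\!\rangle$ and polarization $\mathfrak b=\mathfrak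 b^+\oplus\mathfrak b^-$. Replace the Clifford algebra by the Weyl algebra $T(\mathfrak u)/(u\otimes u'-u'\otimes u-\langle\!\langle u,u'\rangle\!\rangle\mathbf 1)$ and repeat the construction verbatim (same index sets, $\hat{\mathfrak b}^+=\bigoplus_{n\ge0}\mathfrak b(n+\frac12)$, $\hat{\mathfrak b}_{\mathrm{tw}}^+=\mathfrak b^+(0)\oplus\bigoplus_{n>0}\mathfrak b(n)$, same formulas for $Y$ and $Y_{\mathrm{tw}}$ on generators) to get a super vertex algebra $\underline A(\mathfrak b)$ and canonically twisted module $\underline A(\mathfrak b)_{\mathrm{tw}}$. With bases such that $\langle\!\langle b_i^\mp,b_j^\pm\rangle\!\rangle=\pm\delta_{ij}$, put $\omega=\frac12\sum_i(b_i^+(-\frac32)b_i^-(-\frac12)-b_i^+(-\frac12)b_i^-(-\frac32))\mathbf v$ ($c=-\frac d2$) and $\jmath=\sum_ib_i^+(-\frac12)b_i^-(-\frac12)\mathbf v$; then $$\mathrm{tr}(y^{J(0)}q^{L(0)-c/24}|\underline A(\mathfrak b)_{\mathrm{tw}})=y^{-d/4}q^{-d/24}\prod_{n>0}(1-y^{-1}q^{n-1})^{-d/2}(1-yq^n)^{-d/2},$$ with $(1-X)^{-1}=\sum_{k\ge0}X^k$. **Group actions.** $g\in\mathrm{GL}(\mathfrak a^+)$ acts on $\mathfrak a=\mathfrak a^+\oplus\mathfrak a^-$ as $(g,g')$, where $g'\in\mathrm{GL}(\mathfrak a^-)$ is determined by $\langle ga,g'a'\rangle=\langle a,a'\rangle$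 for $a\in\mathfrak a^+,a'\in\mathfrak a^-$, and on $A(\mathfrak a)$ and $A(\mathfrak a)_{\mathrm{tw}}$ by $g\cdot a_1(r_1)\cdots a_n(r_n)\mathbf v=(ga_1)(r_1)\cdots(ga_n)(r_n)\mathbf v$ (resp. with $\mathbf v_{\mathrm{tw}}$). Similarly $\mathrm{GL}(\mathfrak b^+)$ acts on $\underline A(\mathfrak b)$, $\underline A(\mathfrak b)_{\mathrm{tw}}$. **The case $\ell=13$.** Let $\mathfrak e,\mathfrak a$ be $2$-dimensional with non-degenerate symmetric forms and $\mathfrak b,\mathfrak b'$ $2$-dimensional with non-degenerate anti-symmetric forms, all with fixed polarizations. Set $W^{(13)}=A(\mathfrak e)\otimes A(\mathfrak a)\otimes\underline A(\mathfrak b)\otimes\underline A(\mathfrak b')$ and $W^{(13)}_{\mathrm{tw}}=A(\mathfrak e)_{\mathrm{tw}}\otimes A(\mathfrak a)_{\mathrm{tw}}\otimes\underline A(\mathfrak b)_{\mathrm{tw}}\otimes\underline A(\mathfrak b')_{\mathrm{tw}}$. Let $\omega^{(13)}$ be the tensor product Virasoro element (sum of the $\omega$'s of the four factors), $\jmath_{\mathfrak e}=\jmath\otimes\mathbf v\otimes\mathbf v\otimes\mathbf v$, and $\jmath^{(13)}=6\,\mathbf v\otimes\jmath\otimes\mathbf v\otimes\mathbf v+\mathbf v\otimes\mathbf v\otimes\jmath\otimes\mathbf v+3\,\mathbf v\otimes\mathbf v\otimes\mathbf v\otimes\jmath$. On $W^{(13)}_{\mathrm{tw}}$: $J_{\mathfrak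 e}(0)$ and $J(0)$ are the coefficients of $z^{-1}$ in $Y_{\mathrm{tw}}(\jmath_{\mathfrak e},z)$ and $Y_{\mathrm{tw}}(\jmath^{(13)},z)$, $L(0)$ is the coefficient of $z^{-2}$ in $Y_{\mathrm{tw}}(\omega^{(13)},z)$, and $(-1)^F=(-I)\otimes(-I)\otimes I\otimes I\in\mathrm{GL}(\mathfrak e^+)\otimes\mathrm{GL}(\mathfrak a^+)\otimes\mathrm{GL}(\mathfrak b^+)\otimes\mathrm{GL}(\mathfrak b'^+)$. **Group.** $G^{(13)}=\mathrm{Aut}(N)/\mathrm{Inn}(N)$, where $N$ is the Niemeier lattice with root system $A_{12}^{\oplus2}$ and $\mathrm{Inn}(N)$ is generated by reflections in roots; it is cyclic of order $4$, with classes 1A (identity), 2A (the involution), 4A, 4B (the two generators). It acts on $W^{(13)}$ and $W^{(13)}_{\mathrm{tw}}$ by choosing a generator and mapping it to $I\otimes(-I)\otimes(iI)\otimes(iI)$ in $\mathrm{GL}(\mathfrak e^+)\otimes\mathrm{GL}(\mathfrak a^+)\otimes\mathrm{GL}(\mathfrak b^+)\otimes\mathrm{GL}(\mathfrak b'^+)$. **The functions $\psi^{(13)}_g$.** With $q=e^{2\pi i\tau}$, $y=e^{2\pi iz}$: $\eta(\tau)=q^{1/24}\prod_{n>0}(1-q^n)$, $\theta_1(\tau,z)=-iq^{1/8}y^{1/2}\prod_{n>0}(1-y^{-1}q^{n-1})(1-yq^n)(1-q^n)$, $\theta_2(\tau,z)=q^{1/8}y^{1/2}\prod_{n>0}(1+y^{-1}q^{n-1})(1+yq^n)(1-q^n)$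 (where $y^{1/2}=e^{\pi i z}$). The meromorphic Jacobi form $\psi^{(13)}_g$ of umbral moonshine is: - 1A: $2i\,\frac{\eta(\tau)^3\theta_1(\tau,6z)}{\theta_1(\tau,z)\theta_1(\tau,3z)}$ - 2A: $-2i\,\frac{\eta(\tau)^3\theta_1(\tau,6z)}{\theta_2(\tau,z)\theta_2(\tau,3z)}$ - 4A, 4B: $-i\frac{\eta(2\tau)^2\theta_2(\tau,6z)}{\eta(\tau)\theta_2(2\tau,2z)\theta_2(2\tau,6z)}\left(\theta_1(\tau,z+\frac14)\theta_1(\tau,3z+\frac14)-\theta_1(\tau,z-\frac14)\theta_1(\tau,3z-\frac14)\right)$ Poles of the quotients that are removable are understood to be removed. *)

(* Defs.v *)
From HB Require Import structures.
From mathcomp Require Import all_boot all_order all_algebra all_fingroup.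
From mathcomp Require Import generic_quotient sesquilinear finmap.
From mathcomp Require Import complex freeg.
From mathcomp Require Import all_classical all_reals all_analysis.

Set Implicit Arguments.
Unset Strict Implicit.
Unset Printing Implicit Defensive.

Import Order.TTheory GRing.Theory Num.Theory.
Import numFieldNormedType.Exports.

Local Open Scope classical_set_scope.
Local Open Scope quotient_scope.
Local Open Scope ring_scope.

(* The field of complex numbers over R; the annotation gives access to the
   topology that MathComp-Analysis puts on every numFieldType. *)
Definition Cx (R : realType) : numClosedFieldType := R[i].

Section Quotient.
Context (K : fieldType) (V : lmodType K) (S : set V).

Definition lin_span : set V :=
  [set x | exists n (c : 'I_n -> K) (s : 'I_n -> V),
     (forall i, S (s i)) /\ x = \sum_i c i *: s i].

Lemma lin_span0 : lin_span 0.
Proof.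
exists 0%N, (fun=> 0), (fun=> 0); split; first by case.
by rewrite big_ord0.
Qed.

Lemma lin_spanD x y : lin_span x -> lin_span y -> lin_span (x + y).
Proof.
move=> [n [c [s [Ss ->]]]] [m [d [t [St ->]]]].
pose app T (f : 'I_n -> T) (g : 'I_m -> T) (i : 'I_(n + m)) :=
  match fintype.split i with inl j => f j | inr j => g j end.
exists (n + m)%N, (app K c d), (app V s t); split.
  by move=> i; rewrite /app; case: fintype.split.
rewrite big_split_ord /=; congr (_ + _); apply: eq_bigr => i _; rewrite /app.
  by case: split_ordP => j /eqP; rewrite ?eq_lshift ?eq_lrshift // => /eqP ->.
by case: split_ordP => j /eqP; rewrite ?eq_rshift ?eq_rlshift // => /eqP ->.
Qed.

Lemma lin_spanZ a x : lin_span x -> lin_span (a *: x).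
Proof.
move=> [n [c [s [Ss ->]]]]; exists n, (fun i => a * c i), s; split => //.
by rewrite scaler_sumr; apply: eq_bigr => i _; rewrite scalerA.
Qed.

Lemma lin_span_gen x : S x -> lin_span x.
Proof.
by move=> Sx; exists 1%N, (fun=> 1), (fun=> x); split=> //; rewrite big_ord1 scale1r.
Qed.

Definition quot_rel (x y : V) : bool := `[< lin_span (x - y) >].

Lemma quot_rel_equiv : equiv_class_of quot_rel.
Proof.
split=> [x|x y|y x z].
- by apply/asboolP; rewrite subrr; exact: lin_span0.
- by apply/asboolP/asboolP => h; rewrite -opprB -scaleN1r; exact: lin_spanZ.
- move=> /asboolP h1 /asboolP h2; apply/asboolP.
  by rewrite -(subrKA y); exact: lin_spanD.
Qed.

Canonical quot_equiv := EquivRelPack quot_rel_equiv.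

Definition quot := {eq_quot quot_equiv}.

HB.instance Definition _ := Choice.on quot.
HB.instance Definition _ := EqQuotient.on quot.

Lemma quotP (x y : V) : lin_span (x - y) <-> \pi_quot x = \pi_quot y.
Proof. by split=> [h|/eqmodP/asboolP //]; apply/eqmodP/asboolP. Qed.

Lemma quot_repr (x : V) : lin_span (repr (\pi_quot x) - x).
Proof. by apply/quotP; rewrite reprK. Qed.

Definition quot_add (x y : quot) := \pi_quot (repr x + repr y).
Definition quot_opp (x : quot) := \pi_quot (- repr x).
Definition quot_scale (a : K) (x : quot) := \pi_quot (a *: repr x).

Lemma pi_add x y : quot_add (\pi x) (\pi y) = \pi_quot (x + y).
Proof.
apply/quotP; rewrite opprD addrACA.
by apply: lin_spanD; exact: quot_repr.
Qed.

Lemma pi_scale a x : quot_scale a (\pi x) = \pi_quot (a *: x).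
Proof. by apply/quotP; rewrite -scalerBr; apply/lin_spanZ/quot_repr. Qed.

Lemma pi_opp x : quot_opp (\pi x) = \pi_quot (- x).
Proof. by rewrite -scaleN1r -pi_scale /quot_opp /quot_scale scaleN1r. Qed.

Lemma quot_addA : associative quot_add.
Proof. by elim/quotW=> x; elim/quotW=> y; elim/quotW=> z; rewrite !pi_add addrA. Qed.
Lemma quot_addC : commutative quot_add.
Proof. by elim/quotW=> x; elim/quotW=> y; rewrite !pi_add addrC. Qed.
Lemma quot_add0 : left_id (\pi_quot 0) quot_add.
Proof. by elim/quotW=> x; rewrite pi_add add0r. Qed.
Lemma quot_addN : left_inverse (\pi_quot 0) quot_opp quot_add.
Proof. by elim/quotW=> x; rewrite pi_opp pi_add addNr. Qed.

HB.instance Definition _ :=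
  GRing.isZmodule.Build quot quot_addA quot_addC quot_add0 quot_addN.

Lemma quot_scaleA a b x : quot_scale a (quot_scale b x) = quot_scale (a * b) x.
Proof. by elim/quotW: x => x; rewrite !pi_scale scalerA. Qed.
Lemma quot_scale1 : left_id 1 quot_scale.
Proof. by elim/quotW=> x; rewrite pi_scale scale1r. Qed.
Lemma quot_scaleDr : right_distributive quot_scale +%R.
Proof.
move=> a; elim/quotW=> x; elim/quotW=> y.
by rewrite /GRing.add /= pi_add !pi_scale pi_add scalerDr.
Qed.
Lemma quot_scaleDl x : {morph quot_scale^~ x : a b / a + b}.
Proof.
by elim/quotW: x => x a b; rewrite [RHS]/GRing.add /= !pi_scale pi_add scalerDl.
Qed.

HB.instance Definition _ := GRing.Zmodule_isLmodule.Build K quot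
  quot_scaleA quot_scale1 quot_scaleDr quot_scaleDl.

Definition quot_pi (x : V) : quot := \pi_quot x.

Lemma quot_pi_linear : linear quot_pi.
Proof.
by move=> a x y; rewrite [RHS]/GRing.add /GRing.scale /= /quot_pi pi_scale pi_add.
Qed.

HB.instance Definition _ :=
  GRing.isLinear.Build K V quot *:%R quot_pi quot_pi_linear.

Lemma quot_pi_eq0 x : S x -> quot_pi x = 0.
Proof.
move=> Sx; rewrite -(linear0 quot_pi); apply/quotP; rewrite subr0.
exact: lin_span_gen.
Qed.

End Quotient.

Section FreeLift.
Context (K : fieldType) (X : choiceType) (S : set {freeg X / K}).
Context (M : lmodType K) (f : X -> M).

Lemma fglift_linear : linear (fglift f).
Proof.
have fB := lift_is_additive f.
have f0 : fglift f 0 = 0 by rewrite -(subrr 0) fB subrr.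
have fD u v : fglift f (u + v) = fglift f u + fglift f v.
  by rewrite -[v in LHS]opprK fB -[- v]sub0r fB f0 sub0r opprK.
move=> a x y; rewrite fD; congr (_ + _).
have fsum T (r : seq T) (F : T -> {freeg X / K}) :
    fglift f (\sum_(i <- r) F i) = \sum_(i <- r) fglift f (F i).
  by elim: r => [|i r IH]; rewrite ?big_nil // !big_cons fD IH.
rewrite {1}/GRing.scale /= /fgscale fsum -[x in RHS]freeg_sumE fsum scaler_sumr.
by apply: eq_bigr => i _; rewrite !liftU scalerA.
Qed.

HB.instance Definition _ :=
  GRing.isLinear.Build K {freeg X / K} M *:%R (fglift f) fglift_linear.

(* The linear map on the quotient <X> / <S> sending the class of a generator w
   to f w; this is meaningful when the linear extension of f kills S. *)
Definition quot_lift (x : quot S) : M := fglift f (repr x).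

Lemma fglift_span x :
  (forall r, S r -> fglift f r = 0) -> lin_span S x -> fglift f x = 0.
Proof.
move=> fS [n [c [s [Ss ->]]]].
rewrite linear_sum big1 // => i _.
by rewrite linearZ /= fS ?scaler0.
Qed.

Lemma quot_liftE x :
  (forall r, S r -> fglift f r = 0) -> quot_lift (quot_pi S x) = fglift f x.
Proof.
move=> fS; have := fglift_span fS (quot_repr S x).
by rewrite linearB => /eqP; rewrite subr_eq0 => /eqP.
Qed.

End FreeLift.

Lemma linear_fglift (K : fieldType) (X : choiceType) (M N : lmodType K)
    (f : X -> M) (g : {linear M -> N}) (x : {freeg X / K}) :
  g (fglift f x) = fglift (g \o f) x.
Proof.
rewrite -[x]freeg_sumE !linear_sum /=.
by apply: eq_bigr => i _; rewrite !liftU linearZ.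
Qed.

Section Tensor.
Context (K : fieldType) (U V : lmodType K).

Inductive tens_rel : {freeg (U * V)%type / K} -> Prop :=
| TensL c u u' v :
    tens_rel (<< (c *: u + u', v) >> - c *: << (u, v) >> - << (u', v) >>)
| TensR c u v v' :
    tens_rel (<< (u, c *: v + v') >> - c *: << (u, v) >> - << (u, v') >>).

Definition tens : lmodType K := quot tens_rel.

Definition tpure (u : U) (v : V) : tens := quot_pi tens_rel << (u, v) >>.

(* The linear map u (x) v |-> f u v, for a bilinear map f. *)
Definition tlift (M : lmodType K) (f : U -> V -> M) : tens -> M :=
  quot_lift (fun p => f p.1 p.2).

Lemma tliftE (M : lmodType K) (f : U -> V -> M) u v :
  (forall u, linear (f u)) -> (forall v, linear (f^~ v)) ->
  tlift f (tpure u v) = f u v.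
Proof.
move=> fr fl; rewrite /tlift quot_liftE ?liftU ?scale1r // => r [] * /=.
  by rewrite !linearB linearZ /= !liftU !scale1r fl -addrA -opprD subrr.
by rewrite !linearB linearZ /= !liftU !scale1r fr -addrA -opprD subrr.
Qed.

End Tensor.

Definition tmap (K : fieldType) (U V U' V' : lmodType K)
    (f : U -> U') (g : V -> V') : tens U V -> tens U' V' :=
  tlift (fun u v => tpure (f u) (g v)).

Section VertexAlgebra.
Context (K : numClosedFieldType).

Definition gbinom (x : K) (j : nat) : K := (\prod_(i < j) (x - i%:R)) / j`!%:R.

Definition has_sign (V : lmodType K) (s : V -> V) (p : bool) (x : V) : Prop :=
  s x = (-1) ^+ p *: x.

(* A super vertex algebra structure on V, with Z/2-grading given by the
   involution par (x is homogeneous of parity p when has_sign par p x), vacuum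
   vac and Y(a, z) b = \sum_n Y a n b z^(-n-1).  The sums in the Borcherds
   identity, which is the Jacobi identity written in modes, are finite because of
   sva_trunc: they are stationary as the number N of terms grows. *)
Record super_vertex_algebra (V : lmodType K) (par : V -> V) (vac : V)
    (Y : V -> int -> V -> V) : Prop := SuperVertexAlgebra {
  sva_par_linear : linear par;
  sva_par_invol : involutive par;
  sva_linear_l : forall n b, linear (fun a => Y a n b);
  sva_linear_r : forall a n, linear (Y a n);
  sva_par_vac : par vac = vac;
  sva_par_Y : forall a n b, par (Y a n b) = Y (par a) n (par b);
  sva_trunc : forall a b, exists N : int, forall n, N <= n -> Y a n b = 0;
  sva_vac : forall n b, Y vac n b = if n == -1 then b else 0;
  sva_creation : forall a, Y a (-1) vac = a /\ forall n, 0 <= n -> Y a n vac = 0;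
  sva_borcherds : forall p1 p2 a b c (m n k : int),
    has_sign par p1 a -> has_sign par p2 b ->
    exists N0 : nat, forall N, (N0 <= N)%N ->
      \sum_(j < N) gbinom m%:~R j *: Y (Y a (n + j%:Z) b) (m + k - j%:Z) c =
      \sum_(j < N) ((-1) ^+ j * gbinom n%:~R j) *:
        (Y a (m + n - j%:Z) (Y b (k + j%:Z) c)
         - ((-1) ^ n * (-1) ^+ (p1 && p2))
             *: Y b (n + k - j%:Z) (Y a (m + j%:Z) c))
}.

(* A sigma-twisted module structure on M, for an automorphism sigma of order
   dividing 2 of the super vertex algebra (V, par, vac, Y).
   The modes of a twisted vertex operator are indexed by half-integers; they are
   encoded by the doubles of the indices:
     Ytw(a, z) w = \sum_(k : int) Yt a k w z^(-k/2-1),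
   the sum being over the even k when sigma a = a, and the odd k when
   sigma a = - a. *)
Record twisted_module (V : lmodType K) (par sigma : V -> V) (vac : V)
    (Y : V -> int -> V -> V) (M : lmodType K) (parM : M -> M)
    (Yt : V -> int -> M -> M) : Prop := TwistedModule {
  twm_par_linear : linear parM;
  twm_par_invol : involutive parM;
  twm_linear_l : forall k w, linear (fun a => Yt a k w);
  twm_linear_r : forall a k, linear (Yt a k);
  twm_par_Y : forall a k w, parM (Yt a k w) = Yt (par a) k (parM w);
  twm_trunc : forall a w, exists N : int, forall k, N <= k -> Yt a k w = 0;
  twm_index : forall s a (k : int) w,
    has_sign sigma s a -> odd `|k|%N != s -> Yt a k w = 0;
  twm_vac : forall k w, Yt vac k w = if k == -2 then w else 0;
  twm_borcherds : forall p1 p2 s1 s2 a b w (m n k : int),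
    has_sign par p1 a -> has_sign par p2 b ->
    has_sign sigma s1 a -> has_sign sigma s2 b ->
    odd `|m|%N = s1 -> odd `|k|%N = s2 ->
    exists N0 : nat, forall N, (N0 <= N)%N ->
      \sum_(j < N) gbinom (m%:~R / 2) j
        *: Yt (Y a (n + j%:Z) b) (m + k - 2 * j%:Z) w =
      \sum_(j < N) ((-1) ^+ j * gbinom n%:~R j) *:
        (Yt a (m + 2 * n - 2 * j%:Z) (Yt b (k + 2 * j%:Z) w)
         - ((-1) ^ n * (-1) ^+ (p1 && p2))
             *: Yt b (2 * n + k - 2 * j%:Z) (Yt a (m + 2 * j%:Z) w))
}.

(* The twisted vertex operators of the tensor product M1 (x) M2, as a module over
   V1 (x) V2:
     Ytw(a (x) b, z) (u (x) v) = (-1)^(|b||u|) Ytw(a, z) u (x) Ytw(b, z) v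
   for homogeneous b and u.  The general case is obtained by writing b as the sum
   of its even and odd parts.  The sum over i has finitely many nonzero terms. *)
Definition tens_Yt (V1 V2 M1 M2 : lmodType K) (par2 : V2 -> V2)
    (parM1 : M1 -> M1) (Y1 : V1 -> int -> M1 -> M1) (Y2 : V2 -> int -> M2 -> M2)
    (x : tens V1 V2) (k : int) : tens M1 M2 -> tens M1 M2 :=
  tlift (fun u v => tlift (fun a b =>
    \sum_(i \in [set: int])
      (tpure (Y1 a i u) (Y2 (2^-1 *: (b + par2 b)) (k - i - 2) v)
       + tpure (Y1 a i (parM1 u)) (Y2 (2^-1 *: (b - par2 b)) (k - i - 2) v))) x).

End VertexAlgebra.

(* The form is symmetric if eps = false (Clifford case) and anti-symmetric if
   eps = true (Weyl case): pol_form u v = (-1)^eps * pol_form v u. *)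
Record polarized (K : numClosedFieldType) (eps : bool) := Polarized {
  pol_space :> vectType K;
  pol_form : {hermitian pol_space for eps & idfun};
  pol_nondegenerate : nondegenerate pol_form;
  pol_plus : {vspace pol_space};
  pol_minus : {vspace pol_space};
  pol_sum : (pol_plus + pol_minus = fullv)%VS;
  pol_direct : (pol_plus :&: pol_minus = 0)%VS;
  pol_isotropic_plus : {in pol_plus &, forall u v, pol_form u v = 0};
  pol_isotropic_minus : {in pol_minus &, forall u v, pol_form u v = 0}
}.

Section Fock.
Context (K : numClosedFieldType) (eps : bool) (a : polarized K eps).

(* The symbol (u, n) stands for u(n + 1/2) in the untwisted case (tw = false) and
   for u(n) in the twisted case (tw = true); mode2 tw n is twice the index. *)
Definition mode2 (tw : bool) (n : int) : int := 2 * n + (~~ tw)%:Z.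

Definition mode_form (tw : bool) (x y : a * int) : K :=
  if mode2 tw x.2 + mode2 tw y.2 == 0 then pol_form a x.1 y.1 else 0.

(* The homogeneous elements of the subspaces that annihilate the vacuum. *)
Definition annihilator (tw : bool) (x : a * int) : bool :=
  if tw then (0 < x.2) || ((x.2 == 0) && (x.1 \in pol_plus a)) else 0 <= x.2.

(* With T the tensor algebra of \hat a, the module Cliff(\hat a) (x)_<\hat a^+> K v
   is the quotient of T by the sum of the two-sided ideal defining Cliff(\hat a)
   and of the left ideal T \hat a^+ ; the same holds for the Weyl algebra. The
   vector space T is presented as spanned by the words in the symbols (u, n),
   subject to multilinearity in the vectors u. *)
Inductive fock_rel (tw : bool) : {freeg (seq (a * int)) / K} -> Prop :=
| FockLin s t c u v n :
    fock_rel tw (<< s ++ (c *: u + v, n) :: t >>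
                 - c *: << s ++ (u, n) :: t >> - << s ++ (v, n) :: t >>)
| FockCom s t x y :
    fock_rel tw (<< s ++ x :: y :: t >> + (-1) ^+ eps *: << s ++ y :: x :: t >>
                 - mode_form tw x y *: << s ++ t >>)
| FockVac s x : annihilator tw x -> fock_rel tw << rcons s x >>.

Definition fock (tw : bool) : lmodType K := quot (fock_rel tw).

Definition fword (tw : bool) (s : seq (a * int)) : fock tw :=
  quot_pi (fock_rel tw) << s >>.

Definition fvac (tw : bool) : fock tw := fword tw [::].

Definition fop (tw : bool) (x : a * int) : fock tw -> fock tw :=
  quot_lift (fun s => fword tw (x :: s)).

Lemma fopE tw x s : fop x (fword tw s) = fword tw (x :: s).
Proof.
rewrite /fop quot_liftE ?liftU ?scale1r // => r h.
rewrite -(linear_fglift (fun s => << x :: s >>) (quot_pi (fock_rel tw))).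
apply: quot_pi_eq0; case: h => [s1 t c u v n|s1 t y z|s1 y hy];
  rewrite ?(linearB, linearD, linearZ) /= ?scalerN !liftU !scale1r.
- exact: (FockLin tw (x :: s1)).
- exact: (FockCom tw (x :: s1)).
- by rewrite -rcons_cons; exact: FockVac.
Qed.

(* The operator u_1(n_1) ... u_k(n_k) v |-> (phi u_1)(n_1) ... (phi u_k)(n_k) v
   for an isometry phi of a preserving the polarization. *)
Definition fmap (tw : bool) (phi : a -> a) : fock tw -> fock tw :=
  quot_lift (fun s => fword tw [seq (phi x.1, x.2) | x <- s]).

Lemma fmapE tw (phi : a -> a) s : linear phi ->
  (forall u v, pol_form a (phi u) (phi v) = pol_form a u v) ->
  {in pol_plus a, forall u, phi u \in pol_plus a} ->
  fmap phi (fword tw s) = fword tw [seq (phi x.1, x.2) | x <- s].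
Proof.
move=> phiL phiI phiP; rewrite /fmap quot_liftE ?liftU ?scale1r // => r h.
pose f (s : seq (a * int)) := [seq (phi x.1, x.2) | x <- s].
rewrite -(linear_fglift (fun s => << f s >>) (quot_pi (fock_rel tw))).
apply: quot_pi_eq0; case: h => [s1 t c u v n|s1 t y z|s1 y hy];
  rewrite ?(linearB, linearD, linearZ) /= ?scalerN !liftU !scale1r /f ?map_cat /=.
- by rewrite phiL; exact: FockLin.
- have <- : mode_form tw (phi y.1, y.2) (phi z.1, z.2) = mode_form tw y z.
    by rewrite /mode_form phiI.
  exact: FockCom.
- rewrite map_rcons; apply: FockVac; move: hy; rewrite /annihilator /=.
  case: tw => //; case/orP => [-> //|/andP[-> /phiP ->]]; exact: orbT.
Qed.

End Fock.

Section Extension.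
Context (K : numClosedFieldType) (eps : bool) (a : polarized K eps).

(* The action on a of the element c I of GL(a^+), for c != 0: it is c on a^+, and
   c^-1 on a^- because it preserves the pairing of a^+ with a^- . *)
Definition gl_scalar (c : K) (x : a) : a :=
  c *: daddv_pi (pol_plus a) (pol_minus a) x
  + c^-1 *: daddv_pi (pol_minus a) (pol_plus a) x.

Lemma gl_scalar_plus c x : x \in pol_plus a -> gl_scalar c x = c *: x.
Proof.
move=> xp; rewrite /gl_scalar daddv_pi_id ?pol_direct //.
have /eqP dir : (pol_plus a :&: pol_minus a == 0)%VS by rewrite pol_direct.
have := daddv_pi_add dir (subvP (addvSl _ (pol_minus a)) _ xp).
by rewrite daddv_pi_id // -[RHS]addr0 => /addrI ->; rewrite scaler0 addr0.
Qed.

Lemma gl_scalar_minus c x : x \in pol_minus a -> gl_scalar c x = c^-1 *: x.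
Proof.
move=> xm; rewrite /gl_scalar.
have dir := pol_direct a.
have := daddv_pi_add dir (subvP (addvSr (pol_plus a) _) _ xm).
rewrite [X in _ + X]daddv_pi_id 1?capvC // -[RHS]add0r => /addIr ->.
by rewrite scaler0 add0r daddv_pi_id 1?capvC.
Qed.

Lemma gl_scalar_form c x y : c != 0 ->
  x \in pol_plus a -> y \in pol_minus a ->
  pol_form a (gl_scalar c x) (gl_scalar c y) = pol_form a x y.
Proof.
move=> c0 xp ym; rewrite gl_scalar_plus // gl_scalar_minus //.
by rewrite linearZlr /= mulVKf.
Qed.

Definition gl_act (tw : bool) (c : K) : fock a tw -> fock a tw :=
  fmap (gl_scalar c).

(* The involution given by the parity of the number of symbols; on the untwisted
   module this is (-1)^(2 L(0)), with respect to which the modules fock a true are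
   canonically twisted. *)
Definition fsign (tw : bool) : fock a tw -> fock a tw := fmap -%R.

(* The super space structure: the generators u(r) are odd in the Clifford case and
   even in the Weyl case. *)
Definition fpar (tw : bool) : fock a tw -> fock a tw :=
  if eps then id else @fsign tw.

End Extension.

Arguments gl_act {K eps} a tw c.
Arguments fsign {K eps} a tw.
Arguments fpar {K eps} a tw.

(* A space with a form and a polarization as above, of dimension d, together with
   dual bases of a^+ and a^- and the vertex algebra structures carried by its
   Clifford or Weyl modules, which are determined by their values on the
   generators.  In the anti-symmetric case ff_dual implies
   <<b_i^+, b_j^- >> = - delta_ij. *)
Record free_field (K : numClosedFieldType) (eps : bool) (d : nat) := FreeField {
  ff_space :> polarized K eps;
  ff_dim : \dim {: ff_space} = d;
  ff_plus : d./2.-tuple ff_space;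
  ff_minus : d./2.-tuple ff_space;
  ff_plus_basis : basis_of (pol_plus ff_space) ff_plus;
  ff_minus_basis : basis_of (pol_minus ff_space) ff_minus;
  ff_dual : forall i j : 'I_d./2,
    pol_form ff_space (tnth ff_minus i) (tnth ff_plus j) = (i == j)%:R;
  ff_Y : fock ff_space false -> int -> fock ff_space false -> fock ff_space false;
  ff_vertex : super_vertex_algebra (fpar ff_space false)
                (fvac ff_space false) ff_Y;
  (* Y(u(-1/2) v, z) = \sum_n u(n + 1/2) z^(-n-1) *)
  ff_Y_gen : forall u n x, ff_Y (fword false [:: (u, -1)]) n x = fop (u, n) x;
  ff_Yt : fock ff_space false -> int -> fock ff_space true -> fock ff_space true;
  ff_twisted : twisted_module (fpar ff_space false)
                 (fsign ff_space false) (fvac ff_space false) ff_Y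
                 (fpar ff_space true) ff_Yt;
  (* Ytw(u(-1/2) v, z) = \sum_n u(n) z^(-n-1/2) *)
  ff_Yt_gen : forall u n x,
    ff_Yt (fword false [:: (u, -1)]) (2 * n - 1) x = fop (u, n) x
}.

Section FreeField.
Context (K : numClosedFieldType) (eps : bool) (d : nat) (a : free_field K eps d).

Definition jelt : fock a false :=
  \sum_(i < d./2) fword false [:: (tnth (ff_plus a) i, -1); (tnth (ff_minus a) i, -1)].

Definition omega : fock a false := 2^-1 *: \sum_(i < d./2)
  (fword false [:: (tnth (ff_plus a) i, -2); (tnth (ff_minus a) i, -1)]
   - fword false [:: (tnth (ff_plus a) i, -1); (tnth (ff_minus a) i, -2)]).

End FreeField.

Definition tens4 (K : fieldType) (U1 U2 U3 U4 : lmodType K) : lmodType K :=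
  tens (tens (tens U1 U2) U3) U4.

Definition tpure4 (K : fieldType) (U1 U2 U3 U4 : lmodType K)
    (x1 : U1) (x2 : U2) (x3 : U3) (x4 : U4) : tens4 U1 U2 U3 U4 :=
  tpure (tpure (tpure x1 x2) x3) x4.

Definition tmap4 (K : fieldType) (U1 U2 U3 U4 : lmodType K)
    (f1 : U1 -> U1) (f2 : U2 -> U2) (f3 : U3 -> U3) (f4 : U4 -> U4) :
    tens4 U1 U2 U3 U4 -> tens4 U1 U2 U3 U4 :=
  tmap (tmap (tmap f1 f2) f3) f4.

Section W13.
Context (K : numClosedFieldType).
Context (e a : free_field K false 2) (b b' : free_field K true 2).

Definition W13 : lmodType K :=
  tens4 (fock e false) (fock a false) (fock b false) (fock b' false).

Definition W13tw : lmodType K :=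
  tens4 (fock e true) (fock a true) (fock b true) (fock b' true).

Definition W13_Yt : W13 -> int -> W13tw -> W13tw :=
  tens_Yt (fpar b' false)
    (tmap (tmap (fpar e true) (fpar a true)) (fpar b true))
    (tens_Yt (fpar b false) (tmap (fpar e true) (fpar a true))
      (tens_Yt (fpar a false) (fpar e true) (@ff_Yt _ _ _ e) (@ff_Yt _ _ _ a))
      (@ff_Yt _ _ _ b))
    (@ff_Yt _ _ _ b').

Local Notation v x := (fvac x false).

Definition omega13 : W13 :=
  tpure4 (omega e) (v a) (v b) (v b') + tpure4 (v e) (omega a) (v b) (v b')
  + tpure4 (v e) (v a) (omega b) (v b') + tpure4 (v e) (v a) (v b) (omega b').

Definition jelt_e : W13 := tpure4 (jelt e) (v a) (v b) (v b').

Definition jelt13 : W13 :=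
  6 *: tpure4 (v e) (jelt a) (v b) (v b') + tpure4 (v e) (v a) (jelt b) (v b')
  + 3 *: tpure4 (v e) (v a) (v b) (jelt b').

(* Recall that W13_Yt x k is the coefficient of z^(-k/2-1). *)
Definition Je0 : W13tw -> W13tw := W13_Yt jelt_e 0.
Definition J0 : W13tw -> W13tw := W13_Yt jelt13 0.
Definition L0 : W13tw -> W13tw := W13_Yt omega13 2.

Definition fermion_sign : W13tw -> W13tw :=
  tmap4 (gl_act e true (-1)) (gl_act a true (-1))
        (gl_act b true 1) (gl_act b' true 1).

(* The action of the chosen generator of the umbral group. *)
Definition generator13 : W13tw -> W13tw :=
  tmap4 (gl_act e true 1) (gl_act a true (-1))
        (gl_act b true 'i) (gl_act b' true 'i).

End W13.

Section Trace.
Context (K : numClosedFieldType) (V : lmodType K).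

(* S is a finite dimensional subspace, preserved by T, and T has trace t on S. *)
Definition trace_on (S : set V) (T : V -> V) (t : K) : Prop :=
  exists n (x : 'I_n -> V) (A : 'M[K]_n),
    [/\ forall v, S v <-> exists c : 'I_n -> K, v = \sum_i c i *: x i,
        forall c : 'I_n -> K, \sum_i c i *: x i = 0 -> forall i, c i = 0,
        forall j, T (x j) = \sum_i A i j *: x i
      & \tr A = t].

Definition joint_eigenspace (J L : V -> V) (m : int) (n : nat) : set V :=
  [set v | J v = m%:~R *: v /\ L v = n%:R *: v].

(* tr(T y^J q^L | V) is the formal series \sum_(m, n) c m n y^m q^n of
   K[y][[y^-1]][[q]]. *)
Definition trace_series (T J L : V -> V) (c : int -> nat -> K) : Prop :=
  [/\ forall v, exists k (x : 'I_k -> V), v = \sum_i x i /\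
        forall i, exists m n, joint_eigenspace J L m n (x i),
      forall m n, trace_on (joint_eigenspace J L m n) T (c m n)
    & forall n, exists M : int, forall m, M < m -> c m n = 0].

End Trace.

Section Lattice.
Context (n : nat) (B : 'M[int]_n).

Definition lat_form (x y : 'rV[int]_n) : int := (x *m B *m y^T) 0 0.

Definition even_unimodular : Prop :=
  [/\ B^T = B, forall x, exists k : int, lat_form x x = 2 * k, \det B = 1
    & forall x, x != 0 -> 0 < lat_form x x].

Definition lat_root (x : 'rV[int]_n) : Prop := lat_form x x = 2.

(* The roots of each of the two components are the r i j, with i != j, in the
   role of the vectors e_i - e_j of Z^(l+1). *)
Definition root_system_AA (l : nat) : Prop :=
  exists r : bool -> 'I_l.+1 -> 'I_l.+1 -> 'rV[int]_n,
    (forall x, lat_root x <-> exists c i j, i != j /\ x = r c i j) /\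
    (forall c c' i j i' j', i != j -> i' != j' ->
       lat_form (r c i j) (r c' i' j') =
       if c == c' then (i == i')%:R - (i == j')%:R - (j == i')%:R + (j == j')%:R
       else 0).

Definition lat_aut (U : 'M[int]_n) : Prop := U \in unitmx /\ U *m B *m U^T = B.

(* The matrix of x |-> x - <x, r> r, acting on row vectors. *)
Definition reflection (r : 'rV[int]_n) : 'M[int]_n := 1%:M - B *m r^T *m r.

Inductive lat_inn : 'M[int]_n -> Prop :=
| LatInn1 : lat_inn 1%:M
| LatInnM U r : lat_inn U -> lat_root r -> lat_inn (U *m reflection r).

End Lattice.

(* gT is the quotient of Aut(N) by Inn(N) (via the projection p), where N is a
   Niemeier lattice with root system A_12 + A_12. *)
Definition umbral_group13 (gT : finGroupType) : Prop :=
  exists (B : 'M[int]_24) (p : 'M[int]_24 -> gT),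
    [/\ even_unimodular B, root_system_AA B 12,
        forall U V, lat_aut B U -> lat_aut B V -> p (U *m V) = (p U * p V)%g,
        forall g, exists2 U, lat_aut B U & p U = g
      & forall U, lat_aut B U -> (p U = 1%g <-> lat_inn B U)].

Section Jacobi.
Context (R : realType).
Local Notation C := (Cx R).

Definition cexp (w : C) : C :=
  Complex (expR (complex.Re w) * cos (complex.Im w))
          (expR (complex.Re w) * sin (complex.Im w)).

Definition e2pii (w : C) : C := cexp (2 * Complex pi 0 * 'i * w).

Definition infprod (F : nat -> C) : C :=
  lim ((\prod_(1 <= n < N.+1) F n) @[N --> \oo]).

Definition eta (tau : C) : C :=
  e2pii (tau / 24) * infprod (fun n => 1 - e2pii tau ^+ n).

Definition theta1 (tau z : C) : C :=
  let q := e2pii tau in let y := e2pii z in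
  - 'i * e2pii (tau / 8) * e2pii (z / 2) *
  infprod (fun n => (1 - y^-1 * q ^+ n.-1) * (1 - y * q ^+ n) * (1 - q ^+ n)).

Definition theta2 (tau z : C) : C :=
  let q := e2pii tau in let y := e2pii z in
  e2pii (tau / 8) * e2pii (z / 2) *
  infprod (fun n => (1 + y^-1 * q ^+ n.-1) * (1 + y * q ^+ n) * (1 - q ^+ n)).

(* Numerator and denominator of psi_g, according to the order k of g: 1 for the
   class 1A, 2 for 2A, and 4 for 4A and 4B. *)
Definition psi13_num (k : nat) (tau z : C) : C :=
  if k == 1%N then 2 * 'i * eta tau ^+ 3 * theta1 tau (6 * z)
  else if k == 2%N then - 2 * 'i * eta tau ^+ 3 * theta1 tau (6 * z)
  else - 'i * (eta (2 * tau) ^+ 2 * theta2 tau (6 * z)) *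
       (theta1 tau (z + 4^-1) * theta1 tau (3 * z + 4^-1)
        - theta1 tau (z - 4^-1) * theta1 tau (3 * z - 4^-1)).

Definition psi13_den (k : nat) (tau z : C) : C :=
  if k == 1%N then theta1 tau z * theta1 tau (3 * z)
  else if k == 2%N then theta2 tau z * theta2 tau (3 * z)
  else eta tau * theta2 (2 * tau) (2 * z) * theta2 (2 * tau) (6 * z).

(* s is the value of psi_g at (tau, z), removable poles being removed. *)
Definition psi13_value (k : nat) (tau z s : C) : Prop :=
  if psi13_den k tau z == 0
  then psi13_num k tau w / psi13_den k tau w @[w --> z^'] --> s
  else s = psi13_num k tau z / psi13_den k tau z.

(* The double series \sum_(m, n) f m n converges (unconditionally) to s. *)
Definition double_series_sum (f : int -> nat -> C) (s : C) : Prop :=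
  forall eps : R, 0 < eps -> exists F0 : {fset int * nat},
    forall F : {fset int * nat}, (F0 `<=` F)%fset ->
      `|\sum_(p <- F) f p.1 p.2 - s| < (Complex eps 0 : C).

End Jacobi.

(* Main.v *)
Require Import Defs.
From HB Require Import structures.
From mathcomp Require Import all_boot all_order all_algebra all_fingroup cyclic.
From mathcomp Require Import generic_quotient sesquilinear finmap multiset.
From mathcomp Require Import complex freeg.
From mathcomp Require Import all_classical all_reals all_analysis.
From mathcomp Require Import zify ring lra.

Set Implicit Arguments.
Unset Strict Implicit.
Unset Printing Implicit Defensive.

Import Order.TTheory GRing.Theory Num.Theory.
Import numFieldNormedType.Exports.

Local Open Scope classical_set_scope.
Local Open Scope ring_scope.

(* The operators J(0) and L(0) have commutators with the modes u(n) that follow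
   from the twisted Borcherds identity, so the ordered words in the creation modes
   are joint eigenvectors of J(0) and L(0) and of the group; they form a basis of
   each Fock space because they are independent in the representation on functions
   of occupation numbers.  Hence the traces are explicit sums over quadruples of
   multisets of creation modes.  Two sign-reversing involutions shorten these sums:
   the zero mode of the factor e absorbs J_e(0), and each mode y^6 q^(2n) of the
   factor a cancels the square of the mode y^3 q^n of the second Weyl factor b'.
   After the second cancellation the sum converges absolutely under
   |y| > 1 > |y q| alone, whereas the product of the four separate series would
   also require |y^3 q| < 1.  Its value is a quotient of products of the form
   T(x; q) = \prod_(n > 0) (1 - x^-1 q^(n-1)) (1 - x q^n), and the identities
   T(x; q) T(-x; q) = T(x^2; q^2) and T(x; q) = T(x; q^2) O(x; q), with O the
   product over the remaining factors, turn it into psi_g.  At the zeros of the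
   denominator, which are isolated, the value is the limit by continuity. *)

(** * Tensor products and modes of twisted fields *)

(** The vertex operators enter only through their axioms and their values on generators, so every
    commutator and vacuum eigenvalue has to be extracted from the Borcherds identity. The obstacle
    is convergence. Both cancellations preserve charge and level, so they take place inside the
    finite sum that is one coefficient of the series: the coefficients stay the same, and only their
    expression as sums over states changes. The second cancellation rests on 6 = 2 * 3 and on the
    scalars -s^2 on a^+ and s on b'^+. What survives of [b'] has multiplicity at most one, so a
    boson is turned into a fermion. The insertion of J_e(0) keeps the trace from vanishing, since
    the zero mode of [e] alone would give the factor 1 - 1. For g of order 4 the scalars of g and of
    its inverse are i and -i, and the two traces together produce the difference of theta products
    shifted by 1/4 and -1/4. *)

Section LinearSpan.
Context (K : fieldType) (V : lmodType K).
Implicit Types (S : set V) (F : V -> V).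

Lemma lin_span_sum S I (r : seq I) (P : pred I) (f : I -> V) :
  (forall i, P i -> lin_span S (f i)) -> lin_span S (\sum_(i <- r | P i) f i).
Proof.
move=> h; elim/big_rec: _ => [|i x Pi hx]; first exact: lin_span0.
by apply: lin_spanD => //; exact: h.
Qed.

(** Induction on the length of a linear combination; the only case to treat is the addition of a
    multiple of one generator. *)
Lemma lin_span_min S (P : V -> Prop) :
  P 0 -> (forall c x y, S x -> P y -> P (c *: x + y)) ->
  forall x, lin_span S x -> P x.
Proof.
move=> P0 PD x [n [c [s [Ss ->]]]].
by elim/big_rec: _ => // i y _; exact: PD.
Qed.

Lemma lin_span_trans S S' :
  (forall x, S x -> lin_span S' x) -> forall x, lin_span S x -> lin_span S' x.
Proof.
move=> h; apply: lin_span_min; first exact: lin_span0.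
by move=> c x y /h hx hy; apply: lin_spanD => //; exact: lin_spanZ.
Qed.

End LinearSpan.

Lemma linear_on_span (K : fieldType) (V W : lmodType K) (S : set V)
    (f g : V -> W) : linear f -> linear g -> (forall x, S x -> f x = g x) ->
  forall x, lin_span S x -> f x = g x.
Proof.
move=> fl gl h; apply: lin_span_min.
  have f0 : f 0 = 0 by have := fl (-1) 0 0; rewrite scaler0 addr0 scaleN1r addNr.
  have g0 : g 0 = 0 by have := gl (-1) 0 0; rewrite scaler0 addr0 scaleN1r addNr.
  by rewrite f0 g0.
by move=> c x y Sx e; rewrite fl gl h // e.
Qed.

Lemma linear_comp (K : fieldType) (U V W : lmodType K) (f : V -> W) (g : U -> V) :
  linear f -> linear g -> linear (f \o g).
Proof. by move=> fl gl c x y; rewrite /= gl fl. Qed.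

Section LinearFacts.
Context (K : fieldType) (U V : lmodType K) (f : U -> V) (fl : linear f).

(** Maps such as [tlift f], [fop x] and the modes are plain functions with a separate proof of
    linearity, hence these rules for the unbundled predicate. *)
Lemma lin0 : f 0 = 0.
Proof. by have := fl (-1) 0 0; rewrite scaler0 addr0 scaleN1r addNr. Qed.

Lemma linD x y : f (x + y) = f x + f y.
Proof. by rewrite -[x in LHS]scale1r fl scale1r. Qed.

Lemma linZ c x : f (c *: x) = c *: f x.
Proof. by rewrite -[_ *: x]addr0 fl lin0 addr0. Qed.

Lemma linN x : f (- x) = - f x.
Proof. by rewrite -scaleN1r linZ scaleN1r. Qed.

Lemma linB x y : f (x - y) = f x - f y.
Proof. by rewrite linD linN. Qed.

Lemma lin_sum I (r : seq I) (P : pred I) (F : I -> U) :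
  f (\sum_(i <- r | P i) F i) = \sum_(i <- r | P i) f (F i).
Proof.
elim: r => [|i r IH]; rewrite ?big_nil ?lin0 // !big_cons.
by case: ifP => _; rewrite ?linD IH.
Qed.

End LinearFacts.

Section QuotientSpan.
Context (K : fieldType) (X : choiceType) (S : set {freeg X / K}).

Lemma quot_piW (P : quot S -> Prop) :
  (forall x, P (quot_pi S x)) -> forall x, P x.
Proof. by move=> h; elim/quotW=> x; exact: h. Qed.

Lemma quot_gen_span (x : quot S) :
  lin_span [set quot_pi S << w >> | w in [set: X]] x.
Proof.
elim/quot_piW: x => x; rewrite -[x]freeg_sumE linear_sum.
apply: lin_span_sum => w _; rewrite [<< _ *g _ >>](_ : _ = coeff w x *: << w >>).
  by rewrite linearZ; apply/lin_spanZ/lin_span_gen; exists w.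
by apply/eqP/freeg_eqP => z; rewrite coeffZ !coeffU mul1r.
Qed.

Lemma quot_lift_linear (M : lmodType K) (f : X -> M) :
  (forall r, S r -> fglift f r = 0) -> linear (quot_lift f : quot S -> M).
Proof.
move=> fS c; elim/quot_piW=> x; elim/quot_piW=> y.
rewrite -linearP /=.
by rewrite !quot_liftE // linearP.
Qed.

End QuotientSpan.

Section TensorFacts.
Context (K : fieldType).
Implicit Types U V M N : lmodType K.

Lemma tpure_linear_l U V (v : V) : linear (fun u : U => tpure u v).
Proof.
move=> c u u'; have := quot_pi_eq0 (TensL c u u' v); rewrite !linearB linearZ /=.
by move/eqP; rewrite -addrA -opprD subr_eq0 => /eqP.
Qed.

Lemma tpure_linear_r U V (u : U) : linear (fun v : V => tpure u v).
Proof.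
move=> c v v'; have := quot_pi_eq0 (TensR c u v v'); rewrite !linearB linearZ /=.
by move/eqP; rewrite -addrA -opprD subr_eq0 => /eqP.
Qed.

Lemma tens_span U V (x : tens U V) :
  lin_span [set tpure p.1 p.2 | p in [set: U * V]] x.
Proof.
have := quot_gen_span x; apply: lin_span_trans => _ [[u v] _ <-].
by apply: lin_span_gen; exists (u, v).
Qed.

Definition bilin U V M (f : U -> V -> M) :=
  (forall u, linear (f u)) /\ (forall v, linear (f^~ v)).

Lemma tlift_linear U V M (f : U -> V -> M) : bilin f -> linear (tlift f).
Proof.
move=> [fr fl]; apply: quot_lift_linear => r [] * /=.
  by rewrite !linearB linearZ /= !liftU !scale1r fl -addrA -opprD subrr.
by rewrite !linearB linearZ /= !liftU !scale1r fr -addrA -opprD subrr.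
Qed.

Lemma tens_ext U V M (f g : tens U V -> M) : linear f -> linear g ->
  (forall u v, f (tpure u v) = g (tpure u v)) -> f =1 g.
Proof.
move=> fl gl h x; apply: (linear_on_span fl gl _ (tens_span x)).
by move=> _ [[u v] _ <-]; exact: h.
Qed.

Lemma bilin_tpure U V U' V' (f : U -> U') (g : V -> V') :
  linear f -> linear g -> bilin (fun u v => tpure (f u) (g v)).
Proof.
move=> fl gl; split=> [u c x y|v c x y] /=.
  by rewrite gl tpure_linear_r.
by rewrite fl tpure_linear_l.
Qed.

Lemma tmap_linear U V U' V' (f : U -> U') (g : V -> V') :
  linear f -> linear g -> linear (tmap f g).
Proof. by move=> fl gl; apply: tlift_linear; exact: bilin_tpure. Qed.

Lemma tmapE U V U' V' (f : U -> U') (g : V -> V') u v :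
  linear f -> linear g -> tmap f g (tpure u v) = tpure (f u) (g v).
Proof. by move=> fl gl; have [h1 h2] := bilin_tpure fl gl; rewrite /tmap tliftE. Qed.

End TensorFacts.

(** * Finitely supported sums over the integers *)

Section IntegerSums.
Context (K : fieldType) (V : lmodType K).
Implicit Types f g : int -> V.

(** The sum over all integers in [tens_Yt] takes the default value 0 when the support is infinite,
    so its additivity depends on a bound for the support. *)
Definition bounded_supp f := exists N : nat, forall i, (N < `|i|)%N -> f i = 0.

Definition int_ball (N : nat) : {fset int} :=
  seq_fset tt [seq i%:Z - N%:Z | i <- iota 0 (N + N).+1].

Lemma int_ballP N i : i \notin int_ball N -> (N < `|i|)%N.
Proof.
rewrite ltnNge; apply: contra => h; rewrite seq_fsetE; apply/mapP.
by exists (absz (i + N%:Z)); rewrite ?mem_iota; lia.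
Qed.

Lemma fsum_ball N f : (forall i, (N < `|i|)%N -> f i = 0) ->
  \sum_(i \in [set: int]) f i = \sum_(i <- int_ball N) f i.
Proof. by move=> h; apply: fsbigTE => i /int_ballP /h. Qed.

Lemma fsum_linear c f g : bounded_supp f -> bounded_supp g ->
  \sum_(i \in [set: int]) (c *: f i + g i) =
  c *: (\sum_(i \in [set: int]) f i) + \sum_(i \in [set: int]) g i.
Proof.
move=> [N hf] [N' hg].
have hf' i : (maxn N N' < absz i)%N -> f i = 0 by move=> hi; apply: hf; lia.
have hg' i : (maxn N N' < absz i)%N -> g i = 0 by move=> hi; apply: hg; lia.
rewrite (fsum_ball hf') (fsum_ball hg') (@fsum_ball (maxn N N')).
  by rewrite big_split /= scaler_sumr.
by move=> i hi; rewrite hf' // hg' // scaler0 addr0.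
Qed.

Lemma fsum_single j f : (forall i, i != j -> f i = 0) ->
  \sum_(i \in [set: int]) f i = f j.
Proof.
move=> h; rewrite (@fsbigTE _ _ _ _ [fset j]%fset) ?big_seq_fset1 // => i.
by rewrite inE => /h.
Qed.

End IntegerSums.

Section FieldModes.
Context (K : numClosedFieldType).
Implicit Types V M : lmodType K.

(** What [tens_Yt] requires of each factor: linearity and truncation, which make the sum over [i]
    finite. The tensor product has the same properties ([tens_modes]), so the construction can be
    iterated to four factors. *)
Definition field_modes V M (Y : V -> int -> M -> M) : Prop :=
  [/\ forall k w, linear (fun a => Y a k w), forall a k, linear (Y a k)
    & forall a w, exists N : int, forall k, N <= k -> Y a k w = 0].

Definition vacuum_mode V M (Y : V -> int -> M -> M) (vac : V) : Prop :=
  forall k w, Y vac k w = if k == -2 then w else 0.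

(** Truncation of the first factor bounds [i] from above, truncation of the second one bounds it
    from below. The shift by 2 comes from the encoding of z^(-k/2-1) by [k]. *)
Lemma modes_bounded V1 V2 M1 M2 (Y1 : V1 -> int -> M1 -> M1)
    (Y2 : V2 -> int -> M2 -> M2) (a : V1) (b : V2) (u : M1) (v : M2) (k : int) :
  field_modes Y1 -> field_modes Y2 ->
  bounded_supp (fun i => tpure (Y1 a i u) (Y2 b (k - i - 2) v)).
Proof.
move=> [_ _ t1] [_ _ t2]; have [N1 h1] := t1 a u; have [N2 h2] := t2 b v.
exists (absz N1 + absz (k - N2) + 2)%N => i hi.
have [hN|hN] := leP N1 i; first by rewrite h1 // (lin0 (tpure_linear_l _)).
by rewrite h2 ?(lin0 (tpure_linear_r _)) //; lia.
Qed.

Section TensorModes.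
Context (V1 V2 M1 M2 : lmodType K) (par2 : V2 -> V2) (parM1 : M1 -> M1).
Context (Y1 : V1 -> int -> M1 -> M1) (Y2 : V2 -> int -> M2 -> M2).
Hypotheses (par2L : linear par2) (parM1L : linear parM1).
Hypotheses (m1 : field_modes Y1) (m2 : field_modes Y2).

Let plusL : linear (fun b => 2^-1 *: (b + par2 b)).
Proof.
move=> c x y; rewrite par2L addrACA -(scalerDr c x) [LHS]scalerDr !scalerA.
by rewrite mulrC.
Qed.

Let minusL : linear (fun b => 2^-1 *: (b - par2 b)).
Proof.
move=> c x y; rewrite par2L opprD addrACA -scalerN -(scalerDr c x) [LHS]scalerDr !scalerA.
by rewrite mulrC.
Qed.

Let tensor_term k a b u v (i : int) :=
  tpure (Y1 a i u) (Y2 (2^-1 *: (b + par2 b)) (k - i - 2) v)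
  + tpure (Y1 a i (parM1 u)) (Y2 (2^-1 *: (b - par2 b)) (k - i - 2) v).

Let bounded_term k a b u v : bounded_supp (tensor_term k a b u v).
Proof.
have [N1 h1] := modes_bounded a (2^-1 *: (b + par2 b)) u v k m1 m2.
have [N2 h2] := modes_bounded a (2^-1 *: (b - par2 b)) (parM1 u) v k m1 m2.
by exists (maxn N1 N2) => i hi; rewrite /tensor_term h1 ?h2 ?addr0 //; lia.
Qed.

Let inner k a b u v := \sum_(i \in [set: int]) tensor_term k a b u v i.

Let inner_linear_a k b u v : linear (fun a => inner k a b u v).
Proof.
have [l1 _ _] := m1.
move=> c a a'; rewrite -fsum_linear //; apply: eq_fsbigr => i _.
by rewrite /tensor_term !l1 !tpure_linear_l addrACA -(scalerDr c).
Qed.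

Let inner_linear_b k a u v : linear (fun b => inner k a b u v).
Proof.
have [l2 _ _] := m2.
move=> c b b'; rewrite -fsum_linear //; apply: eq_fsbigr => i _.
by rewrite /tensor_term plusL minusL !l2 !tpure_linear_r addrACA -(scalerDr c).
Qed.

Let inner_linear_u k a b v : linear (fun u => inner k a b u v).
Proof.
have [_ r1 _] := m1.
move=> c u u'; rewrite -fsum_linear //; apply: eq_fsbigr => i _.
by rewrite /tensor_term parM1L !r1 !tpure_linear_l addrACA -(scalerDr c).
Qed.

Let inner_linear_v k a b u : linear (inner k a b u).
Proof.
have [_ r2 _] := m2.
move=> c v v'; rewrite -fsum_linear //; apply: eq_fsbigr => i _.
by rewrite /tensor_term !r2 !tpure_linear_r addrACA -(scalerDr c).
Qed.

Local Notation Yt := (tens_Yt par2 parM1 Y1 Y2).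

Let inner_bilin k u v : bilin (fun a b => inner k a b u v).
Proof. by split=> *; [exact: inner_linear_b|exact: inner_linear_a]. Qed.

(** Linearity in the module vectors is an identity between linear maps of [x], hence may be checked
    on pure tensors, where [tliftE] applies. *)
Let outer_bilin k x : bilin (fun u v => tlift (fun a b => inner k a b u v) x).
Proof.
have L u v := tlift_linear (inner_bilin k u v).
split=> [u|v] c w w'.
  have R : linear (fun x => c *: tlift (fun a b => inner k a b u w) x
                      + tlift (fun a b => inner k a b u w') x).
    move=> d x1 x2; rewrite !(linD (L _ _)) !(linZ (L _ _)) !scalerDr !scalerA.
    by rewrite (mulrC c d) -!addrA; congr (_ + _); rewrite addrCA.
  apply: (tens_ext (L u _) R) => a b.
  by rewrite !tliftE ?inner_linear_v //; apply inner_bilin.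
have R : linear (fun x => c *: tlift (fun a b => inner k a b w v) x
                      + tlift (fun a b => inner k a b w' v) x).
  move=> d x1 x2; rewrite !(linD (L _ _)) !(linZ (L _ _)) !scalerDr !scalerA.
  by rewrite (mulrC c d) -!addrA; congr (_ + _); rewrite addrCA.
apply: (tens_ext (L _ v) R) => a b.
by rewrite !tliftE ?inner_linear_u //; apply inner_bilin.
Qed.

Lemma tens_Yt_pure a b k u v :
  Yt (tpure a b) k (tpure u v) =
  \sum_(i \in [set: int])
      (tpure (Y1 a i u) (Y2 (2^-1 *: (b + par2 b)) (k - i - 2) v)
       + tpure (Y1 a i (parM1 u)) (Y2 (2^-1 *: (b - par2 b)) (k - i - 2) v)).
Proof.
have [rr ll] := outer_bilin k (tpure a b); have [i1 i2] := inner_bilin k u v.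
by rewrite /tens_Yt tliftE // tliftE.
Qed.

Lemma tens_Yt_linear_r x k : linear (Yt x k).
Proof. exact: tlift_linear (outer_bilin k x). Qed.

Lemma tens_Yt_linear_l k w : linear (fun x => Yt x k w).
Proof.
move=> c x y.
have R : linear (fun w => c *: Yt x k w + Yt y k w).
  move=> d w1 w2; rewrite !(tens_Yt_linear_r) !scalerDr !scalerA (mulrC c d).
  by rewrite -!addrA; congr (_ + _); rewrite addrCA.
apply: (tens_ext (tens_Yt_linear_r _ k) R) => u v.
have E x0 : Yt x0 k (tpure u v) = tlift (fun a b => inner k a b u v) x0.
  by apply: tliftE; apply outer_bilin.
rewrite !E; exact: (tlift_linear (inner_bilin k u v)).
Qed.

(** The truncation bound varies with the pure tensor, so it is carried along two span inductions,
    one in the algebra and one in the module; |P| + |Q| bounds a combination of terms with bounds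
    [P] and [Q]. *)
Lemma tens_modes : field_modes Yt.
Proof.
split; [exact: tens_Yt_linear_l|exact: tens_Yt_linear_r|].
have add P Q (f g : int -> tens M1 M2) : (forall k, P <= k -> f k = 0) ->
    (forall k, Q <= k -> g k = 0) ->
    forall c k, `|P| + `|Q| <= k -> c *: f k + g k = 0.
  by move=> hf hg c k hk; rewrite hf ?hg ?scaler0 ?addr0 //; lia.
move=> x w; have := tens_span x.
move: x; apply: lin_span_min => [|c x y [[a b] _ <-]].
  by exists 0 => k _; exact: lin0 (tens_Yt_linear_l k w).
move=> [N hN]; suff [N' hN'] : exists N' : int, forall k, N' <= k -> Yt (tpure a b) k w = 0.
  by exists (`|N'| + `|N|) => k hk; rewrite tens_Yt_linear_l; exact: (add _ _ _ _ hN' hN).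
move=> {hN N x y c}; have := tens_span w.
move: w; apply: lin_span_min => [|c w y [[u v] _ <-]].
  by exists 0 => k _; exact: lin0 (tens_Yt_linear_r _ k).
move=> [N hN]; suff [N' hN'] : exists N' : int, forall k, N' <= k ->
    Yt (tpure a b) k (tpure u v) = 0.
  by exists (`|N'| + `|N|) => k hk; rewrite tens_Yt_linear_r; exact: (add _ _ _ _ hN' hN).
have [_ _ t1] := m1; have [_ _ t2] := m2.
have [N1 h1] := t1 a u; have [N2 h2] := t2 (2^-1 *: (b + par2 b)) v.
have [N3 h3] := t1 a (parM1 u); have [N4 h4] := t2 (2^-1 *: (b - par2 b)) v.
exists (`|N1| + `|N2| + `|N3| + `|N4| + 2) => k hk.
rewrite tens_Yt_pure; apply: fsbig1 => i _.
have e1 : tpure (Y1 a i u) (Y2 (2^-1 *: (b + par2 b)) (k - i - 2) v) = 0.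
  have [hN'|hN'] := leP N1 i; first by rewrite h1 // (lin0 (tpure_linear_l _)).
  by rewrite h2 ?(lin0 (tpure_linear_r _)) //; lia.
have e2 : tpure (Y1 a i (parM1 u)) (Y2 (2^-1 *: (b - par2 b)) (k - i - 2) v) = 0.
  have [hN'|hN'] := leP N3 i; first by rewrite h3 // (lin0 (tpure_linear_l _)).
  by rewrite h4 ?(lin0 (tpure_linear_r _)) //; lia.
by rewrite e1 e2 addr0.
Qed.

Let half_even b : par2 b = b -> 2^-1 *: (b + par2 b) = b /\ 2^-1 *: (b - par2 b) = 0.
Proof.
move=> ->; rewrite subrr scaler0 -[b + b]mulr2n -[b *+ 2]scaler_nat scalerA mulVf ?scale1r ?pnatr_eq0 //.
Qed.

Lemma tens_Yt_even a b k u v : par2 b = b ->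
  Yt (tpure a b) k (tpure u v) =
  \sum_(i \in [set: int]) tpure (Y1 a i u) (Y2 b (k - i - 2) v).
Proof.
move=> /half_even[e1 e2]; have [l2 _ _] := m2.
rewrite tens_Yt_pure; apply: eq_fsbigr => i _.
by rewrite e1 e2 (lin0 (l2 _ _)) (lin0 (tpure_linear_r _)) addr0.
Qed.

(** The vacuum has the single mode -2, so in the sum over [i] only the term with k - i - 2 = -2
    remains. *)
Lemma tens_Yt_vacr a vac k u v : par2 vac = vac -> vacuum_mode Y2 vac ->
  Yt (tpure a vac) k (tpure u v) = tpure (Y1 a k u) v.
Proof.
move=> pv hv; rewrite tens_Yt_even // (fsum_single (j := k)) ?hv.
  by rewrite subrr.
move=> i ik; rewrite hv; case: eqP => [?|_]; last exact: lin0 (tpure_linear_r _).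
by move/eqP: ik; lia.
Qed.

Lemma tens_Yt_vacl vac b k u v : par2 b = b -> vacuum_mode Y1 vac ->
  Yt (tpure vac b) k (tpure u v) = tpure u (Y2 b k v).
Proof.
move=> pb hv; rewrite tens_Yt_even // (fsum_single (j := -2)) ?hv //.
  by congr (tpure _ (Y2 _ _ _)); lia.
by move=> i i2; rewrite hv (negPf i2) (lin0 (tpure_linear_l _)).
Qed.

Lemma tens_vacuum vac1 vac2 : par2 vac2 = vac2 ->
  vacuum_mode Y1 vac1 -> vacuum_mode Y2 vac2 ->
  vacuum_mode Yt (tpure vac1 vac2).
Proof.
move=> pv hv1 hv2 k w.
have R : linear (fun w : tens M1 M2 => if k == -2 then w else 0).
  by move=> c x y; case: ifP; rewrite ?scaler0 ?addr0.
apply: (tens_ext (tens_Yt_linear_r _ k) R) => u v.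
rewrite tens_Yt_vacr // hv1; case: ifP => // _; exact: lin0 (tpure_linear_l _).
Qed.

End TensorModes.
End FieldModes.

(** * Traces of diagonalizable operators *)

Section DualBasis.
Context (K : numClosedFieldType).

(** A basis of an infinite-dimensional space together with its coordinate forms, which stand for
    linear independence and multiply under tensor products. The predicate [D] cuts down the index
    type because Fock states are indexed by multisets, while a Clifford state has no repeated
    mode. *)
Record dual_basis (V : lmodType K) (X : choiceType) (D : pred X) (w : X -> V)
    (dl : X -> V -> K^o) : Prop := DualBasis {
  dual_linear : forall x, linear (dl x);
  dual_pair : forall x y, D x -> D y -> dl x (w y) = (x == y)%:R;
  dual_span : forall v, lin_span [set w x | x in [set x | D x]] v
}.

Lemma sum_fset_delta (V : lmodType K) (X : choiceType) (F : {fset X}) (y : X)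
    (a : X -> V) : y \in F -> \sum_(x <- F) (x == y)%:R *: a x = a y.
Proof.
move=> yF; rewrite (big_fsetD1 y) //= eqxx scale1r big1_seq ?addr0 // => x.
by rewrite /= in_fsetD1 => /andP[/negPf -> _]; rewrite scale0r.
Qed.

Lemma dual_expand (V : lmodType K) (X : choiceType) (D : pred X) (w : X -> V) dl :
  dual_basis D w dl -> forall v, exists F : {fset X},
    (forall x, x \in F -> D x) /\ v = \sum_(x <- F) dl x v *: w x.
Proof.
move=> [dL dP dS] v.
suff [F [FD [a e]]] : exists F : {fset X}, (forall x, x \in F -> D x) /\
    exists a : X -> K, v = \sum_(x <- F) a x *: w x.
  exists F; split=> //; rewrite {1}e; apply: eq_big_seq => y yF; congr (_ *: _).
  rewrite e (lin_sum (dL y)) -[LHS](sum_fset_delta (fun x => a x : K^o) yF).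
  apply: eq_big_seq => x xF; rewrite (linZ (dL y)) dP ?FD // eq_sym.
  by rewrite /GRing.scale /= mulrC.
have := dS v; move: v; apply: lin_span_min.
  by exists fset0; split=> [x|]; rewrite ?inE //; exists (fun=> 0); rewrite big_seq_fset0.
move=> c _ v [x0 /= Dx0 <-] [F [FD [a ->]]].
exists (x0 |` F)%fset; split=> [x|]; first by rewrite !inE => /predU1P[->//|/FD].
exists (fun x => (x == x0)%:R * c + (if x \in F then a x else 0)).
under [RHS]eq_bigr => x _ do rewrite scalerDl -scalerA.
rewrite big_split /= (sum_fset_delta (fun x => c *: w x)) ?fset1U1 //; congr (_ + _).
rewrite -(big_fset_incl _ (fsubsetUr [fset x0]%fset F)) /=.
  by apply: eq_big_seq => x /= ->.
by move=> x _ /negPf ->; rewrite scale0r.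
Qed.

(** Allowing any larger finite set lets the support of a vector be compared with a prescribed set of
    indices. *)
Lemma dual_expand_sup (V : lmodType K) (X : choiceType) (D : pred X) (w : X -> V) dl v :
  dual_basis D w dl -> exists F0 : {fset X}, (forall x, x \in F0 -> D x) /\
  forall F : {fset X}, (forall x, x \in F -> D x) -> (F0 `<=` F)%fset ->
    v = \sum_(x <- F) dl x v *: w x.
Proof.
move=> wb; have [F0 [D0 e]] := dual_expand wb v; exists F0; split=> // F DF sub.
rewrite {1}e; apply: big_fset_incl => // x xF xF0; have [dL dP _] := wb.
suff -> : dl x v = 0 by rewrite scale0r.
rewrite e (lin_sum (dL x)) big1_seq // => y /andP[_ yF].
rewrite (linZ (dL x)) dP; [|exact: DF|exact: D0].
case: eqP => [xy|_]; last by rewrite scaler0.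
by move: xF0; rewrite xy yF.
Qed.

Lemma dual_basis_tens (U V : lmodType K) (X Y : choiceType) (D1 : pred X)
    (D2 : pred Y) (w1 : X -> U) (w2 : Y -> V) dl1 dl2 :
  dual_basis D1 w1 dl1 -> dual_basis D2 w2 dl2 ->
  dual_basis (fun p => D1 p.1 && D2 p.2) (fun p => tpure (w1 p.1) (w2 p.2))
    (fun p => tlift (fun u v => dl1 p.1 u * dl2 p.2 v : K^o)).
Proof.
move=> [l1 p1 s1] [l2 p2 s2].
have bl (p : X * Y) : bilin (fun u v => dl1 p.1 u * dl2 p.2 v : K^o).
  split=> [u|v] c x y /=; first by rewrite l2 /GRing.scale /=; ring.
  by rewrite l1 /GRing.scale /=; ring.
split=> [p|[x y] [x' y'] /= /andP[Dx Dy] /andP[Dx' Dy']|v].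
- exact: tlift_linear.
- have [r l] := bl (x, y); rewrite tliftE //= p1 // p2 // xpair_eqE.
  by rewrite -natrM mulnb.
apply: lin_span_trans (tens_span v) => _ [[u' v'] _ <-] /=.
have := s1 u'; move: u'; apply: lin_span_min => [|c _ u [x Dx <-] hu].
  by rewrite (lin0 (tpure_linear_l _)); exact: lin_span0.
rewrite tpure_linear_l; apply: lin_spanD => //; apply: lin_spanZ.
have := s2 v'; move: v' {hu}; apply: lin_span_min => [|d _ u2 [y Dy <-] hu2].
  by rewrite (lin0 (tpure_linear_r _)); exact: lin_span0.
rewrite tpure_linear_r; apply: lin_spanD => //; apply/lin_spanZ/lin_span_gen.
by exists (x, y) => //=; rewrite Dx.
Qed.

Section DiagonalTrace.
Context (V : lmodType K) (X : choiceType) (D : pred X) (w : X -> V).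
Context (dl : X -> V -> K^o) (wb : dual_basis D w dl).
Context (J L T : V -> V) (j : X -> int) (l : X -> nat) (t : X -> K).
Hypotheses (JL : linear J) (LL : linear L).
Hypotheses (Jw : forall x, D x -> J (w x) = (j x)%:~R *: w x).
Hypotheses (Lw : forall x, D x -> L (w x) = (l x)%:R *: w x).
Hypotheses (Tw : forall x, D x -> T (w x) = t x *: w x).
Context (S : int -> nat -> {fset X}).
Hypothesis memS : forall m n x, (x \in S m n) = [&& D x, j x == m & l x == n].

(** The form [dl x \o A] equals [al x *: dl x], since both are linear and agree on the basis; so an
    eigenvector has coordinates only at basis vectors of the same eigenvalue. *)
Let dual_eigen (A : V -> V) (al : X -> K) c v x : linear A ->
  (forall x, D x -> A (w x) = al x *: w x) -> D x -> A v = c *: v ->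
  dl x v != 0 -> al x = c.
Proof.
move=> AL Aw Dx e h; have [dL dP _] := wb.
have : dl x (A v) = al x * dl x v.
  have sL : linear (fun v => al x *: dl x v : K^o).
    by move=> d v1 v2; rewrite dL scalerDr !scalerA mulrC.
  have := @linear_on_span _ _ _ _ _ _ (linear_comp (dL x) AL) sL _ _ (dual_span wb v).
  apply => _ [y Dy <-] /=; rewrite Aw // (linZ (dL x)) dP //.
  by case: eqP => [->//|_]; rewrite !scaler0.
by rewrite e (linZ (dL x)) => /(mulIf h).
Qed.

Let joint_mem m n x : x \in S m n -> joint_eigenspace J L m n (w x).
Proof. by rewrite memS => /and3P[Dx /eqP <- /eqP <-]; split; [exact: Jw|exact: Lw]. Qed.

Lemma diagonal_trace_on m n :
  trace_on (joint_eigenspace J L m n) T (\sum_(x <- S m n) t x).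
Proof.
have [dL dP _] := wb; pose s := in_tuple (enum_fset (S m n)).
have s_inj : injective (tnth s) by apply/tuple_uniqP; exact: fset_uniq.
have sS i : tnth s i \in S m n by exact: mem_tnth.
have sD i : D (tnth s i) by have := sS i; rewrite memS => /and3P[].
exists (size s), (fun i => w (tnth s i)), (diag_mx (\row_i t (tnth s i))); split.
- move=> v; split=> [[Jv Lv]|[c ->]]; last first.
    have mem i : joint_eigenspace J L m n (w (tnth s i)) by exact: joint_mem.
    split; rewrite (lin_sum JL, lin_sum LL) scaler_sumr; apply: eq_bigr => i _.
      by have [e _] := mem i; rewrite (linZ JL) e !scalerA mulrC.
    by have [_ e] := mem i; rewrite (linZ LL) e !scalerA mulrC.
  exists (fun i => dl (tnth s i) v).
  have [F [FD e]] := dual_expand_sup v wb.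
  have FS x : x \in (F `|` S m n)%fset -> D x.
    by rewrite inE => /orP[/FD//|]; rewrite memS => /and3P[].
  rewrite -(big_tnth _ _ _ xpredT (fun x => dl x v *: w x)) /=.
  (* Expanding over the union makes [S m n] a subset; the remaining indices have coordinate 0 by
     [dual_eigen]. *)
  rewrite {1}(e (F `|` S m n)%fset) ?fsubsetUl //.
  apply/esym/big_fset_incl; first exact: fsubsetUr.
  move=> x /FS Dx; apply: contraNeq; rewrite scaler_eq0 => /norP[h _].
  rewrite memS Dx /=; apply/andP; split.
    by have /eqP := dual_eigen JL Jw Dx Jv h; rewrite eqr_int.
  by have /eqP := dual_eigen LL Lw Dx Lv h; rewrite eqr_nat.
- move=> c e i; have := congr1 (dl (tnth s i)) e.
  rewrite (lin_sum (dL _)) (lin0 (dL _)) (bigD1 i) //= (linZ (dL _)) dP // eqxx.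
  rewrite big1 ?addr0 => [|k ki]; first by rewrite /GRing.scale /= mulr1.
  rewrite (linZ (dL _)) dP // (inj_eq s_inj) eq_sym (negPf ki).
  by rewrite scaler0.
- move=> k; rewrite Tw // (bigD1 k) //= !mxE eqxx mulr1n big1 ?addr0 // => i ik.
  by rewrite !mxE (negPf ik) mulr0n scale0r.
- by rewrite mxtrace_diag [RHS]big_tnth; apply: eq_bigr => i _; rewrite mxE.
Qed.

Lemma diagonal_trace_series :
  (forall n, exists M, forall m, M < m -> S m n = fset0) ->
  trace_series T J L (fun m n => \sum_(x <- S m n) t x).
Proof.
move=> bound; split=> [v|m n|n]; last first.
- have [M hM] := bound n; exists M => m /hM ->; exact: big_seq_fset0.
- exact: diagonal_trace_on.
have [F [FD e]] := dual_expand wb v; pose s := in_tuple (enum_fset F).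
exists (size s), (fun i => dl (tnth s i) v *: w (tnth s i)); split.
  by rewrite {1}e big_tnth.
move=> i; have Dx : D (tnth s i) by apply: FD; exact: mem_tnth.
exists (j (tnth s i)), (l (tnth s i)); split.
  by rewrite (linZ JL) Jw // !scalerA mulrC.
by rewrite (linZ LL) Lw // !scalerA mulrC.
Qed.

End DiagonalTrace.
End DualBasis.

(** * The free fields of dimension 2 *)

Lemma eq_of_subr2_eq0 (V : zmodType) (x y z : V) : x - y - z = 0 -> x = y + z.
Proof. by move/eqP; rewrite -addrA -opprD subr_eq0 => /eqP. Qed.

Lemma eq_of_addrB_eq0 (V : zmodType) (x y z : V) : x + y - z = 0 -> x = z - y.
Proof. by move/eqP; rewrite subr_eq0 => /eqP <-; rewrite addrK. Qed.

Section FockWords.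
Context (K : numClosedFieldType) (eps : bool) (a : polarized K eps).

Lemma form_linear_l (w : a) : linear (fun u => pol_form a u w : K^o).
Proof. by move=> c u v; rewrite linearDl linearZl_LR. Qed.

Lemma form_linear_r (u : a) : linear (fun w => pol_form a u w : K^o).
Proof. by move=> c v w; rewrite linearDr linearZr_LR. Qed.

Lemma form_swap (u v : a) : pol_form a u v = (-1) ^+ eps * pol_form a v u.
Proof. by rewrite hermC. Qed.

Lemma fmap_linear tw (phi : a -> a) : linear phi ->
  (forall u v, pol_form a (phi u) (phi v) = pol_form a u v) ->
  {in pol_plus a, forall u, phi u \in pol_plus a} ->
  linear (Defs.fmap phi : fock a tw -> fock a tw).
Proof.
move=> phiL phiI phiP; apply: quot_lift_linear => r h.
pose f (s : seq (a * int)) := [seq (phi x.1, x.2) | x <- s].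
rewrite -(linear_fglift (fun s => << f s >>) (quot_pi (fock_rel tw))).
apply: quot_pi_eq0; case: h => [s1 t c u v n|s1 t y z|s1 y hy];
  rewrite ?(linearB, linearD, linearZ) /= ?scalerN !liftU !scale1r /f ?map_cat /=.
- by rewrite phiL; exact: FockLin.
- have <- : mode_form tw (phi y.1, y.2) (phi z.1, z.2) = mode_form tw y z.
    by rewrite /mode_form phiI.
  exact: FockCom.
- rewrite map_rcons; apply: FockVac; move: hy; rewrite /annihilator /=.
  case: (tw) => //; case/orP => [-> //|/andP[-> /phiP ->]]; exact: orbT.
Qed.

Section Words.
Context (tw : bool).
Local Notation W := (@fword K eps a tw).

Lemma fock_span (x : fock a tw) : lin_span [set W s | s in setT] x.
Proof. exact: quot_gen_span. Qed.

Lemma fword_linear s t n : linear (fun u : a => W (s ++ (u, n) :: t)).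
Proof.
move=> c u v; have := quot_pi_eq0 (FockLin tw s t c u v n).
by rewrite !linearB linearZ /= => /eq_of_subr2_eq0.
Qed.

Lemma fword_swap s t x y :
  W (s ++ x :: y :: t) =
  mode_form tw x y *: W (s ++ t) - (-1) ^+ eps *: W (s ++ y :: x :: t).
Proof.
have := quot_pi_eq0 (FockCom tw s t x y).
by rewrite linearB linearD !linearZ /= scalerN => /eq_of_addrB_eq0 e; rewrite scalerN.
Qed.

Lemma fword_vac s x : annihilator tw x -> W (rcons s x) = 0.
Proof. by move=> h; exact: quot_pi_eq0 (FockVac s h). Qed.

Lemma fword_map_scale (phi : a -> a) (c : a * int -> K) s0 s :
  (forall x, x \in s -> phi x.1 = c x *: x.1) ->
  W (s0 ++ [seq (phi x.1, x.2) | x <- s]) = (\prod_(x <- s) c x) *: W (s0 ++ s).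
Proof.
elim: s s0 => [|[u n] s IH] s0 h; first by rewrite big_nil scale1r.
rewrite big_cons /= (h (u, n)) ?mem_head // (linZ (fword_linear _ _ _)) -cat_rcons IH.
  by rewrite cat_rcons scalerA.
by move=> x xs; apply: h; rewrite inE xs orbT.
Qed.

Let oppr_isometry : [/\ linear (-%R : a -> a),
  forall u v, pol_form a (- u) (- v) = pol_form a u v
  & {in pol_plus a, forall u, - u \in pol_plus a}].
Proof.
split=> [c x y|u v|u]; first by rewrite opprD scalerN.
  by rewrite (linN (form_linear_l _)) (linN (form_linear_r _)) opprK.
by rewrite memvN.
Qed.

Lemma fsign_linear : linear (fsign a tw).
Proof. by have [? ? ?] := oppr_isometry; exact: fmap_linear. Qed.

Lemma fsign_word s : fsign a tw (W s) = (-1) ^+ size s *: W s.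
Proof.
have [? ? ?] := oppr_isometry; rewrite /fsign Defs.fmapE //.
rewrite (@fword_map_scale _ (fun=> -1) [::]) => [|x _]; last by rewrite scaleN1r.
by rewrite big_const_seq count_predT iter_mulr_1.
Qed.

Lemma fpar_word s : fpar a tw (W s) = (-1) ^+ (~~ eps && odd (size s)) *: W s.
Proof.
have if_app b (f g : fock a tw -> fock a tw) x :
  (if b then f else g) x = if b then f x else g x by case: b.
have if_sign (V : lmodType K) b n (x : V) :
  (if b then x else (-1) ^+ odd n *: x) = (-1) ^+ (~~ b && odd n) *: x.
  by case: b; rewrite //= scale1r.
by rewrite /fpar if_app fsign_word -signr_odd if_sign.
Qed.

End Words.
End FockWords.

Section ShortBinomials.
Context (K : numClosedFieldType).

Lemma gbinom0 (x : K) : gbinom x 0 = 1.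
Proof. by rewrite /gbinom big_ord0 fact0 divr1. Qed.

Lemma gbinom1 (x : K) : gbinom x 1 = x.
Proof. by rewrite /gbinom big_ord1 subr0 divr1. Qed.

Lemma gbinom2 (x : K) : gbinom x 2 = x * (x - 1) / 2.
Proof. by rewrite /gbinom !big_ord_recl big_ord0 subr0 mulr1 !factS fact0 !muln1. Qed.

Lemma gbinom_0S j : gbinom (0 : K) j.+1 = 0.
Proof. by rewrite /gbinom big_ord_recl subr0 !mul0r. Qed.

(** In every use below the products [Y x (n + j) y] vanish for j > 2, so three terms remain on the
    left of the Borcherds identity. *)
Lemma big_ord3 (V : zmodType) (F : nat -> V) N : (2 < N)%N ->
  (forall j, (2 < j)%N -> F j = 0) -> \sum_(j < N) F j = F 0%N + F 1%N + F 2.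
Proof.
case: N => [|[|[|N]]] // _ h; rewrite !big_ord_recl big1 ?addr0 ?addrA //.
by move=> j _; exact: h.
Qed.

End ShortBinomials.

Section FreeFieldModes.
Context (K : numClosedFieldType) (eps : bool) (a : free_field K eps 2).

Definition vplus : a := tnth (ff_plus a) (@ord0 0).
Definition vminus : a := tnth (ff_minus a) (@ord0 0).
Local Notation P := vplus.
Local Notation M := vminus.
Local Notation form := (pol_form a).
Local Notation sg := ((-1) ^+ eps : K).

Lemma form_MP : form M P = 1.
Proof. by rewrite (ff_dual a (@ord0 0) (@ord0 0)) eqxx. Qed.

Lemma form_PM : form P M = sg.
Proof. by rewrite form_swap form_MP mulr1. Qed.

Let span1 (t : 1.-tuple a) : <<t>>%VS = <[tnth t ord0]>%VS.
Proof. by case: t => [[|x [|]]] //= ?; rewrite span_seq1. Qed.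

Lemma plus_line : pol_plus a = <[P]>%VS.
Proof. by have /andP[/eqP <- _] := ff_plus_basis a; exact: span1. Qed.

Lemma minus_line : pol_minus a = <[M]>%VS.
Proof. by have /andP[/eqP <- _] := ff_minus_basis a; exact: span1. Qed.

Lemma vplus_in : P \in pol_plus a. Proof. by rewrite plus_line memv_line. Qed.
Lemma vminus_in : M \in pol_minus a. Proof. by rewrite minus_line memv_line. Qed.

Lemma form_PP : form P P = 0.
Proof. by apply: (pol_isotropic_plus (p := a)); exact: vplus_in. Qed.

Lemma form_MM : form M M = 0.
Proof. by apply: (pol_isotropic_minus (p := a)); exact: vminus_in. Qed.

(** In dimension 2 each summand of the polarization is a line. The vector [u] is paired on opposite
    sides so that <M, P> = 1 serves both coefficients and the sign of <P, M> = (-1)^eps does not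
    enter. *)
Lemma form_decomp u : u = form M u *: P + form u P *: M.
Proof.
have : u \in (pol_plus a + pol_minus a)%VS by rewrite pol_sum memvf.
rewrite plus_line minus_line => /memv_addP[_ /vlineP[x ->] [_ /vlineP[y ->] ->]].
rewrite (linD (form_linear_r _)) (linD (form_linear_l _)).
rewrite !(linZ (form_linear_r _)) !(linZ (form_linear_l _)) form_MP form_MM form_PP.
by rewrite !scaler0 addr0 add0r /GRing.scale /= !mulr1.
Qed.

Local Notation W0 := (@fword K eps a false).
Local Notation W1 := (@fword K eps a true).
Local Notation gen u := (W0 [:: (u, -1 : int)]).
Local Notation Y := (@ff_Y _ _ _ a).
Local Notation Yt := (@ff_Yt _ _ _ a).

Lemma Y_gen u n s : Y (gen u) n (W0 s) = W0 ((u, n) :: s).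
Proof. by rewrite ff_Y_gen fopE. Qed.

Lemma Yt_gen u n s : Yt (gen u) (2 * n - 1) (W1 s) = W1 ((u, n) :: s).
Proof. by rewrite ff_Yt_gen fopE. Qed.

Lemma jeltE : jelt a = W0 [:: (P, -1); (M, -1)].
Proof. by rewrite /jelt big_ord1. Qed.

Lemma omegaE : omega a =
  2^-1 *: (W0 [:: (P, -2); (M, -1)] - W0 [:: (P, -1); (M, -2)]).
Proof. by rewrite /omega big_ord1. Qed.

Lemma twisted_fock_modes : field_modes Yt.
Proof.
have h := ff_twisted a.
by split; [exact: twm_linear_l h|exact: twm_linear_r h|exact: twm_trunc h].
Qed.

Lemma twisted_fock_vacuum : vacuum_mode Yt (fvac a false).
Proof. exact: twm_vac (ff_twisted a). Qed.

Lemma fpar_sign s : has_sign (fpar a false) (~~ eps && odd (size s)) (W0 s).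
Proof. exact: fpar_word. Qed.

Lemma fsign_sign s : has_sign (fsign a false) (odd (size s)) (W0 s).
Proof. by rewrite /has_sign fsign_word signr_odd. Qed.

Lemma fpar_even_words s t c d : ~~ odd (size s) -> ~~ odd (size t) ->
  fpar a false (c *: W0 s + d *: W0 t) = c *: W0 s + d *: W0 t.
Proof.
move=> hs ht; have pl := sva_par_linear (ff_vertex a).
by rewrite (linD pl) !(linZ pl) !fpar_word (negPf hs) (negPf ht) andbF !scale1r.
Qed.

Lemma fpar_jelt : fpar a false (jelt a) = jelt a.
Proof.
have := @fpar_even_words [:: (P, -1); (M, -1)] [::] 1 0.
by rewrite !scale0r !addr0 !scale1r -jeltE; apply.
Qed.

Lemma fpar_omega : fpar a false (omega a) = omega a.
Proof. by rewrite omegaE scalerBr -scaleNr fpar_even_words. Qed.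

Lemma fsign_jelt : has_sign (fsign a false) false (jelt a).
Proof. by rewrite jeltE; exact: (fsign_sign [:: (P, -1); (M, -1)]). Qed.

(** The twisted Borcherds identity with its left side cut to three terms. The condition 0 < N keeps
    the term j = 0 on the right available. *)
Lemma borcherds_left p1 p2 s1 s2 (x y : fock a false) w (m n k : int) :
  has_sign (fpar a false) p1 x -> has_sign (fpar a false) p2 y ->
  has_sign (fsign a false) s1 x -> has_sign (fsign a false) s2 y ->
  odd `|m|%N = s1 -> odd `|k|%N = s2 ->
  (forall j : nat, (2 < j)%N -> Y x (n + j%:Z) y = 0) ->
  exists2 N, (0 < N)%N &
  Yt (Y x n y) (m + k) w + (m%:~R / 2) *: Yt (Y x (n + 1) y) (m + k - 2) w
  + (m%:~R / 2 * (m%:~R / 2 - 1) / 2) *: Yt (Y x (n + 2) y) (m + k - 4) w =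
  \sum_(j < N) ((-1) ^+ j * gbinom n%:~R j) *:
        (Yt x (m + 2 * n - 2 * j%:Z) (Yt y (k + 2 * j%:Z) w)
         - ((-1) ^ n * (-1) ^+ (p1 && p2))
             *: Yt y (2 * n + k - 2 * j%:Z) (Yt x (m + 2 * j%:Z) w)).
Proof.
move=> h1 h2 h3 h4 h5 h6 tr.
have [N0 e] := twm_borcherds (ff_twisted a) w n h1 h2 h3 h4 h5 h6.
exists (N0 + 3)%N; first by rewrite addnS.
rewrite -(e (N0 + 3)%N (leq_addr _ _)).
have [lin_l _ _] := twisted_fock_modes.
pose F (j : nat) := gbinom (m%:~R / 2 : K) j *: Yt (Y x (n + j%:Z) y) (m + k - 2 * j%:Z) w.
rewrite (@big_ord3 _ F) ?addnS //; last first.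
  by move=> j hj; rewrite /F tr // (lin0 (lin_l _ _)) scaler0.
by rewrite /F gbinom0 gbinom1 gbinom2 scale1r addr0 mulr0 subr0 mulr1.
Qed.

(** Setting the middle parameter of [borcherds_left] to 0 kills all binomials on the right but the
    first, which leaves a commutator, with no sign since [y] is even. The operator u(n) is the mode
    of doubled index 2n - 1. *)
Lemma commutator_left u (y : fock a false) w (n k : int) :
  has_sign (fpar a false) false y -> has_sign (fsign a false) false y ->
  ~~ odd `|k|%N -> (forall j : nat, (2 < j)%N -> Y (gen u) j%:Z y = 0) ->
  let m := 2 * n - 1 in let r := m%:~R / 2 : K in
  Yt (Y (gen u) 0 y) (m + k) w + r *: Yt (Y (gen u) 1 y) (m + k - 2) w
  + (r * (r - 1) / 2) *: Yt (Y (gen u) 2 y) (m + k - 4) w =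
  Yt (gen u) m (Yt y k w) - Yt y k (Yt (gen u) m w).
Proof.
move=> h2 h4 hk tr m r; have h1 := fpar_sign [:: (u, -1 : int)].
have h3 := fsign_sign [:: (u, -1 : int)].
have hm : odd `|m|%N = true by rewrite /m; lia.
have tr' (j : nat) : (2 < j)%N -> Y (gen u) (0 + j%:Z) y = 0.
  by move=> hj; rewrite add0r tr.
have [[//|N] _] := borcherds_left w h1 h2 h3 h4 hm (negbTE hk) tr'.
rewrite !add0r => ->; rewrite big_ord_recl big1 => [|j _]; last first.
  by rewrite gbinom_0S mulr0 scale0r.
by rewrite gbinom0 andbF !mulr1 !scale1r !mulr0 !addr0.
Qed.

Lemma fword_ann1 u n x : 0 <= n ->
  W0 [:: (u, n); x] = mode_form false (u, n) x *: W0 [::].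
Proof.
move=> hn; rewrite (fword_swap _ [::]) /= (@fword_vac _ _ _ _ [:: x]) //.
by rewrite scaler0 subr0.
Qed.

Lemma fword_ann2 u n x y : 0 <= n ->
  W0 [:: (u, n); x; y] =
  mode_form false (u, n) x *: W0 [:: y]
  - (sg * mode_form false (u, n) y) *: W0 [:: x].
Proof.
move=> hn; rewrite (fword_swap _ [::]) /= (fword_swap _ [:: x]) /=.
rewrite (@fword_vac _ _ _ _ [:: x; y]) // scaler0 subr0.
by rewrite scalerA.
Qed.

Definition letter (b : bool) : a := if b then P else M.
Definition lsign (b : bool) : int := if b then 1 else -1.
Local Notation L b := (letter b).

Lemma form_letter_P b : form (L b) P = (~~ b)%:R.
Proof. by case: b; rewrite /letter ?form_PP ?form_MP. Qed.

Lemma form_letter_M b : form (L b) M = sg * b%:R.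
Proof. by case: b; rewrite /letter ?form_MM ?form_PM ?mulr1 ?mulr0. Qed.

Lemma sgsg : sg * sg = 1.
Proof. by rewrite -expr2 sqrr_sign. Qed.

(** A nonnegative mode is contracted with each letter of [jelt]. The sign from passing the first
    letter cancels the one in <P, M>, so the result is the same in the Clifford and Weyl cases. *)
Lemma Y_letter_jelt b (j : nat) :
  Y (gen (L b)) j%:Z (jelt a) = - (j == 0%N)%:R *: ((lsign b)%:~R *: gen (L b)).
Proof.
rewrite jeltE Y_gen fword_ann2 // /mode_form /mode2 /=.
case: j => [|j]; last by rewrite !ifF ?mulr0 ?scale0r ?subr0 ?oppr0 ?scale0r //; lia.
rewrite form_letter_M form_letter_P mulrA sgsg mul1r.
by case: b; rewrite /= !scale0r ?scale1r ?scaleN1r ?subr0 ?sub0r ?opprK.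
Qed.

Lemma Y_letter_omega b (j : nat) :
  Y (gen (L b)) j%:Z (omega a) = 2^-1 *:
   ((j == 1)%:R *: gen (L b) - (j == 0)%:R *: W0 [:: (L b, -2)]).
Proof.
have lr := sva_linear_r (ff_vertex a).
rewrite omegaE (linZ (lr _ _)) (linB (lr _ _)) !Y_gen !fword_ann2 // /mode_form /mode2 /=.
congr (_ *: _).
case: j => [|[|j]] /=; last first.
- by rewrite !ifF ?mulr0 ?scale0r ?subr0 ?oppr0 ?scale0r ?addr0 //; lia.
- rewrite form_letter_M form_letter_P mulrA sgsg mul1r.
  by case: b; rewrite /= ?mulr0 !scale0r ?scale1r ?subr0 ?sub0r ?oppr0 ?addr0 ?opprK.
rewrite form_letter_M form_letter_P mulrA sgsg mul1r.
by case: b; rewrite /= ?mulr0 !scale0r ?scale1r ?subr0 ?sub0r ?oppr0 ?addr0 ?opprK.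
Qed.

(** The rule that the field of L(-1)u is the derivative of the field of u, in modes. It is the
    Borcherds identity with the vacuum as second entry and middle parameter -2: the right side
    vanishes because the only nonzero vacuum mode, -2, never occurs there. *)
Lemma Yt_derivative u m w : odd `|m|%N ->
  Yt (W0 [:: (u, -2)]) m w = - (m%:~R / 2) *: Yt (gen u) (m - 2) w.
Proof.
move=> hm; have h1 := fpar_sign [:: (u, -1 : int)].
have h3 := fsign_sign [:: (u, -1 : int)].
have h2 := fpar_sign [::]; have h4 := fsign_sign [::].
have tr (j : nat) : (2 < j)%N -> Y (gen u) (-2 + j%:Z) (W0 [::]) = 0.
  by move=> hj; rewrite Y_gen (@fword_vac _ _ _ _ [::]) //=; lia.
have [N _] := @borcherds_left _ _ _ _ _ _ w m (-2) 0 h1 h2 h3 h4 hm erefl tr.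
rewrite big1 => [|j _]; last first.
  rewrite !twisted_fock_vacuum !ifF; try lia.
  by have [_ lr _] := twisted_fock_modes; rewrite (lin0 (lr _ _)) !(scaler0, subr0).
rewrite !Y_gen (@fword_vac _ _ _ _ [::] (u, -2 + 2)) //= addr0.
have [ll _ _] := twisted_fock_modes; rewrite (lin0 (ll _ _)) scaler0 addr0.
by move/eqP; rewrite addr_eq0 => /eqP ->; rewrite scaleNr.
Qed.

Lemma fsign_omega : has_sign (fsign a false) false (omega a).
Proof.
have sl := @fsign_linear _ _ a false.
by rewrite /has_sign omegaE (linZ sl) (linB sl) !fsign_word sqrrN expr1n !scale1r.
Qed.

Lemma commutator_jelt b n w :
  Yt (jelt a) 0 (Yt (gen (L b)) (2 * n - 1) w) =
  Yt (gen (L b)) (2 * n - 1) (Yt (jelt a) 0 w)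
  + (lsign b)%:~R *: Yt (gen (L b)) (2 * n - 1) w.
Proof.
have pj : has_sign (fpar a false) false (jelt a) by rewrite /has_sign fpar_jelt scale1r.
have tr (j : nat) : (2 < j)%N -> Y (gen (L b)) j (jelt a) = 0.
  by case: j => [|j] // _; rewrite Y_letter_jelt oppr0 scale0r.
have := @commutator_left (L b) (jelt a) w n 0 pj fsign_jelt erefl tr.
have [ll _ _] := twisted_fock_modes.
rewrite (Y_letter_jelt b 0) (Y_letter_jelt b 1) (Y_letter_jelt b 2) /=.
rewrite !oppr0 !scale0r !(lin0 (ll _ _)) !scaler0 !addr0 scaleN1r.
rewrite (linN (ll _ _)) (linZ (ll _ _)) => /eqP; rewrite eq_sym subr_eq => /eqP ->.
by rewrite addrAC addNr add0r.
Qed.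

Lemma commutator_omega b n w :
  Yt (omega a) 2 (Yt (gen (L b)) (2 * n - 1) w) =
  Yt (gen (L b)) (2 * n - 1) (Yt (omega a) 2 w)
  - n%:~R *: Yt (gen (L b)) (2 * n - 1) w.
Proof.
have po : has_sign (fpar a false) false (omega a) by rewrite /has_sign fpar_omega scale1r.
have tr (j : nat) : (2 < j)%N -> Y (gen (L b)) j (omega a) = 0.
  by case: j => [|[|j]] // _; rewrite Y_letter_omega !scale0r subr0 scaler0.
have := @commutator_left (L b) (omega a) w n 2 po fsign_omega erefl tr.
have [ll _ _] := twisted_fock_modes.
rewrite (Y_letter_omega b 0) (Y_letter_omega b 1) (Y_letter_omega b 2) /=.
rewrite !scale0r !subr0 !sub0r !scale1r !scaler0 !(lin0 (ll _ _)) !scaler0 !addr0.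
move: (omega a) {po tr} => om.
rewrite !(linZ (ll _ _)) (linN (ll _ _)) Yt_derivative; last by lia.
rewrite addrK scalerN !scalerA -scaleNr -scalerDl.
set z := Yt (gen _) _ w; set x := Yt _ _ (Yt _ _ w); set y := Yt _ _ z.
(* The two terms come from the derivative of the field and from the pole of order 2 in its product
   with [omega]. *)
suff -> : (- (2^-1 * - ((2 * n - 1 + 2)%:~R / 2)) + (2 * n - 1)%:~R / 2 / 2 : K) = n%:~R.
  by move=> ->; rewrite subKr.
by rewrite !rmorphD !rmorphM /= !rmorphN /=; field.
Qed.

Let odd_mode m : odd `|m|%N -> exists n, m = 2 * n - 1.
Proof. by move=> hm; exists ((m + 1) %/ 2)%Z; lia. Qed.

Lemma Yt_gen_vac u m : odd `|m|%N -> 1 <= m -> Yt (gen u) m (W1 [::]) = 0.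
Proof.
move=> /odd_mode[n ->] h1; rewrite Yt_gen (@fword_vac _ _ _ _ [::]) //=.
by apply/orP; left; lia.
Qed.

Lemma Yt_plus_vac m : odd `|m|%N -> -1 <= m -> Yt (gen P) m (W1 [::]) = 0.
Proof.
move=> /odd_mode[n ->] h1; rewrite Yt_gen (@fword_vac _ _ _ _ [::]) //= vplus_in andbT.
by lia.
Qed.

Let mode_lin m : Yt 0 m =1 fun=> 0.
Proof. by have [ll _ _] := twisted_fock_modes; move=> w; exact: lin0 (ll _ _). Qed.

(** The indices -1 and 1 are chosen so that every term on the right of the Borcherds identity kills
    the vacuum, P(0) and M(1) being the extreme cases. The left side is then J(0) minus half of <P,
    M>. *)
Lemma jelt_vacuum : Yt (jelt a) 0 (W1 [::]) = (sg / 2) *: W1 [::].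
Proof.
have [ll lr _] := twisted_fock_modes.
have h1 := fpar_sign [:: (P, -1 : int)].
have h2 := fpar_sign [:: (M, -1 : int)].
have h3 := fsign_sign [:: (P, -1 : int)].
have h4 := fsign_sign [:: (M, -1 : int)].
have tr (j : nat) : (2 < j)%N -> Y (gen P) (-1 + j%:Z) (gen M) = 0.
  by move=> hj; rewrite Y_gen fword_ann1 ?/mode_form /mode2 /= ?ifF ?scale0r //; lia.
have [N _] := @borcherds_left _ _ _ _ _ _ (W1 [::]) (-1) (-1) 1 h1 h2 h3 h4 erefl erefl tr.
rewrite big1 => [|j _]; last first.
  rewrite (@Yt_gen_vac M (1 + _)) ?(@Yt_plus_vac (-1 + _)); try lia.
  by rewrite !(lin0 (lr _ _)) scaler0 subr0 scaler0.
rewrite !Y_gen -jeltE !fword_ann1 //= /mode_form /mode2 /= form_PM.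
rewrite scale0r mode_lin scaler0 addr0 (linZ (ll _ _)) twisted_fock_vacuum /=.
move/eqP; rewrite addr_eq0 => /eqP ->; rewrite scalerA -scaleNr; congr (_ *: _).
by field.
Qed.

(** The argument of [jelt_vacuum] with index 3 in place of 1, so that the total index is that of
    L(0). The binomials of -1/2 are -1/2 and 3/8; the two words have eigenvalues -1/8 and -3/8 times
    (-1)^eps, and half of the difference is 1/8. *)
Lemma omega_vacuum : Yt (omega a) 2 (W1 [::]) = (sg / 8) *: W1 [::].
Proof.
have [ll lr _] := twisted_fock_modes.
have h1 := fpar_sign [:: (P, -1 : int)].
have h2 := fpar_sign [:: (M, -1 : int)].
have h3 := fsign_sign [:: (P, -1 : int)].
have h4 := fsign_sign [:: (M, -1 : int)].
have h2' := fpar_sign [:: (M, -2 : int)].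
have h4' := fsign_sign [:: (M, -2 : int)].
have e1 : Yt (W0 [:: (P, -2); (M, -1)]) 2 (W1 [::]) = (- sg / 8) *: W1 [::].
  have tr (j : nat) : (2 < j)%N -> Y (gen P) (-2 + j%:Z) (gen M) = 0.
    by move=> hj; rewrite Y_gen fword_ann1 ?/mode_form /mode2 /= ?ifF ?scale0r //; lia.
  have [N _] := @borcherds_left _ _ _ _ _ _ (W1 [::]) (-1) (-2) 3 h1 h2 h3 h4 erefl erefl tr.
  rewrite big1 => [|j _]; last first.
    rewrite (@Yt_gen_vac M (3 + _)) ?(@Yt_plus_vac (-1 + _)); try lia.
    by rewrite !(lin0 (lr _ _)) scaler0 subr0 scaler0.
  rewrite !Y_gen -jeltE (@fword_ann1 P (-2 + 2)) //= /mode_form /mode2 /= form_PM.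
  rewrite (linZ (ll _ _)) twisted_fock_vacuum /= jelt_vacuum.
  move/eqP; rewrite -addrA addr_eq0 => /eqP ->.
  rewrite !scalerA -scalerDl -scaleNr; congr (_ *: _).
  by field.
have e2 : Yt (W0 [:: (P, -1); (M, -2)]) 2 (W1 [::]) = (- (sg * 3) / 8) *: W1 [::].
  have tr (j : nat) : (2 < j)%N -> Y (gen P) (-1 + j%:Z) (W0 [:: (M, -2)]) = 0.
    by move=> hj; rewrite Y_gen fword_ann1 ?/mode_form /mode2 /= ?ifF ?scale0r //; lia.
  have [N _] := @borcherds_left _ _ _ _ _ _ (W1 [::]) (-1) (-1) 3 h1 h2' h3 h4' erefl erefl tr.
  rewrite big1 => [|j _]; last first.
    rewrite Yt_derivative; last by lia.
    rewrite (@Yt_gen_vac M (3 + _ - 2)) ?(@Yt_plus_vac (-1 + _)); try lia.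
    by rewrite scaler0 !(lin0 (lr _ _)) scaler0 subr0 scaler0.
  rewrite !Y_gen (@fword_ann1 P (-1 + 1)) // (@fword_ann1 P (-1 + 2)) //= /mode_form /mode2 /= form_PM.
  rewrite scale0r mode_lin scaler0 addr0 (linZ (ll _ _)) twisted_fock_vacuum /=.
  move/eqP; rewrite addr_eq0 => /eqP ->.
  rewrite !scalerA -scaleNr; congr (_ *: _).
  by field.
rewrite omegaE (linZ (ll _ _)) (linB (ll _ _)) e1 e2 -scalerBl scalerA.
by congr (_ *: _); field.
Qed.

(* The creation modes a^+(-n) with n > 0 and a^-(-n) with n >= 0 are numbered
   2n - 1 and 2n. *)
Definition create (k : nat) : a * int := (letter (odd k), - (uphalf k)%:Z).
Definition create_word (t : seq nat) : fock a true := W1 [seq create k | k <- t].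

Let create_mode k s :
  W1 (create k :: s) = Yt (gen (L (odd k))) (2 * - (uphalf k)%:Z - 1) (W1 s).
Proof. by rewrite Yt_gen. Qed.

Lemma jelt_word t : Yt (jelt a) 0 (create_word t) =
  (sg / 2 + (\sum_(k <- t) lsign (odd k))%:~R) *: create_word t.
Proof.
rewrite /create_word; elim: t => [|k t IH].
  by rewrite big_nil addr0 jelt_vacuum.
have [_ lr _] := twisted_fock_modes.
rewrite map_cons create_mode commutator_jelt IH (linZ (lr _ _)) -scalerDl big_cons.
by rewrite rmorphD /= addrA addrAC.
Qed.

Lemma omega_word t : Yt (omega a) 2 (create_word t) =
  (sg / 8 + (\sum_(k <- t) uphalf k)%:R) *: create_word t.
Proof.
rewrite /create_word; elim: t => [|k t IH].
  by rewrite big_nil addr0 omega_vacuum.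
have [_ lr _] := twisted_fock_modes.
rewrite map_cons create_mode commutator_omega IH (linZ (lr _ _)) -scalerBl big_cons.
by rewrite natrD rmorphN opprK addrA addrAC.
Qed.

End FreeFieldModes.

(** * A basis of the Fock space *)

Section OccupationModel.
Context (K : numClosedFieldType) (eps : bool).
Local Open Scope mset_scope.
Local Notation St := {mset nat}.
Local Notation F := (St -> K^o).
Implicit Types (f g : F) (A B : St) (k l : nat).

(** The exchange sign: 1 for bosons and -1 for fermions. *)
Let eta : K := - (-1) ^+ eps.
(** The value of the number operator, annihilation followed by creation, at occupation n. The parity
    in the fermionic case makes the model a representation on functions of all multisets,
    repetitions included. *)
Let nu (n : nat) : nat := if eps then n else odd n.
Let sg A k : K := eta ^+ (\sum_(j < k) A j).

Let scaleF c f A : (c *: f) A = c * f A. Proof. by []. Qed.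
Let addF f g A : (f + g) A = f A + g A. Proof. by []. Qed.
Let oppF f A : (- f) A = - f A. Proof. by []. Qed.

Let eta2 : eta * eta = 1.
Proof. by rewrite mulrNN -expr2 sqrr_sign. Qed.

Let eta_cases : eta = if eps then 1 else -1.
Proof. by rewrite /eta; case: (eps); rewrite ?expr0 ?expr1 ?opprK. Qed.

Let nu0 : nu 0 = 0%N. Proof. by rewrite /nu; case: (eps). Qed.

Let nuS n : (nu n.+1)%:R - eta * (nu n)%:R = 1 :> K.
Proof.
rewrite eta_cases /nu; case: (eps) => /=.
  by rewrite mul1r -natr1 addrAC subrr add0r.
by case: (odd n); rewrite /= mulN1r opprK ?add0r ?addr0.
Qed.

Let nuSS n : eta = -1 -> nu n != 0%N -> nu n.+1 = 0%N.
Proof.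
rewrite eta_cases /nu; case: (eps) => /= [/eqP|_]; last by case: (odd n).
by rewrite -subr_eq0 opprK -mulr2n pnatr_eq0.
Qed.

Let sg2 A k : sg A k * sg A k = 1.
Proof. by rewrite -exprMn eta2 expr1n. Qed.

Let sgS A k l : sg (k +` A) l = (if (k < l)%N then eta else 1) * sg A l.
Proof.
rewrite /sg; under eq_bigr do rewrite mset1DE.
rewrite big_split /= exprD; congr (_ * _).
case: ltnP => kl.
  rewrite (bigD1 (Ordinal kl)) //= eqxx big1 ?expr1 // => i.
  by rewrite -val_eqE /= => /negPf ->.
by rewrite big1 ?expr0 // => i _; case: eqP => // e; have := ltn_ord i; lia.
Qed.

Let cre k f A : K := if nu (A k) != 0%N then sg A k * f (A `\ k) else 0.
Let ann k f A : K := (nu (A k).+1)%:R * sg A k * f (k +` A).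
(* cre k and ann k satisfy the commutation relations of the creation mode k and
   of its adjoint; sg is the sign of moving k to its place in an ordered word. *)
Definition opk (c : bool) k : F -> F := if c then cre k else ann k.

Let mset1DK k A : (0 < A k)%N -> k +` (A `\ k) = A.
Proof. by rewrite mset_gt0; exact: msetB1K. Qed.

Let nu_gt0 n : nu n != 0%N -> (0 < n)%N.
Proof. by case: n => //; rewrite nu0. Qed.

Let cre_cre k l f : cre k (cre l f) = eta *: cre l (cre k f).
Proof.
apply/funext => A; rewrite scaleF /cre.
have [<-|kl] := eqVneq k l.
  case: ifP => [h1|_]; last by rewrite mulr0.
  have e := mset1DK (nu_gt0 h1); move: (A `\ k) e h1 => B <- h1.
  rewrite ?mset1DE eqxx add1n /= in h1 *; case: ifP => [h2|_]; last by rewrite !mulr0.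
  move: h1; rewrite eta_cases; case: (boolP eps) => [_|he]; first by rewrite mul1r.
  by rewrite nuSS // eta_cases (negPf he).
have lk : (l == k) = false by rewrite eq_sym (negPf kl).
rewrite !msetB1E (negPf kl) lk !subn0.
have [h1|h1] := boolP (nu (A k) != 0%N); have [h2|h2] := boolP (nu (A l) != 0%N);
  rewrite /= ?mulr0 //.
have e1 := mset1DK (nu_gt0 h1); have hl : (0 < (A `\ k) l)%N.
  by rewrite msetB1E lk subn0 nu_gt0.
have e2 := mset1DK hl; move: (A `\ k `\ l) e2 => B e2.
have {e1 e2 h1 h2 hl} -> : A = k +` (l +` B) by rewrite e2.
rewrite msetD1K [k +` (l +` B)]msetDCA !msetD1K !sgS !ltnn !mul1r.
by case: ltngtP kl => // _ _; rewrite ?mul1r; ring: eta2.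
Qed.

Let ann_ann k l f : ann k (ann l f) = eta *: ann l (ann k f).
Proof.
apply/funext => A; rewrite scaleF /ann !mset1DE.
have [<-|kl] := eqVneq k l.
  rewrite add1n; case: (eqVneq (nu (A k).+1) 0%N) => [->|h].
    by rewrite !mul0r mulr0.
  rewrite eta_cases; case: (boolP eps) => [_|he]; first by rewrite mul1r.
  by rewrite (@nuSS (A k).+1) // ?mul0r ?mulr0 // eta_cases (negPf he).
rewrite !add0n msetDCA !sgS.
by case: ltngtP kl => // _ _; rewrite ?mul1r; ring: eta2.
Qed.

Let ann_cre k l f : ann k (cre l f) - eta *: cre l (ann k f) = (k == l)%:R *: f.
Proof.
apply/funext => A; rewrite addF oppF !scaleF /ann /cre.
have [<-|kl] := eqVneq k l.
  rewrite mset1DE eqxx add1n msetD1K sgS ltnn mul1r mul1r.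
  have -> : (if nu (A k) != 0%N then
     sg A k * ((nu ((A `\ k) k).+1)%:R * sg (A `\ k) k * f (k +` (A `\ k)))
     else 0) = (nu (A k))%:R * f A.
    case: ifP => [h|/negbFE/eqP ->]; last by rewrite mul0r.
    have e := mset1DK (nu_gt0 h); move: (A `\ k) e h => B <- _.
    by rewrite mset1DE eqxx add1n sgS ltnn mul1r; ring: (sg2 B k).
  case: ifP => [_|/negbFE/eqP h].
    rewrite -[RHS]mul1r -[X in _ = X * _](nuS (A k)) mulrBl mulrA; congr (_ - _).
      by ring: (sg2 A k).
    by rewrite mulrA.
  have := nuS (A k); rewrite h => e; rewrite -[RHS]mul1r -[X in _ = X * _]e.
  by rewrite mulr0; ring.
have lk : (l == k) = false by rewrite eq_sym (negPf kl).
rewrite mul0r mset1DE lk add0n.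
case: ifP => [h|_]; last by rewrite !mulr0 subr0.
have e := mset1DK (nu_gt0 h); move: (A `\ l) e h => B <- _.
rewrite !mset1DE (negPf kl) msetDCA msetD1K !sgS ltnn !mul1r add0n.
by case: ltngtP kl => // _ _; rewrite ?mul1r; ring: eta2.
Qed.

Let bracket_swap (h : K) (X Y Z : F) : h * h = 1 -> X - h *: Y = Z ->
  Y - h *: X = - h *: Z.
Proof.
move=> hh <-; rewrite scalerBr scalerA mulNr hh scaleN1r opprK addrC.
by rewrite scaleNr.
Qed.

Definition bracket (X Y : F -> F) f : F := X (Y f) - eta *: Y (X f).

Lemma opk_bracket c c' k l f : bracket (opk c k) (opk c' l) f =
  ((c != c') && (k == l))%:R *: ((if c then - eta else 1) *: f).
Proof.
rewrite /bracket; case: c; case: c'; rewrite /= ?scale0r.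
- by rewrite cre_cre subrr.
- have := ann_cre l k f; rewrite (eq_sym k l) => e.
  by rewrite scalerA mulrC -scalerA (bracket_swap eta2 e).
- by rewrite ann_cre scale1r.
- by rewrite ann_ann subrr.
Qed.

Lemma opk_linear c k : linear (opk c k).
Proof.
move=> d f g; apply/funext => A; rewrite /opk; case: c.
  rewrite addF scaleF /cre; case: ifP => _; last by rewrite mulr0 addr0.
  by rewrite addF scaleF; ring.
by rewrite addF scaleF /ann addF scaleF; ring.
Qed.

Definition delta A : F := fun B => (B == A)%:R.

Lemma ann_vac k : opk false k (delta mset0) = 0.
Proof.
apply/funext => A; rewrite /= /ann /delta.
suff -> : (k +` A == mset0) = false by rewrite mulr0.
by apply/eqP => /(congr1 (fun B : St => B k)); rewrite mset1DE mset0E eqxx.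
Qed.

Lemma cre_delta k A : eps || (A k == 0%N) ->
  exists2 c, c != 0 & opk true k (delta A) = c *: delta (k +` A).
Proof.
move=> h; exists (sg A k).
  by apply/eqP => e; have /eqP := sg2 A k; rewrite e mul0r eq_sym oner_eq0.
apply/funext => B; rewrite scaleF /= /cre /delta.
have [->|BA] := eqVneq B (k +` A).
  rewrite mset1DE eqxx add1n msetD1K eqxx sgS ltnn mul1r ifT //.
  by move: h; rewrite /nu; case: (eps) => //= /eqP ->.
case: ifP => [h1|_]; last by rewrite mulr0.
suff -> : (B `\ k == A) = false by rewrite !mulr0.
by apply/eqP => e; move: BA; rewrite -e mset1DK ?eqxx // nu_gt0.
Qed.

End OccupationModel.

Section FockBasis.
Context (K : numClosedFieldType) (eps : bool) (a : free_field K eps 2).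
Local Notation St := {mset nat}%mset.
Local Notation F := (St -> K^o).
Local Notation P := (vplus a).
Local Notation M := (vminus a).
Local Notation form := (pol_form a).
Local Notation sgn := ((-1) ^+ eps : K).
Local Notation W1 := (@fword K eps a true).
Local Notation br := (@bracket K eps).
Local Notation opk := (@opk K eps).

Let scaleF c (f : F) A : (c *: f) A = c * f A. Proof. by []. Qed.
Let addF (f g : F) A : (f + g) A = f A + g A. Proof. by []. Qed.
Let oppF (f : F) A : (- f) A = - f A. Proof. by []. Qed.

(** The action of P(n), followed by that of M(n), in the numbering of [create]: a mode that does not
    create annihilates the creation mode it pairs with. The factor in the annihilating P(n) is <P,
    M>, whereas <M, P> = 1. *)
Let opP (n : int) (f : F) : F :=
  if n < 0 then opk true (2 * `|n|).-1 f else sgn *: opk false (2 * `|n|) f.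
Let opM (n : int) (f : F) : F :=
  if n <= 0 then opk true (2 * `|n|) f else opk false (2 * `|n|).-1 f.
Let op (x : a * int) (f : F) : F :=
  form M x.1 *: opP x.2 f + form x.1 P *: opM x.2 f.

Let opP_linear n : linear (opP n).
Proof.
move=> c f g; rewrite /opP; case: ifP => _; rewrite opk_linear //.
by rewrite scalerDr !scalerA mulrC.
Qed.

Let opM_linear n : linear (opM n).
Proof. by move=> c f g; rewrite /opM; case: ifP => _; rewrite opk_linear. Qed.

Let op_linear x : linear (op x).
Proof.
move=> c f g; rewrite /op opP_linear opM_linear !scalerDr addrACA !scalerA.
by rewrite ![_ * c]mulrC.
Qed.

Let op_linear_l n f : linear (fun u : a => op (u, n) f).
Proof.
move=> c u v; rewrite /op /= (form_linear_l P c u v) (form_linear_r M c u v).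
by rewrite !scalerDl scalerDr !scalerA addrACA.
Qed.

Let brP X Y (c : K) f : linear X -> br X (fun g => c *: Y g) f = c *: br X Y f.
Proof.
by move=> Xl; rewrite /bracket (linZ Xl) scalerBr !scalerA mulrC.
Qed.

Let brPl X Y (c : K) f : linear Y -> br (fun g => c *: X g) Y f = c *: br X Y f.
Proof.
by move=> Yl; rewrite /bracket (linZ Yl) scalerBr !scalerA mulrC.
Qed.

Let PP n n' f : br (opP n) (opP n') f = 0.
Proof.
have e1 : ((2 * `|n|).-1 == 2 * `|n'| :> nat)%N = false \/ ~ n < 0.
  by case: ltP => h; [left; lia|right].
have e2 : (2 * `|n| == (2 * `|n'|).-1 :> nat)%N = false \/ ~ n' < 0.
  by case: (ltP n') => h; [left; lia|right].
rewrite /opP; case: ltP e1 e2 => h e1; case: ltP => h' e2.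
- by rewrite opk_bracket scale0r.
- rewrite (@brP _ (opk false _)) ?opk_bracket; last exact: opk_linear.
  by case: e1 => // ->; rewrite scale0r scaler0.
- rewrite (@brPl (opk false _)) ?opk_bracket; last exact: opk_linear.
  by case: e2 => // ->; rewrite scale0r scaler0.
rewrite (@brPl (opk false _)); last first.
  by move=> c g g'; rewrite opk_linear scalerDr !scalerA mulrC.
rewrite (@brP _ (opk false _)) ?opk_bracket ?scale0r ?scaler0 //.
exact: opk_linear.
Qed.

Let MM n n' f : br (opM n) (opM n') f = 0.
Proof.
rewrite /opM; case: (leP n 0) => h; case: (leP n' 0) => h'; rewrite opk_bracket /= ?scale0r //.
  by rewrite (_ : (_ == _) = false) ?scale0r //; lia.
by rewrite (_ : (_ == _) = false) ?scale0r //; lia.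
Qed.

Let PM n n' f : br (opP n) (opM n') f = (n + n' == 0)%:R *: (sgn *: f).
Proof.
rewrite /opP /opM; case: (ltP n 0) => h; case: (leP n' 0) => h'.
- rewrite opk_bracket scale0r (_ : (n + n' == 0) = false) ?scale0r //; lia.
- rewrite opk_bracket /= opprK.
  by rewrite (_ : (_ == _) = (n + n' == 0)) //; lia.
- rewrite (@brPl (opk false _)); last exact: opk_linear.
  rewrite opk_bracket /= scale1r scalerA mulrC -scalerA.
  by rewrite (_ : (_ == _) = (n + n' == 0)) //; lia.
rewrite (@brPl (opk false _)); last exact: opk_linear.
rewrite opk_bracket scale0r scaler0 (_ : (n + n' == 0) = false) ?scale0r //; lia.
Qed.

Let MP n n' f : br (opM n) (opP n') f = (n + n' == 0)%:R *: f.
Proof.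
rewrite /opP /opM; case: (leP n 0) => h; case: (ltP n' 0) => h'.
- rewrite opk_bracket scale0r (_ : (n + n' == 0) = false) ?scale0r //; lia.
- rewrite (@brP _ (opk false _)); last exact: opk_linear.
  rewrite opk_bracket /= opprK !scalerA mulrCA -expr2 sqrr_sign mulr1.
  by rewrite (_ : (_ == _) = (n + n' == 0)) //; lia.
- rewrite opk_bracket /= scale1r.
  by rewrite (_ : (_ == _) = (n + n' == 0)) //; lia.
rewrite (@brP _ (opk false _)); last exact: opk_linear.
rewrite opk_bracket scale0r scaler0 (_ : (n + n' == 0) = false) ?scale0r //; lia.
Qed.

(** The defining relation of the Clifford or Weyl algebra in the model; by bilinearity it reduces to
    the four brackets of [opP] and [opM]. *)
Let op_bracket x y f : op x (op y f) + sgn *: op y (op x f) = mode_form true x y *: f.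
Proof.
case: x y => [u n] [v n'].
have -> : mode_form true (u, n) (v, n') =
    (n + n' == 0)%:R * (form M u * form v P * sgn + form u P * form M v).
  rewrite /mode_form /mode2 /= (_ : (_ == 0) = (n + n' == 0)); last by lia.
  case: (n + n' == 0); rewrite ?mul0r ?mul1r //.
  rewrite [u in LHS](form_decomp (a := a)) [v in LHS](form_decomp (a := a)).
  rewrite !(linD (form_linear_r _)) !(linD (form_linear_l _)).
  rewrite !(linZ (form_linear_r _)) !(linZ (form_linear_l _)).
  rewrite form_PP form_MM form_PM form_MP /GRing.scale /=; ring.
transitivity (
  (form M u * form M v) *: br (opP n) (opP n') f
  + (form M u * form v P) *: br (opP n) (opM n') f
  + (form u P * form M v) *: br (opM n) (opP n') f
  + (form u P * form v P) *: br (opM n) (opM n') f).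
  rewrite /op /= !(linD (opP_linear _)) !(linD (opM_linear _)).
  rewrite !(linZ (opP_linear _)) !(linZ (opM_linear _)) /bracket.
  move: (opP n) (opP n') (opM n) (opM n') => p p' m m'.
  by apply/funext => A; rewrite !(addF, oppF, scaleF) /= !mulNr !opprK; ring.
rewrite PP PM MP MM !scaler0 add0r addr0 !scalerA -scalerDl; congr (_ *: _).
by ring.
Qed.

Let vac : F := delta K mset0%mset.
Let ops (s : seq (a * int)) (f : F) : F := foldr op f s.

Let ops_linear s : linear (ops s).
Proof. by elim: s => [|x s IH] c f g //=; rewrite IH op_linear. Qed.

Let op_annihilator x : annihilator true x -> op x vac = 0.
Proof.
case: x => u n /= h; rewrite /op /=.
have eP : 0 <= n -> opP n vac = 0.
  by move=> hn; rewrite /opP ltNge hn ann_vac scaler0.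
have [n0|n0] := boolP (0 < n).
  by rewrite eP ?(ltW n0) // /opM leNgt n0 ann_vac !scaler0 addr0.
move: h eP; rewrite (negPf n0) /= => /andP[/eqP -> up] eP.
rewrite eP // scaler0 add0r.
by rewrite (pol_isotropic_plus (p := a)) ?scale0r // vplus_in.
Qed.

Let model_kills r : fock_rel true r -> fglift (ops^~ vac : seq (a * int) -> F) r = 0.
Proof.
have cat s t : ops (s ++ t) vac = ops s (ops t vac) by rewrite /ops foldr_cat.
case=> [s t c u v n|s t x y|s x hx];
  rewrite ?(linearB, linearD, linearZ) /= ?scalerN !liftU !scale1r.
- rewrite !cat /= op_linear_l (linD (ops_linear _)) (linZ (ops_linear _)).
  by rewrite -addrA -opprD subrr.
- rewrite !cat /=; have := congr1 (ops s) (op_bracket x y (ops t vac)).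
  by rewrite (linD (ops_linear s)) !(linZ (ops_linear s)) => ->; rewrite subrr.
- by rewrite -cats1 cat /= op_annihilator // (lin0 (ops_linear _)).
Qed.

(** A word acts on the vacuum of the occupation model. Since the action respects [fock_rel], this is
    a linear map on the Fock space, and it separates the ordered creation words. *)
Let model : fock a true -> F := quot_lift (ops^~ vac).

Let model_linear : linear model.
Proof. exact: quot_lift_linear model_kills. Qed.

Let model_word s : model (W1 s) = ops s vac.
Proof. by rewrite /model quot_liftE ?liftU ?scale1r //; exact: model_kills. Qed.

Let op_create k f : op (create a k) f = opk true k f.
Proof.
rewrite /op /create /= /letter; have e := odd_double_half k.
case: ifP => ok.
  rewrite form_PP form_MP scale1r scale0r addr0 /opP ifT; last by lia.
  by congr (opk true _ f); lia.
rewrite form_MM form_MP scale1r scale0r add0r /opM ifT; last by lia.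
by congr (opk true _ f); lia.
Qed.

Definition admissible (A : {mset nat}%mset) : bool := eps || uniq A.

Lemma count_uniq_mset (k : nat) (t : seq nat) : uniq (k :: t) ->
  seq_mset t k = 0%N.
Proof. by move=> /andP[kt _]; rewrite mset_seqE; apply/count_memPn. Qed.

(** Each creation step moves the indicator of one occupation to the next up to a sign, so distinct
    states have independent images. *)
Let model_create t : eps || uniq t ->
  exists2 c, c != 0 & model (create_word a t) = c *: delta K (seq_mset t).
Proof.
rewrite /create_word model_word; elim: t => [|k t IH] /= ht.
  exists 1; rewrite ?oner_eq0 // scale1r /vac; congr (delta _ _).
  by apply/msetP => k; rewrite mset_seqE mset0E.
have [|c c0 e] := IH; first by move: ht; case: (eps) => //= /andP[].
have [|d d0 e'] := @cre_delta K eps k (seq_mset t).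
  by move: ht; case: (eps) => //= ht; apply/eqP/count_uniq_mset.
exists (c * d); first by rewrite mulf_neq0.
rewrite op_create e (linZ (@opk_linear K eps true k)) e' scalerA.
congr (_ *: delta _ _); apply/msetP => j.
by rewrite mset1DE !mset_seqE /= eq_sym.
Qed.

Let fop_linear x : linear (@fop K eps a true x).
Proof.
have [_ lr _] := twisted_fock_modes a; case: x => u n c w w'.
by rewrite -!ff_Yt_gen lr.
Qed.

Local Notation S := [set create_word a t | t in setT].

(** Two creation indices sum to 0 only when both are 0; then both letters are M, which is
    isotropic. *)
Let swap_create k l s :
  W1 (create a k :: create a l :: s) = - sgn *: W1 (create a l :: create a k :: s).
Proof.
rewrite (fword_swap _ [::]) /= scaleNr.
suff -> : mode_form true (create a k) (create a l) = 0 by rewrite scale0r sub0r.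
rewrite /mode_form /mode2 /=; case: ifP => // h.
have ok : odd k = false by lia.
have ol : odd l = false by lia.
by rewrite /letter ok ol form_MM.
Qed.

Let sgn_neq0 : - sgn != 0 :> K.
Proof. by rewrite oppr_eq0 signr_eq0. Qed.

Let move_create k s1 s2 : exists2 c : K, c != 0 &
  create_word a (k :: s1 ++ s2) = c *: create_word a (s1 ++ k :: s2).
Proof.
elim: s1 => [|l s1 [c c0 IH]]; first by exists 1; rewrite ?oner_eq0 ?scale1r.
exists (- sgn * c); first by rewrite mulf_neq0.
rewrite /create_word /= swap_create -scalerA; congr (_ *: _).
have := congr1 (fop (create a l)) IH.
by rewrite (linZ (fop_linear _)) /create_word !fopE.
Qed.

Let perm_create s t : perm_eq s t -> exists2 c : K, c != 0 &
  create_word a s = c *: create_word a t.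
Proof.
elim: s t => [|k s IH] t.
  by rewrite perm_sym => /perm_nilP ->; exists 1; rewrite ?oner_eq0 ?scale1r.
move=> st; have kt : k \in t by rewrite -(perm_mem st) mem_head.
case/splitPr: kt st => t1 t2; rewrite perm_sym perm_catC /= perm_cons perm_catC.
rewrite perm_sym => /IH[c c0 e]; have [d d0 e'] := move_create k t1 t2.
exists (c * d); first by rewrite mulf_neq0.
rewrite -scalerA -e'; have := congr1 (fop (create a k)) e.
by rewrite (linZ (fop_linear _)) /create_word !fopE.
Qed.

(** In the Clifford case two equal letters are brought side by side; exchanging them changes the
    sign of the word, which is therefore 0. *)
Let create_dup t : ~~ (eps || uniq t) -> create_word a t = 0.
Proof.
rewrite negb_or => /andP[he].
have sgn1 : sgn = 1 by rewrite (negPf he) expr0.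
elim: t => [//|k t IH] /=; rewrite negb_and negbK => /orP[|/IH e]; last first.
  by rewrite /create_word /= -fopE -/(create_word a t) e (lin0 (fop_linear _)).
move=> kt; case/splitPr: kt => t1 t2; have [c _ e] := move_create k t1 (t2).
have [|d _ ->] := @perm_create (k :: t1 ++ k :: t2) (k :: k :: t1 ++ t2).
  by rewrite perm_cons perm_catC /= perm_cons perm_catC.
suff -> : create_word a (k :: k :: t1 ++ t2) = 0 by rewrite scaler0.
have := swap_create k k [seq create a j | j <- t1 ++ t2].
rewrite sgn1 scaleN1r => /eqP; rewrite -addr_eq0 -mulr2n -scaler_nat scaler_eq0.
by rewrite pnatr_eq0 => /eqP.
Qed.

Let fop_create_span k v : lin_span S v -> lin_span S (fop (create a k) v).
Proof.
move: v; apply: lin_span_min => [|c _ v [t _ <-] h].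
  by rewrite (lin0 (fop_linear _)); exact: lin_span0.
rewrite fop_linear; apply: lin_spanD => //; apply/lin_spanZ/lin_span_gen.
by exists (k :: t) => //; rewrite /create_word /= fopE.
Qed.

Let create_span t : lin_span S (create_word a t).
Proof. by apply: lin_span_gen; exists t. Qed.

(** A letter either is a creation mode or kills the vacuum. In the second case it is commuted to the
    right end of the word, each step leaving a shorter creation word. *)
Let fop_letter_span b n t : lin_span S (fop (letter a b, n) (create_word a t)).
Proof.
have [h|h] := boolP (annihilator true (letter a b, n)); last first.
  suff -> : (letter a b, n) = create a (if b then (2 * `|n|).-1 else 2 * `|n|)%N.
    exact: fop_create_span.
  move: h; rewrite /annihilator /= negb_or negb_and.
  case: b; rewrite /create /letter ?vplus_in ?orbF => h.
    by rewrite ifT; [congr (_, _)|]; lia.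
  by rewrite ifF; [congr (_, _)|]; lia.
rewrite fopE; elim: t => [|k t IH] /=.
  by rewrite (@fword_vac _ _ _ _ [::]) //; exact: lin_span0.
rewrite (fword_swap _ [::]) /= -scaleN1r scalerA.
apply: lin_spanD; apply: lin_spanZ; first exact: create_span.
by rewrite -fopE; exact: fop_create_span.
Qed.

Let word_span s : lin_span S (W1 s).
Proof.
elim: s => [|[u n] s IH]; first by apply: lin_span_gen; exists [::].
rewrite -fopE; move: (W1 s) IH; apply: lin_span_min => [|c _ v [t _ <-] h].
  by rewrite (lin0 (fop_linear _)); exact: lin_span0.
rewrite fop_linear; apply: lin_spanD => //; apply: lin_spanZ.
rewrite fopE [u in (u, n)](form_decomp (a := a)).
rewrite (fword_linear true [::]) (linZ (fword_linear true [::] _ _)) -!fopE.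
by apply: lin_spanD; apply: lin_spanZ;
  [exact: (fop_letter_span true)|exact: (fop_letter_span false)].
Qed.

Definition state_word (A : {mset nat}%mset) : fock a true := create_word a A.

(** Dividing by the value of the model at [A] itself normalizes the scalar of [model_create], which
    is only known to be nonzero. *)
Definition state_dual (A : {mset nat}%mset) (x : fock a true) : K^o :=
  (model (state_word A) A)^-1 * model x A.

Lemma state_basis : dual_basis admissible state_word state_dual.
Proof.
split=> [A c x y|A B DA DB|v].
- by rewrite /state_dual model_linear addF scaleF mulrDr /GRing.scale /= mulrCA.
- have [c c0 ec] := model_create DA; have [d d0 ed] := model_create DB.
  rewrite /state_dual /state_word ec ed !seq_mset_id !scaleF /delta eqxx mulr1.
  case: (eqVneq A B) => [AB|_]; last by rewrite !mulr0.
  by subst B; move: ed; rewrite ec => /(congr1 (fun f : F => f A));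
    rewrite !scaleF /delta !seq_mset_id !eqxx !mulr1 => <-; rewrite mulVf.
apply: lin_span_trans (fock_span v) => _ [s _ <-].
apply: lin_span_trans (word_span s) => _ [t _ <-].
have [ht|/create_dup ->] := boolP (eps || uniq t); last exact: lin_span0.
have tt : perm_eq t (seq_mset t) by rewrite perm_sym perm_eq_seq_mset.
have [c _ ->] := perm_create tt; apply/lin_spanZ/lin_span_gen.
exists (seq_mset t) => //=; rewrite /admissible; case: (eps) ht => //=.
by rewrite (perm_uniq tt).
Qed.

End FockBasis.

(** * Finite boxes of occupation numbers, charge and level *)

Section OccupationBoxes.
Local Open Scope nat_scope.
Local Notation St := {mset nat}%mset.

Definition mset_of_ffun N M (f : {ffun 'I_N -> 'I_M.+1}) : St :=
  [fsfun k in seq_fset tt (iota 0 N) => if insub k is Some i then f i : nat else 0].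

Lemma mset_of_ffunE N M (f : {ffun 'I_N -> 'I_M.+1}) k :
  mset_of_ffun f k = if insub k is Some i then f i : nat else 0.
Proof.
rewrite fsfunE seq_fsetE mem_iota add0n /=.
by case: ifP => // h; rewrite insubF.
Qed.

Lemma mset_of_ffun_ord N M (f : {ffun 'I_N -> 'I_M.+1}) (i : 'I_N) :
  mset_of_ffun f i = f i.
Proof. by rewrite mset_of_ffunE insubT //= => h; congr (nat_of_ord (f _)); exact: val_inj. Qed.

Lemma mset_of_ffun_inj N M : injective (@mset_of_ffun N M).
Proof.
move=> f g e; apply/ffunP => i; apply/val_inj.
by rewrite /= -!mset_of_ffun_ord e.
Qed.

(** Indexing by finite functions lets a sum over a box be expanded as a product of sums over single
    modes. *)
Definition box N M : {fset St} :=
  [fset mset_of_ffun f | f in {: {ffun 'I_N -> 'I_M.+1}}]%fset.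

Lemma boxP N M (A : St) :
  reflect ((forall k, A k <= M) /\ (forall k, N <= k -> A k = 0)) (A \in box N M).
Proof.
apply: (iffP (imfsetP _ _ _ _)) => [[f _ ->]|[h1 h2]].
  split=> k; rewrite mset_of_ffunE; first by case: insubP => // i _ _; exact: leq_ord.
  by move=> Nk; rewrite insubF // ltnNge Nk.
exists [ffun i : 'I_N => inord (A i)]; first by rewrite inE.
apply/msetP => k; rewrite mset_of_ffunE; case: insubP => [i _ <-|].
  by rewrite ffunE inordK // ltnS.
by rewrite -leqNgt => /h2.
Qed.

Lemma box_mono N N' M M' : N <= N' -> M <= M' -> {subset box N M <= box N' M'}.
Proof.
move=> hN hM A /boxP[h1 h2]; apply/boxP; split=> k.
  exact: leq_trans (h1 k) hM.
by move=> hk; apply: h2; exact: leq_trans hk.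
Qed.

Lemma mset_in_box (A : St) : exists N, A \in box N N.
Proof.
exists (\sum_(k <- finsupp A) (k.+1 + A k)); have bound k : k \in finsupp A ->
    k.+1 + A k <= \sum_(k <- finsupp A) (k.+1 + A k).
  by move=> kA; rewrite [leqRHS](big_fsetD1 k) //= leq_addr.
apply/boxP; split=> k.
  have [kA|kA] := boolP (k \in finsupp A).
    by apply: leq_trans (bound k kA); exact: leq_addl.
  by rewrite memNfinsupp in kA; rewrite (eqP kA).
move=> h; apply/eqP; rewrite -memNfinsupp; apply/negP => kA.
by have := leq_trans (bound k kA) h; lia.
Qed.

Definition mcharge (A : St) : int := \sum_(k <- A) lsign (odd k).
Definition mlevel (A : St) : nat := \sum_(k <- A) uphalf k.

Lemma big_mset_cons (R : Type) (idx : R) (op : Monoid.com_law idx) (F : nat -> R)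
    k (A : St) :
  \big[op/idx]_(j <- (k +` A)%mset) F j = op (F k) (\big[op/idx]_(j <- A) F j).
Proof.
have e : perm_eq (enum_mset (k +` A)%mset) (k :: enum_mset A).
  apply/allP => /= j _; apply/eqP; rewrite /= !count_mem_mset mset1DE.
  by rewrite eq_sym.
by rewrite (perm_big _ e) big_cons.
Qed.

Lemma mset_ind (P : St -> Prop) : P mset0 -> (forall k A, P A -> P (k +` A)%mset) ->
  forall A, P A.
Proof.
move=> P0 PS A; rewrite -(seq_mset_id A); elim: (enum_mset A) => [|k s IH].
  suff -> : seq_mset [::] = mset0 :> St by [].
  by apply/msetP => k; rewrite mset_seqE mset0E.
suff -> : seq_mset (k :: s) = (k +` seq_mset s)%mset by exact: PS.
by apply/msetP => j; rewrite mset1DE !mset_seqE /= eq_sym.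
Qed.

Lemma mcharge_cons k A : mcharge (k +` A)%mset = (lsign (odd k) + mcharge A)%R.
Proof. exact: big_mset_cons. Qed.

Lemma mlevel_cons k A : mlevel (k +` A)%mset = uphalf k + mlevel A.
Proof. exact: big_mset_cons. Qed.

Lemma mlevel_ge (A : St) k : A k * uphalf k <= mlevel A.
Proof.
elim/mset_ind: A => [|j A IH]; first by rewrite mset0E.
rewrite mset1DE mlevel_cons mulnDl leq_add //.
by case: eqP => [->|_]; rewrite ?mul1n ?mul0n.
Qed.

(** A mode of a^+ has charge 1 and level at least 1, a mode of a^- has charge -1; the zero mode has
    level 0, and its multiplicity fills the gap. Charge and level thus bound the number of zero
    modes. *)
Lemma mcharge_le (A : St) : (mcharge A + (A 0%N)%:Z <= (mlevel A)%:Z)%R.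
Proof.
elim/mset_ind: A => [|j A IH].
  by rewrite /mcharge /mlevel enum_mset0 !big_nil mset0E.
rewrite mcharge_cons mlevel_cons mset1DE /lsign; move: IH.
move: (mcharge A) (mlevel A) (A 0) => c l a0.
by case: ifP; lia.
Qed.

(** Mode k has level [uphalf k], which is 0 only for k = 0; this mode has a bound of its own. *)
Lemma mem_box_level (A : St) n : mlevel A <= n -> A 0 <= n -> A \in box (2 * n).+1 n.
Proof.
move=> hl h0; apply/boxP; split=> [[//|k]|k hk].
  by apply: leq_trans hl; apply: leq_trans (mlevel_ge A k.+1); rewrite leq_pmulr.
have h : n < uphalf k by rewrite uphalf_half; have := odd_double_half k; lia.
have := leq_trans (mlevel_ge A k) hl; case: (A k) => // a.
by rewrite mulSn => /(leq_trans (leq_addr _ _)); rewrite leqNgt h.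
Qed.

End OccupationBoxes.

(** * The trace on the twisted module *)

Section LetterWeights.
Context (K : numClosedFieldType).
Implicit Types (c d : K) (A : {mset nat}%mset).

Definition letter_weight c A : K := \prod_(k <- A) (if odd k then c else c^-1).

Lemma letter_weightM c d A :
  letter_weight (c * d) A = letter_weight c A * letter_weight d A.
Proof.
by rewrite /letter_weight -big_split; apply: eq_bigr => k _; case: ifP => // _; rewrite invfM.
Qed.

Lemma letter_weight1 A : letter_weight 1 A = 1.
Proof. by rewrite /letter_weight big1 // => k _; rewrite invr1 if_same. Qed.

End LetterWeights.

Section ScalarAction.
Context (K : numClosedFieldType) (eps : bool) (a : free_field K eps 2).
Context (c : K) (c0 : c != 0).
Local Notation P := (vplus a).
Local Notation M := (vminus a).

Lemma gl_scalar_linear : linear (@gl_scalar K eps a c).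
Proof.
move=> d x y; rewrite /gl_scalar.
move: (daddv_pi (pol_plus a) _) (daddv_pi (pol_minus a) _) => p m.
rewrite (linearP p) (linearP m) !scalerDr addrACA !scalerA.
by rewrite ![_ * d]mulrC.
Qed.

Lemma gl_scalar_decomp u : gl_scalar c u =
  (c * pol_form a M u) *: P + (c^-1 * pol_form a u P) *: M.
Proof.
rewrite {1}[u](form_decomp (a := a)) gl_scalar_linear (linZ gl_scalar_linear).
rewrite gl_scalar_plus ?vplus_in // gl_scalar_minus ?vminus_in // !scalerA.
by rewrite ![c * _]mulrC ![c^-1 * _]mulrC.
Qed.

Lemma gl_scalar_isometry u v : pol_form a (gl_scalar c u) (gl_scalar c v) = pol_form a u v.
Proof.
rewrite [u in RHS](form_decomp (a := a)) [v in RHS](form_decomp (a := a)).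
rewrite !gl_scalar_decomp !(linD (form_linear_r _)) !(linD (form_linear_l _)).
rewrite !(linZ (form_linear_r _)) !(linZ (form_linear_l _)).
rewrite form_PP form_MM /GRing.scale /= !mulr0 !addr0 !add0r.
by congr (_ + _); rewrite !mulrA; congr (_ * _ * _); field.
Qed.

Lemma gl_scalar_pol : {in pol_plus a, forall u : a, gl_scalar c u \in pol_plus a}.
Proof. by move=> u up; rewrite gl_scalar_plus // memvZ. Qed.

Lemma gl_act_linear tw : linear (gl_act a tw c).
Proof.
exact: fmap_linear gl_scalar_linear gl_scalar_isometry gl_scalar_pol.
Qed.

Lemma gl_act_state A : gl_act a true c (state_word a A) =
  letter_weight c A *: state_word a A.
Proof.
rewrite /gl_act /state_word /create_word.
rewrite (Defs.fmapE _ _ gl_scalar_linear gl_scalar_isometry gl_scalar_pol).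
pose f (x : a * int) := if x.1 == P then c else c^-1.
have MP : (M == P) = false.
  apply/eqP => e; have := form_MP a; rewrite e form_PP => /eqP.
  by rewrite eq_sym oner_eq0.
rewrite (@fword_map_scale _ _ _ _ _ f [::]) => [|_ /mapP[k _ ->]].
  rewrite big_map /=; congr (_ *: _); apply: eq_bigr => k _.
  by rewrite /f /create /letter /=; case: (odd k); rewrite ?eqxx ?MP.
rewrite /f /create /letter /=; case: (odd k); rewrite ?eqxx ?MP.
  by rewrite gl_scalar_plus // vplus_in.
by rewrite gl_scalar_minus // vminus_in.
Qed.

End ScalarAction.

(** * Vertex operators on the tensor product of four factors *)

Section TwistedTrace.
Context (K : numClosedFieldType).
Context (e a : free_field K false 2) (b b' : free_field K true 2).
Local Notation V x := (fvac x false).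
Local Notation Yt x := (@ff_Yt _ _ _ x).
Local Notation F x := (twisted_fock_modes x).
Local Notation vac x := (@twisted_fock_vacuum _ _ x).

Let fpar_vac eps (x : free_field K eps 2) : fpar x false (V x) = V x.
Proof. exact: sva_par_vac (ff_vertex x). Qed.
Let parL eps (x : free_field K eps 2) : linear (fpar x false).
Proof. exact: sva_par_linear (ff_vertex x). Qed.
Let parM eps (x : free_field K eps 2) : linear (fpar x true).
Proof. exact: twm_par_linear (ff_twisted x). Qed.

Let Y2 := tens_Yt (fpar a false) (fpar e true) (Yt e) (Yt a).
Let M2 := tmap (fpar e true) (fpar a true).
Let Y3 := tens_Yt (fpar b false) M2 Y2 (Yt b).
Let M3 := tmap M2 (fpar b true).
Let M2L : linear M2. Proof. exact: tmap_linear (@parM _ e) (@parM _ a). Qed.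
Let M3L : linear M3. Proof. exact: tmap_linear M2L (@parM _ b). Qed.
Let F2 : field_modes Y2.
Proof. exact: tens_modes (@parL _ a) (@parM _ e) (F e) (F a). Qed.
Let F3 : field_modes Y3.
Proof. exact: tens_modes (@parL _ b) M2L F2 (F b). Qed.

Let vac2 : vacuum_mode Y2 (tpure (V e) (V a)).
Proof. exact (tens_vacuum (@parL _ a) (@parM _ e) (F e) (F a) (fpar_vac a) (vac e) (vac a)). Qed.
Let vac3 : vacuum_mode Y3 (tpure (tpure (V e) (V a)) (V b)).
Proof. exact (tens_vacuum (@parL _ b) M2L F2 (F b) (fpar_vac b) vac2 (vac b)). Qed.

Lemma W13_linear_l k w : linear (fun x => @W13_Yt K e a b b' x k w).
Proof. exact (tens_Yt_linear_l (@parL _ b') M3L F3 (F b') k w). Qed.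
Lemma W13_linear_r x k : linear (@W13_Yt K e a b b' x k).
Proof. exact (tens_Yt_linear_r (@parL _ b') M3L F3 (F b') x k). Qed.

Let vr4 x k u v : tens_Yt (fpar b' false) M3 Y3 (Yt b') (tpure x (V b')) k (tpure u v)
  = tpure (Y3 x k u) v.
Proof.
apply: (tens_Yt_vacr (@parL _ b') M3L F3 (F b')); first exact: fpar_vac.
exact: twisted_fock_vacuum.
Qed.

Let vr3 x k u v : Y3 (tpure x (V b)) k (tpure u v) = tpure (Y2 x k u) v.
Proof.
apply: (tens_Yt_vacr (@parL _ b) M2L F2 (F b)); first exact: fpar_vac.
exact: twisted_fock_vacuum.
Qed.

Let vr2 x k u v : Y2 (tpure x (V a)) k (tpure u v) = tpure (Yt e x k u) v.
Proof.
apply: (tens_Yt_vacr (@parL _ a) (@parM _ e) (F e) (F a)); first exact: fpar_vac.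
exact: twisted_fock_vacuum.
Qed.

Lemma W13_slot1 x k u1 u2 u3 u4 :
  @W13_Yt K e a b b' (tpure4 x (V a) (V b) (V b')) k (tpure4 u1 u2 u3 u4) =
  tpure4 (Yt e x k u1) u2 u3 u4.
Proof. by rewrite /W13_Yt /tpure4 vr4 vr3 vr2. Qed.

Lemma W13_slot2 x k u1 u2 u3 u4 : fpar a false x = x ->
  @W13_Yt K e a b b' (tpure4 (V e) x (V b) (V b')) k (tpure4 u1 u2 u3 u4) =
  tpure4 u1 (Yt a x k u2) u3 u4.
Proof.
move=> px; rewrite /W13_Yt /tpure4 vr4 vr3.
by rewrite /Y2 (tens_Yt_vacl (@parL _ a) (@parM _ e) (F e) (F a) _ _ _ px (vac e)).
Qed.

Lemma W13_slot3 x k u1 u2 u3 u4 : fpar b false x = x ->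
  @W13_Yt K e a b b' (tpure4 (V e) (V a) x (V b')) k (tpure4 u1 u2 u3 u4) =
  tpure4 u1 u2 (Yt b x k u3) u4.
Proof.
move=> px; rewrite /W13_Yt /tpure4 vr4.
by rewrite /Y3 (tens_Yt_vacl (@parL _ b) M2L F2 (F b) _ _ _ px vac2).
Qed.

Lemma W13_slot4 x k u1 u2 u3 u4 : fpar b' false x = x ->
  @W13_Yt K e a b b' (tpure4 (V e) (V a) (V b) x) k (tpure4 u1 u2 u3 u4) =
  tpure4 u1 u2 u3 (Yt b' x k u4).
Proof.
move=> px.
by rewrite /W13_Yt /tpure4 (tens_Yt_vacl (@parL _ b') M3L F3 (F b') _ _ _ px vac3).
Qed.

End TwistedTrace.

Section TracedStates.
Context (K : numClosedFieldType).
Context (e a : free_field K false 2) (b b' : free_field K true 2).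
Local Notation St := {mset nat}%mset.
Local Notation X := (St * St * St * St)%type.
Implicit Types x : X.

Definition state4 x : W13tw e a b b' :=
  tpure4 (state_word e x.1.1.1) (state_word a x.1.1.2)
    (state_word b x.1.2) (state_word b' x.2).

Definition admissible4 x : bool :=
  [&& admissible false x.1.1.1, admissible false x.1.1.2,
      admissible true x.1.2 & admissible true x.2].

Lemma state4_basis : exists dl, dual_basis admissible4 state4 dl.
Proof.
have h := dual_basis_tens (dual_basis_tens (dual_basis_tens
  (state_basis e) (state_basis a)) (state_basis b)) (state_basis b').
suff -> : admissible4 = fun p : X => ((admissible false p.1.1.1
    && admissible false p.1.1.2) && admissible true p.1.2) && admissible true p.2.
  by eexists; exact: h.
by apply/funext => x; rewrite /admissible4; do 4![case: (admissible _ _)].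
Qed.

(** The constant 1 is 6/2 - 1/2 - 3/2, from the vacuum charges of [a], [b] and [b']. The vacuum
    levels 1/8, 1/8, -1/8, -1/8 cancel, so [level4] has no constant. *)
Definition charge4 x : int :=
  1 + 6 * mcharge x.1.1.2 + mcharge x.1.2 + 3 * mcharge x.2.
Definition level4 x : nat :=
  (mlevel x.1.1.1 + mlevel x.1.1.2 + mlevel x.1.2 + mlevel x.2)%N.

Lemma tpure4Z (U1 U2 U3 U4 : lmodType K) c1 c2 c3 c4
    (u1 : U1) (u2 : U2) (u3 : U3) (u4 : U4) :
  tpure4 (c1 *: u1) (c2 *: u2) (c3 *: u3) (c4 *: u4) =
  (c1 * c2 * c3 * c4) *: tpure4 u1 u2 u3 u4.
Proof.
rewrite /tpure4 (linZ (tpure_linear_r _)) !(linZ (tpure_linear_l _)).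
rewrite (linZ (tpure_linear_r _)) !(linZ (tpure_linear_l _)).
rewrite (linZ (tpure_linear_r _)) !(linZ (tpure_linear_l _)) !scalerA.
by congr (_ *: _); ring.
Qed.

Lemma tmap4E (f1 : fock e true -> fock e true) (f2 : fock a true -> fock a true)
    (f3 : fock b true -> fock b true) (f4 : fock b' true -> fock b' true)
    u1 u2 u3 u4 : linear f1 -> linear f2 -> linear f3 -> linear f4 ->
  tmap4 f1 f2 f3 f4 (tpure4 u1 u2 u3 u4) = tpure4 (f1 u1) (f2 u2) (f3 u3) (f4 u4).
Proof.
move=> l1 l2 l3 l4; have l12 := tmap_linear l1 l2; have l123 := tmap_linear l12 l3.
by rewrite /tmap4 /tpure4 (tmapE _ _ l123 l4) (tmapE _ _ l12 l3) (tmapE _ _ l1 l2).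
Qed.

Lemma gl_act4 c1 c2 c3 c4 x : c1 != 0 -> c2 != 0 -> c3 != 0 -> c4 != 0 ->
  tmap4 (gl_act e true c1) (gl_act a true c2) (gl_act b true c3) (gl_act b' true c4)
    (state4 x) =
  (letter_weight c1 x.1.1.1 * letter_weight c2 x.1.1.2
   * letter_weight c3 x.1.2 * letter_weight c4 x.2) *: state4 x.
Proof.
move=> h1 h2 h3 h4; rewrite /state4 tmap4E; try exact: gl_act_linear.
by rewrite !gl_act_state // tpure4Z.
Qed.

Lemma jelt_state eps (f : free_field K eps 2) A :
  ff_Yt (jelt f) 0 (state_word f A) =
  ((-1) ^+ eps / 2 + (mcharge A)%:~R) *: state_word f A.
Proof. exact: jelt_word. Qed.

Lemma omega_state eps (f : free_field K eps 2) A :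
  ff_Yt (omega f) 2 (state_word f A) =
  ((-1) ^+ eps / 8 + (mlevel A)%:R) *: state_word f A.
Proof. exact: omega_word. Qed.

Lemma Je0_state x :
  @Je0 K e a b b' (state4 x) = (2^-1 + (mcharge x.1.1.1)%:~R) *: state4 x.
Proof.
rewrite /Je0 /jelt_e /state4 W13_slot1 jelt_state expr0 mul1r.
move: (tpure4Z (2^-1 + (mcharge x.1.1.1)%:~R) 1 1 1 (state_word e x.1.1.1)
  (state_word a x.1.1.2) (state_word b x.1.2) (state_word b' x.2)).
by rewrite !scale1r !mulr1.
Qed.

Let slots (U1 U2 U3 U4 : lmodType K) (u1 : U1) (u2 : U2) (u3 : U3) (u4 : U4) c :
  [/\ tpure4 (c *: u1) u2 u3 u4 = c *: tpure4 u1 u2 u3 u4,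
      tpure4 u1 (c *: u2) u3 u4 = c *: tpure4 u1 u2 u3 u4,
      tpure4 u1 u2 (c *: u3) u4 = c *: tpure4 u1 u2 u3 u4
    & tpure4 u1 u2 u3 (c *: u4) = c *: tpure4 u1 u2 u3 u4].
Proof.
have h := @tpure4Z _ _ _ _ _ _ _ _ u1 u2 u3 u4.
have := h c 1 1 1; have := h 1 c 1 1; have := h 1 1 c 1; have := h 1 1 1 c.
by rewrite !scale1r !mulr1 !mul1r.
Qed.

Lemma J0_state x : @J0 K e a b b' (state4 x) = (charge4 x)%:~R *: state4 x.
Proof.
have WL := @W13_linear_l K e a b b' 0 (state4 x).
rewrite /J0 /jelt13 !(linD WL) !(linZ WL) /state4.
rewrite W13_slot2 ?W13_slot3 ?W13_slot4 ?fpar_jelt // !jelt_state.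
set u1 := state_word e _; set u2 := state_word a _.
set u3 := state_word b _; set u4 := state_word b' _.
have sl c := slots u1 u2 u3 u4 c.
have [_ -> _ _] := sl ((-1) ^+ false / 2 + (mcharge x.1.1.2)%:~R).
have [_ _ -> _] := sl ((-1) ^+ true / 2 + (mcharge x.1.2)%:~R).
have [_ _ _ ->] := sl ((-1) ^+ true / 2 + (mcharge x.2)%:~R).
rewrite !scalerA -!scalerDl; congr (_ *: _).
rewrite /charge4 !rmorphD !rmorphM /= expr0 expr1; by field.
Qed.

Lemma L0_state x : @L0 K e a b b' (state4 x) = (level4 x)%:R *: state4 x.
Proof.
have WL := @W13_linear_l K e a b b' 2 (state4 x).
rewrite /L0 /omega13 !(linD WL) /state4.
rewrite W13_slot1 W13_slot2 ?W13_slot3 ?W13_slot4 ?fpar_omega // !omega_state.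
set u1 := state_word e _; set u2 := state_word a _.
set u3 := state_word b _; set u4 := state_word b' _.
have sl c := slots u1 u2 u3 u4 c.
have [-> _ _ _] := sl ((-1) ^+ false / 8 + (mlevel x.1.1.1)%:R).
have [_ -> _ _] := sl ((-1) ^+ false / 8 + (mlevel x.1.1.2)%:R).
have [_ _ -> _] := sl ((-1) ^+ true / 8 + (mlevel x.1.2)%:R).
have [_ _ _ ->] := sl ((-1) ^+ true / 8 + (mlevel x.2)%:R).
rewrite -!scalerDl; congr (_ *: _).
rewrite /level4 !natrD expr0 expr1; by field.
Qed.

Lemma fermion_sign_state x : fermion_sign (state4 x) =
  (letter_weight (-1) x.1.1.1 * letter_weight (-1) x.1.1.2) *: state4 x.
Proof.
have N1 : (-1 : K) != 0 by rewrite oppr_eq0 oner_eq0.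
by rewrite /fermion_sign gl_act4 ?oner_eq0 // !letter_weight1 !mulr1.
Qed.

Lemma generator13_linear : linear (@generator13 K e a b b').
Proof.
have N1 : (-1 : K) != 0 by rewrite oppr_eq0 oner_eq0.
have i0 : ('i : K) != 0 by exact: neq0Ci.
by apply: tmap_linear; [apply: tmap_linear; [apply: tmap_linear|]|];
  apply: gl_act_linear; rewrite ?oner_eq0.
Qed.

Lemma generator13_iter k x : iter k (@generator13 K e a b b') (state4 x) =
  (letter_weight ((-1) ^+ k) x.1.1.2 * letter_weight ('i ^+ k) x.1.2
   * letter_weight ('i ^+ k) x.2) *: state4 x.
Proof.
have N1 : (-1 : K) != 0 by rewrite oppr_eq0 oner_eq0.
have i0 : ('i : K) != 0 by exact: neq0Ci.
elim: k => [|k IH] /=; first by rewrite !letter_weight1 !mulr1 scale1r.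
rewrite IH (linZ generator13_linear) /generator13 gl_act4 ?oner_eq0 //.
rewrite letter_weight1 scalerA !exprS !letter_weightM; congr (_ *: _); ring.
Qed.

(* The trace weight of a state, up to the eigenvalue of J_e(0); s = i^k is the
   scalar by which gamma^k acts on b^+ and b'^+, and -s^2 is the one by which
   (-1)^F gamma^k acts on a^+. *)
Definition weight4 (s : K) x : K :=
  letter_weight (-1) x.1.1.1 * letter_weight (- s ^+ 2) x.1.1.2
  * letter_weight s x.1.2 * letter_weight s x.2.

Definition traced (s : K) x : K := (2^-1 + (mcharge x.1.1.1)%:~R) * weight4 s x.

Lemma traced_state k x :
  iter k (@generator13 K e a b b') (Je0 (fermion_sign (state4 x))) =
  traced ('i ^+ k) x *: state4 x.
Proof.
have JL : linear (@Je0 K e a b b') by exact: W13_linear_r.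
have gL : linear (iter k (@generator13 K e a b b')).
  elim: k => [|k IH] c y z //=; by rewrite IH generator13_linear.
rewrite fermion_sign_state (linZ JL) Je0_state !(linZ gL) generator13_iter.
rewrite !scalerA /traced /weight4; congr (_ *: _).
have -> : - ('i ^+ k) ^+ 2 = -1 * (-1) ^+ k :> K.
  by rewrite -exprM mulnC exprM sqrCi mulN1r.
by rewrite (letter_weightM (-1) ((-1) ^+ k)); ring.
Qed.

(** Finiteness is built in by an a priori box. By [mcharge_le], prescribed charge and level bound
    the zero modes of [b] and [b']; 10 = 6 + 1 + 3 adds the coefficients of the charge. *)
Definition sector m n : {fset X} :=
  let N := (10 * n + absz m + 2)%N in
  let B := box (2 * N).+1 N in
  [fset x in B `*` B `*` B `*` B | [&& admissible4 x, charge4 x == m & level4 x == n]]%fset.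

Let uniq_le1 (A : St) k : uniq A -> (A k <= 1)%N.
Proof. by move=> u; rewrite -count_mem_mset count_uniq_mem // leq_b1. Qed.

Lemma mem_sector m n x :
  (x \in sector m n) = [&& admissible4 x, charge4 x == m & level4 x == n].
Proof.
rewrite !inE /=; apply: andb_idl => /and3P[D /eqP hj /eqP hl].
case: x D hj hl => [[[A1 A2] A3] A4].
rewrite /admissible4 /charge4 /level4 /= => /and3P[D1 D2 _] hj hl.
have c2 := mcharge_le A2; have c3 := mcharge_le A3; have c4 := mcharge_le A4.
have u1 := uniq_le1 0 D1; have u2 := uniq_le1 0 D2.
rewrite -!andbA; apply/and4P; split; apply: mem_box_level; try lia.
by apply: leq_trans u1 _; lia.
Qed.

(** This places the trace in K[y][[y^-1]][[q]]. *)
Lemma sector_bound n m : 1 + 10 * n%:Z < m -> sector m n = fset0.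
Proof.
move=> h; apply/fsetP => -[[[A1 A2] A3] A4]; rewrite mem_sector inE.
apply/negbTE/negP => /and3P[_ /eqP hj /eqP hl]; move: hj hl.
rewrite /charge4 /level4 /= => hj hl.
have := mcharge_le A2; have := mcharge_le A3; have := mcharge_le A4; lia.
Qed.

End TracedStates.

(** The two exponents are later those of g and its inverse, both written as powers of the
    generator. *)
Lemma twisted_trace (K : numClosedFieldType)
    (e a : free_field K false 2) (b b' : free_field K true 2)
    (T : W13tw e a b b' -> W13tw e a b b') (k k' : nat) :
  (forall w, T w = - (iter k (@generator13 K e a b b') (Je0 (fermion_sign w))
                      + iter k' (@generator13 K e a b b') (Je0 (fermion_sign w)))) ->
  trace_series T (@J0 K e a b b') (@L0 K e a b b') (fun m n =>
    \sum_(x <- sector m n) - (traced ('i ^+ k : K) x + traced ('i ^+ k' : K) x)).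
Proof.
move=> TE; have [dl wb] := state4_basis e a b b'.
apply: (diagonal_trace_series wb (j := charge4) (l := level4)).
- exact: W13_linear_r.
- exact: W13_linear_r.
- by move=> x _; exact: J0_state.
- by move=> x _; exact: L0_state.
- by move=> x _; rewrite TE !traced_state -scalerDl scaleNr.
- exact: mem_sector.
- by move=> n; exists (1 + 10 * n%:Z) => m; exact: sector_bound.
Qed.

(** * Cancellations in the trace *)

Section Cancellation.
Context (K : numClosedFieldType).
Local Notation St := {mset nat}%mset.
Local Notation X := (St * St * St * St)%type.
Implicit Types (x y : X) (A B : St) (k : nat) (s : K).

(** Fixed points are allowed: there the weight equals its opposite, hence is 0 in characteristic
    0. *)
Lemma sum_involution (Y : choiceType) (F : {fset Y}) (i : Y -> Y) (w : Y -> K) :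
  (forall z, z \in F -> i z \in F) -> (forall z, z \in F -> i (i z) = z) ->
  (forall z, z \in F -> w (i z) = - w z) -> \sum_(z <- F) w z = 0.
Proof.
move=> iF ii wi; have e : perm_eq [seq i z | z <- F] F.
  apply: uniq_perm => //.
    by rewrite map_inj_in_uniq // => x y /ii {2}<- /ii {2}<- ->.
  move=> x; apply/mapP/idP => [[y yF ->]|xF]; first exact: iF.
  by exists (i x); [exact: iF|rewrite ii].
have : \sum_(z <- F) w z = - \sum_(z <- F) w z.
  by rewrite -{1}(perm_big _ e) big_map -sumrN; exact: eq_big_seq.
move/eqP; rewrite -addr_eq0 -mulr2n mulrn_eq0 /=; exact: eqP.
Qed.

Lemma uniq_msetP A : reflect (forall k, (A k <= 1)%N) (uniq A).
Proof.
apply: (iffP idP) => [u k|h].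
  by rewrite -count_mem_mset count_uniq_mem // leq_b1.
apply: count_mem_uniq => k; rewrite count_mem_mset; have := h k.
by have := in_mset k A; case: (A k) => [|[|]] // ->.
Qed.

Lemma letter_weight_cons (c : K) k A : letter_weight c (k +` A)%mset =
  (if odd k then c else c^-1) * letter_weight c A.
Proof. exact: big_mset_cons. Qed.

Definition toggle0 A : St := if A 0%N == 0%N then (0%N +` A)%mset else (A `\ 0%N)%mset.

Let toggle_e x : X := (toggle0 x.1.1.1, x.1.1.2, x.1.2, x.2).

Let zero_mode A : (forall k, (A k <= 1)%N) -> A 0%N != 0%N ->
  exists B, A = (0%N +` B)%mset /\ B 0%N = 0%N.
Proof.
move=> h h0; exists (A `\ 0%N)%mset; split.
  by rewrite msetB1K // in_mset lt0n.
by rewrite msetB1E eqxx; have := h 0%N; lia.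
Qed.

Let uniq_cons0 k A : A k = 0%N -> uniq (enum_mset (k +` A)%mset) = uniq (enum_mset A).
Proof.
move=> h; apply/uniq_msetP/uniq_msetP => u j; have := u j; rewrite mset1DE; first by lia.
by case: eqP => [->|_]; rewrite ?h.
Qed.

(* Toggling the zero mode of e changes the sign of (-1)^F and shifts J_e(0) by 1,
   so a pair of states contributes its weight without the eigenvalue of J_e(0). *)
Lemma traced_zero_mode s m n :
  \sum_(x <- sector m n) traced s x =
  \sum_(x <- sector m n) (x.1.1.1 0%N == 0%N)%:R * weight4 s x.
Proof.
(* The difference of the two summands is anti-invariant under [toggle_e]: without the zero mode it
   is (c - 1/2) w and with it (1/2 - c) w, where w and c are the weight and the [e]-charge of the
   state without it. *)
apply/eqP; rewrite -subr_eq0 -sumrB; apply/eqP.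
have pair (x : X) A : x.1.1.1 = A -> A 0%N = 0%N ->
    let y : X := ((0%N +` A)%mset, x.1.1.2, x.1.2, x.2) in
    [/\ (x \in sector m n) = (y \in sector m n), toggle_e x = y, toggle_e y = x
      & traced s y - (y.1.1.1 0%N == 0%N)%:R * weight4 s y =
        - (traced s x - (x.1.1.1 0%N == 0%N)%:R * weight4 s x)].
  case: x => [[[A1 A2] A3] A4] /= -> h; split.
  - rewrite !mem_sector /admissible4 /charge4 /level4 /admissible /=.
    by rewrite uniq_cons0 // mlevel_cons.
  - by rewrite /toggle_e /toggle0 /= h.
  - by rewrite /toggle_e /toggle0 /= mset1DE eqxx h /= msetD1K.
  rewrite mset1DE eqxx h eqxx /= mul0r subr0 mul1r /traced /weight4 /=.
  by rewrite mcharge_cons letter_weight_cons /= invrN invr1 !rmorphD /=; ring.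
have cases x : x \in sector m n -> exists (y : X) A, [/\ y.1.1.1 = A, A 0%N = 0%N
    & x = y \/ x = ((0%N +` A)%mset, y.1.1.2, y.1.2, y.2)].
  rewrite mem_sector => /and3P[/and4P[/uniq_msetP u _ _ _] _ _].
  have [h|h] := eqVneq (x.1.1.1 0%N) 0%N; first by exists x, x.1.1.1; split=> //; left.
  have [B [e B0]] := zero_mode u h.
  exists (B, x.1.1.2, x.1.2, x.2), B; split=> //; right => /=.
  by rewrite -e; case: (x) => [[[]]].
apply: (@sum_involution _ _ toggle_e) => x xS.
- have [y [A [yA A0 h]]] := cases x xS; have [e1 e2 e3 _] := pair y A yA A0.
  by case: h xS => ->; rewrite ?e2 ?e3 ?e1.
- have [y [A [yA A0 h]]] := cases x xS; have [e1 e2 e3 _] := pair y A yA A0.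
  by case: h => ->; rewrite ?e2 ?e3 ?e2.
have [y [A [yA A0 h]]] := cases x xS; have [e1 e2 e3 e4] := pair y A yA A0.
by case: h => ->; rewrite ?e2 ?e3 ?e4 ?opprK.
Qed.

(* The mode of a whose weight is, up to sign, the square of the weight of the
   mode k of b'. *)
Definition partner k : nat := 2 * k + odd k.

Let odd_partner k : odd (partner k) = odd k.
Proof. by rewrite /partner oddD mul2n odd_double; case: (odd k). Qed.

Let uphalf_partner k : uphalf (partner k) = (2 * uphalf k)%N.
Proof. by have := odd_double_half k; rewrite uphalf_half odd_partner /partner uphalf_half; lia. Qed.

Let partner_inj : injective partner.
Proof. move=> k l; have := odd_double_half k; have := odd_double_half l; rewrite /partner; lia. Qed.

(** A mode [partner k] of [a] counts as two modes k of [b'], so exchanging one for the other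
    preserves the load. The least k with load above 1 is therefore the same for both states of a
    pair, which makes the pairing an involution. *)
Definition pair_load x k : nat := (2 * x.1.1.2 (partner k) + x.2 k)%N.

Let step k x y : Prop := [/\ x.1.1.1 = y.1.1.1, x.1.2 = y.1.2,
  y.1.1.2 = (partner k +` x.1.1.2)%mset, x.2 = (k +` (k +` y.2))%mset
  & x.1.1.2 (partner k) = 0%N].

Let step_load k x y : step k x y -> pair_load x = pair_load y.
Proof.
move=> [_ _ e2 e4 h]; apply/funext => l; rewrite /pair_load e2 e4 !mset1DE.
rewrite (inj_eq partner_inj); case: eqP => [->|_]; last by lia.
by rewrite h; lia.
Qed.

Let step_sector k x y m n : step k x y -> (x \in sector m n) = (y \in sector m n).
Proof.
move=> [e1 e3 e2 e4 h]; rewrite !mem_sector /admissible4 /charge4 /level4.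
rewrite e1 e3 e2 e4 /admissible /= uniq_cons0 // !mcharge_cons !mlevel_cons.
rewrite odd_partner uphalf_partner; congr [&& _, _ & _].
  by congr (_ == _); move: (lsign _) => z; lia.
by congr (_ == _); lia.
Qed.

(** For letters of type plus the new mode of [a] contributes -s^2 and the two removed modes of [b']
    contribute s each; for letters of type minus, the inverses. *)
Let step_weight s k x y : s != 0 -> step k x y -> weight4 s y = - weight4 s x.
Proof.
move=> s0 [e1 e3 e2 e4 _]; rewrite /weight4 e1 e3 e2 e4 !letter_weight_cons odd_partner.
by case: (odd k); field.
Qed.

Let flip k x : X :=
  if x.1.1.2 (partner k) == 0%N
  then (x.1.1.1, (partner k +` x.1.1.2)%mset, x.1.2, (x.2 `\ k `\ k)%mset)
  else (x.1.1.1, (x.1.1.2 `\ partner k)%mset, x.1.2, (k +` (k +` x.2))%mset).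

(** If the mode [partner k] is absent from [a], a load above 1 provides two copies of k in [b']; if
    it is present, it occurs once and can be removed. *)
Let flip_step k x : uniq x.1.1.2 -> (1 < pair_load x k)%N ->
  step k x (flip k x) \/ step k (flip k x) x.
Proof.
case: x => [[[A1 A2] A3] A4]; rewrite /pair_load /flip /= => /uniq_msetP u h.
case: eqP h => [e h|/eqP h0 _]; [left|right].
  have h4 : (1 < A4 k)%N by move: h; rewrite e.
  split=> //=; rewrite msetB1K; first by rewrite msetB1K // in_mset; lia.
  by rewrite in_mset msetB1E eqxx; lia.
split=> //=; first by rewrite msetB1K // in_mset lt0n.
by rewrite msetB1E eqxx; have := u (partner k); lia.
Qed.

Let step_flip k x y : step k x y -> flip k x = y /\ flip k y = x.
Proof.
case: x => [[[A1 A2] A3] A4]; case: y => [[[B1 B2] B3] B4] [/= e1 e3 e2 e4 h].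
rewrite /flip /= h eqxx -e1 -e3 e2 e4 !msetD1K; split=> //.
by rewrite mset1DE eqxx h.
Qed.

Let least (p : nat -> bool) : nat :=
  if pselect (exists k, p k) is left h then ex_minn h else 0%N.

Let leastP (p : nat -> bool) : (exists k, p k) -> p (least p).
Proof. by rewrite /least => h; case: pselect => // h'; case: ex_minnP. Qed.

(* The states that survive the involution adding the mode partner k of a while
   removing twice the mode k of b', for the least k for which this is possible. *)
Definition reduced_state x : bool :=
  `[< forall k, (pair_load x k <= 1)%N >].

Definition reduced_weight s x : K :=
  ((x.1.1.1 0%N == 0%N) && reduced_state x)%:R * weight4 s x.

Lemma reduced_sum s m n : s != 0 ->
  \sum_(x <- sector m n) traced s x = \sum_(x <- sector m n) reduced_weight s x.
Proof.
move=> s0; rewrite traced_zero_mode; apply/eqP; rewrite -subr_eq0 -sumrB; apply/eqP.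
pose over x k := (1 < pair_load x k)%N.
(* Reduced states are fixed; there the two summands agree and the difference is 0. *)
pose i x := if reduced_state x then x else flip (least (over x)) x.
have overP x : ~~ reduced_state x -> over x (least (over x)).
  move=> h; apply: leastP; apply: contrapT => h'; case/asboolP: h => k.
  by rewrite leqNgt; apply/negP => h; apply: h'; exists k.
pose b x := ~~ reduced_state x.
have main x : x \in sector m n -> ~~ reduced_state x ->
    [/\ i x \in sector m n, reduced_state (i x) = false, i (i x) = x,
        (i x).1.1.1 = x.1.1.1 & weight4 s (i x) = - weight4 s x].
  move=> xS nr; have ix : i x = flip (least (over x)) x by rewrite /i (negPf nr).
  have uA : uniq x.1.1.2 by move: xS; rewrite mem_sector => /and3P[/and4P[]].
  have := flip_step uA (overP x nr); rewrite -ix; set k := least (over x).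
  have red y : pair_load y = pair_load x -> reduced_state y = false.
    by move=> e; rewrite /reduced_state e; apply: negbTE.
  have iE y : pair_load y = pair_load x -> i y = flip k y.
    by move=> e; rewrite /i (red y e) /k /over e.
  case=> st.
    have e := esym (step_load st); have [f1 f2] := step_flip st.
    split; [by rewrite -(step_sector _ _ st)|exact: red|by rewrite (iE (i x))| |].
      by case: st.
    exact: step_weight st.
  have e := step_load st; have [f1 f2] := step_flip st.
  split; [by rewrite (step_sector _ _ st)|exact: red|by rewrite (iE (i x))| |].
    by case: st.
  by rewrite (step_weight s0 st) opprK.
apply: (@sum_involution _ _ i) => x xS; have [r|nr] := boolP (reduced_state x).
- by rewrite /i r.
- by have [] := main x xS nr.
- by rewrite /i r r.
- by have [] := main x xS nr.
- by rewrite /i r /reduced_weight r andbT subrr oppr0.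
have [h1 h2 h3 h4 h5] := main x xS nr.
by rewrite /reduced_weight h2 (negPf nr) !andbF !mul0r !subr0 h4 h5 mulrN.
Qed.

End Cancellation.

(** * Infinite products and unconditional sums *)

Import ComplexField.Normc.

Section ComplexLimits.
Context (R : realType).
Local Notation C := (Cx R).
Implicit Types (z l : C) (u v : nat -> C).

(** The norm on [Cx R] takes values in [Cx R]; estimates are carried out with the real-valued
    [normc]. *)
Lemma normE z : `|z| = (normc z)%:C%C.
Proof. by []. Qed.

Lemma normc_ge0 z : 0 <= normc z.
Proof. by have := normr_ge0 z; rewrite normE lecR. Qed.

Lemma normcD z l : normc (z + l) <= normc z + normc l.
Proof. by have := ler_normD z l; rewrite !normE -rmorphD lecR. Qed.

Lemma normcN z : normc (- z) = normc z.
Proof. by apply: (complexI (R := R)); rewrite -!normE normrN. Qed.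

Lemma normcB z l : normc (z - l) = normc (l - z).
Proof. by rewrite -normcN opprB. Qed.

Lemma normcX z n : normc (z ^+ n) = normc z ^+ n.
Proof. by elim: n => [|n IH]; rewrite ?normc1 // !exprS normcM IH. Qed.

Lemma normc_sum I (r : seq I) (P : pred I) (F : I -> C) :
  normc (\sum_(i <- r | P i) F i) <= \sum_(i <- r | P i) normc (F i).
Proof.
elim/big_rec2: _ => [|i x y _ h]; first by rewrite normc0.
by apply: le_trans (normcD _ _) _; rewrite lerD2l.
Qed.

Lemma normc_prod I (r : seq I) (P : pred I) (F : I -> C) :
  normc (\prod_(i <- r | P i) F i) = \prod_(i <- r | P i) normc (F i).
Proof. by elim/big_rec2: _ => [|i x y _ h]; rewrite ?normc1 // normcM h. Qed.

Lemma normc_gt0 z : (0 < normc z) = (z != 0).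
Proof.
rewrite lt_neqAle normc_ge0 andbT eq_sym; congr negb.
by apply/eqP/eqP => [/eq0_normc|->]; rewrite ?normc0.
Qed.

Lemma gt0_complexE z : 0 < z -> z = (complex.Re z)%:C%C.
Proof. by move=> z0; rewrite RRe_real // gtr0_real. Qed.

Lemma cvgC_P u l : u @ \oo --> l <->
  (forall e : R, 0 < e -> exists N, forall n, (N <= n)%N -> normc (l - u n) < e).
Proof.
split=> [/cvgrPdist_lt h e e0|h].
  have [|N _ hN] := h e%:C%C; first by rewrite ltcR.
  by exists N => n Nn; have := hN n Nn; rewrite normE ltcR.
apply/cvgrPdist_lt => e e0; have ee := gt0_complexE e0.
have [|N hN] := h (complex.Re e); first by rewrite -ltcR -ee.
by exists N => // n Nn; rewrite ee normE ltcR; exact: hN.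
Qed.

Lemma limC u l : u @ \oo --> l -> lim (u @ \oo) = l.
Proof. by apply/cvg_lim; exact: norm_hausdorff. Qed.

Lemma cvgC_unique u l l' : u @ \oo --> l -> u @ \oo --> l' -> l = l'.
Proof. by move=> /limC <- /limC <-. Qed.

Lemma cvgC_dist_le u l c (e : R) n0 : u @ \oo --> l ->
  (forall n, (n0 <= n)%N -> normc (u n - c) <= e) -> normc (l - c) <= e.
Proof.
move=> /cvgC_P ul h; apply/ler_addgt0Pr => d d0; have [N hN] := ul d d0.
have := hN (maxn n0 N) (leq_maxr _ _); have := h (maxn n0 N) (leq_maxl _ _).
set x := u _ => h1 h2; have -> : l - c = (l - x) + (x - c) by rewrite addrA subrK.
by apply: le_trans (normcD _ _) _; rewrite addrC lerD // ltW.
Qed.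

Lemma cvgC_subseq u l (f : nat -> nat) : (forall n, (n <= f n)%N) ->
  u @ \oo --> l -> u \o f @ \oo --> l.
Proof.
move=> hf /cvgC_P h; apply/cvgC_P => e e0; have [N hN] := h e e0.
by exists N => n Nn; apply: hN; exact: leq_trans (hf n).
Qed.

Lemma cvgC_prod n (F : nat -> nat -> C) (f : nat -> C) :
  (forall k, (k < n)%N -> F k @ \oo --> f k) ->
  (fun M => \prod_(k < n) F k M) @ \oo --> \prod_(k < n) f k.
Proof.
elim: n => [|n IH] h.
  rewrite big_ord0; under eq_fun do rewrite big_ord0; exact: cvg_cst.
rewrite big_ord_recr /=; under eq_fun do rewrite big_ord_recr /=.
apply: cvgM; last exact: h.
by apply: IH => k kn; apply: h; exact: ltnW.
Qed.

Lemma Re_normc z : `|complex.Re z| <= normc z.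
Proof. by have := normc_ge_Re z; rewrite normE lecR. Qed.

Lemma Im_normc z : `|complex.Im z| <= normc z.
Proof.
case: z => a b /=; rewrite -sqrtr_sqr ler_wsqrtr // lerDr; exact: sqr_ge0.
Qed.

Lemma normc_ReIm z : normc z <= `|complex.Re z| + `|complex.Im z|.
Proof.
case: z => a b /=; rewrite -(ler_pXn2r (n := 2)) ?nnegrE ?sqrtr_ge0 ?addr_ge0 //.
rewrite sqr_sqrtr ?addr_ge0 ?sqr_ge0 // -(real_normK (num_real a)) -(real_normK (num_real b)).
rewrite sqrrD lerD2r lerDl mulrn_wge0 // mulr_ge0 //.
Qed.

(* Completeness: Re u + B and Im u + B are nondecreasing and bounded. *)
Lemma cvgC_dominated u (B : nat -> R) (S : R) :
  (forall n, normc (u n.+1 - u n) <= B n.+1 - B n) -> (forall n, B n <= S) ->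
  exists l : C, u @ \oo --> l.
Proof.
move=> hu hB.
have Bmono n : B n <= B n.+1 by rewrite -subr_ge0; apply: le_trans (hu n); exact: normc_ge0.
have bound n : normc (u n - u 0%N) <= B n - B 0%N.
  elim: n => [|n IH]; first by rewrite !subrr normc0.
  rewrite -[u n.+1](subrK (u n)) -addrA; apply: le_trans (normcD _ _) _.
  apply: le_trans (lerD (hu n) IH) _; lra.
have cv (f : C -> R) : (forall z, `|f z| <= normc z) -> (forall z z', f (z - z') = f z - f z') ->
    exists r : R, (f \o u) @ \oo --> r.
  move=> fn fB.
  have cvm (v : nat -> R) T : (forall n, v n <= v n.+1) -> (forall n, v n <= T) -> cvgn v.
    move=> vm vT; apply: nondecreasing_is_cvgn; first exact/nondecreasing_seqP.
    by exists T => _ [n _ <-].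
  have c1 : cvgn (fun n => f (u n) + B n).
    apply: (cvm _ (f (u 0%N) + (S - B 0%N) + S)) => n.
      have := le_trans (fn _) (hu n); rewrite fB ler_norml => /andP[h _]; lra.
    have := le_trans (fn _) (bound n); rewrite fB ler_norml => /andP[_ h].
    have := hB n; lra.
  have c2 : cvgn B by apply: (cvm _ S).
  exists (limn (fun n => f (u n) + B n) - limn B).
  have -> : f \o u = (fun n => f (u n) + B n - B n).
    by apply/funext => n /=; rewrite addrK.
  exact: cvgB.
have [r hr] : exists r : R, ((fun z : C => complex.Re z) \o u) @ \oo --> r.
  by apply: cv; [exact: Re_normc|case=> a b [c d]].
have [i hi] : exists r : R, ((fun z : C => complex.Im z) \o u) @ \oo --> r.
  by apply: cv; [exact: Im_normc|case=> a b [c d]].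
exists (r +i* i)%C; apply/cvgC_P => e e0.
have e2 : 0 < e / 2 by lra.
move/cvgrPdist_lt: hr => /(_ _ e2)[N1 _ h1].
move/cvgrPdist_lt: hi => /(_ _ e2)[N2 _ h2].
exists (maxn N1 N2) => n Nn; apply: le_lt_trans (normc_ReIm _) _.
have := h1 n (leq_trans (leq_maxl _ _) Nn); have := h2 n (leq_trans (leq_maxr _ _) Nn).
rewrite /=; case: (u n) => a b /=; lra.
Qed.

End ComplexLimits.

Section InfiniteProducts.
Context (R : realType).
Local Notation C := (Cx R).
Implicit Types (a : nat -> C) (b : nat -> R).

Definition partial_prod a N : C := \prod_(k < N) (1 + a k).

Lemma partial_prodS a N : partial_prod a N.+1 = partial_prod a N * (1 + a N).
Proof. by rewrite /partial_prod big_ord_recr. Qed.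

Lemma prod_le_exp b N : (forall k, 0 <= b k) ->
  \prod_(k < N) (1 + b k) <= expR (\sum_(k < N) b k).
Proof.
move=> b0; elim: N => [|N IH]; first by rewrite !big_ord0 expR0.
rewrite !big_ord_recr /= expRD ler_pM ?expR_ge1Dx //; last by rewrite addr_ge0.
by rewrite prodr_ge0 // => k _; rewrite addr_ge0.
Qed.

Lemma normc_1D a b k : normc (a k) <= b k -> normc (1 + a k) <= 1 + b k.
Proof. by move=> h; apply: le_trans (normcD _ _) _; rewrite normc1 lerD2l. Qed.

Lemma partial_prod_le a b N : (forall k, normc (a k) <= b k) ->
  normc (partial_prod a N) <= \prod_(k < N) (1 + b k).
Proof.
move=> h; rewrite normc_prod; apply: ler_prod => k _.
by rewrite normc_ge0 normc_1D.
Qed.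

Lemma partial_prod_step a b N : (forall k, normc (a k) <= b k) ->
  normc (partial_prod a N.+1 - partial_prod a N) <=
  \prod_(k < N.+1) (1 + b k) - \prod_(k < N) (1 + b k).
Proof.
move=> h; rewrite partial_prodS big_ord_recr /= !mulrDr !mulr1 !(addrC _ (_ * _)) !addrK.
rewrite normcM ler_pM ?normc_ge0 //; exact: partial_prod_le.
Qed.

Lemma partial_prod_dist a b N N' : (forall k, normc (a k) <= b k) -> (N <= N')%N ->
  normc (partial_prod a N' - partial_prod a N) <=
  \prod_(k < N') (1 + b k) - \prod_(k < N) (1 + b k).
Proof.
move=> h; elim: N' => [|N' IH]; first by rewrite leqn0 => /eqP ->; rewrite !subrr normc0.
rewrite leq_eqVlt => /predU1P[->|/IH {}IH]; first by rewrite !subrr normc0.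
rewrite -[partial_prod a N'.+1](subrK (partial_prod a N')) -addrA.
apply: le_trans (normcD _ _) _.
apply: le_trans (lerD (partial_prod_step N' h) IH) _; lra.
Qed.

Section Convergence.
Context (a : nat -> C) (b : nat -> R) (S : R).
Hypotheses (ab : forall k, normc (a k) <= b k) (bS : forall N, \sum_(k < N) b k <= S).

Let b0 k : 0 <= b k.
Proof. by apply: le_trans (ab k); exact: normc_ge0. Qed.

Let prod_bound N : \prod_(k < N) (1 + b k) <= expR S.
Proof. by apply: le_trans (prod_le_exp N b0) _; rewrite ler_expR. Qed.

Lemma partial_prod_cvg : exists l : C, partial_prod a @ \oo --> l.
Proof.
apply: (cvgC_dominated (B := fun N => \prod_(k < N) (1 + b k)) (S := expR S)) => N //.
exact: partial_prod_step.
Qed.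

(** The conclusion concerns the majorant [b] alone, so the rank [N] serves all products dominated by
    it at once. *)
Lemma prod_tail_small (e : R) : 0 < e -> exists N, forall N', (N <= N')%N ->
  \prod_(k < N') (1 + b k) - \prod_(k < N) (1 + b k) < e.
Proof.
move=> e0; pose P N := \prod_(k < N) (1 + b k).
have Pm : {homo P : n m / (n <= m)%N >-> n <= m}.
  apply/nondecreasing_seqP => N; rewrite /P big_ord_recr /= ler_peMr ?lerDl //.
  by rewrite prodr_ge0 // => k _; rewrite addr_ge0.
have Pc : cvgn P.
  by apply: nondecreasing_is_cvgn => //; exists (expR S) => _ [N _ <-]; exact: prod_bound.
move/cvgrPdist_lt: (Pc) => /(_ _ e0)[N _ hN]; exists N => N' NN'.
have := hN N (leqnn N); have := nondecreasing_cvgn_le Pm Pc N'.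
rewrite -/(P N') -/(P N) /= => h1 h2.
have := ler_norm (limn P - P N); lra.
Qed.

(** Once the tail of the sum of [b] from N on is at most 1/2, |P_(N+M)| >= |P_N| (1 - b_N - ... -
    b_(N+M-1)) >= |P_N| / 2, and P_N is nonzero. *)
Lemma partial_prod_lim_neq0 (l : C) : (forall k, 1 + a k != 0) ->
  partial_prod a @ \oo --> l -> l != 0.
Proof.
move=> a1 al.
have [N hN] : exists N, forall M, \sum_(k < M) b (N + k)%N <= 2^-1.
  pose s N := \sum_(k < N) b k.
  have sm : {homo s : n m / (n <= m)%N >-> n <= m}.
    by apply/nondecreasing_seqP => N; rewrite /s big_ord_recr /= lerDl.
  have sc : cvgn s.
    by apply: nondecreasing_is_cvgn => //; exists S => _ [N _ <-]; exact: bS.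
  have h2 : (0 : R) < 2^-1 by lra.
  move/cvgrPdist_lt: (sc) => /(_ _ h2)[N _ hN]; exists N => M.
  have := hN N (leqnn N); have := nondecreasing_cvgn_le sm sc (N + M)%N.
  rewrite {1}/s big_split_ord /= -/(s N) => h1 h3.
  have := ler_norm (limn s - s N); lra.
have lower M : normc (partial_prod a N) * (1 - \sum_(k < M) b (N + k)%N) <=
    normc (partial_prod a (N + M)).
  elim: M => [|M IH]; first by rewrite big_ord0 subr0 mulr1 addn0.
  rewrite addnS partial_prodS normcM big_ord_recr /=.
  have h1 : 1 - b (N + M)%N <= normc (1 + a (N + M)%N).
    have := normcD (1 + a (N + M)%N) (- a (N + M)%N); rewrite addrK normc1 normcN.
    have := ab (N + M)%N; lra.
  have h2 : b (N + M)%N <= 2^-1.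
    have := hN M.+1; rewrite big_ord_recr /=.
    have : 0 <= \sum_(i < M) b (N + i)%N by rewrite sumr_ge0.
    by lra.
  have h3 : \sum_(k < M) b (N + k)%N <= 2^-1 by exact: hN.
  have h4 : 0 <= \sum_(i < M) b (N + i)%N by rewrite sumr_ge0.
  have h5 := normc_ge0 (partial_prod a N).
  move: h1 h2 h3 h4 h5 IH (b0 (N + M)%N).
  set s := \sum_(k < M) _; set p := normc (partial_prod a N).
  set r := normc (partial_prod _ _); set t := normc (1 + _); set c := b _.
  move=> h1 h2 h3 h4 h5 IH c0.
  apply: (@le_trans _ _ (p * (1 - s) * (1 - c))); last first.
    apply: ler_pM => //; [by apply: mulr_ge0 => //; lra|by lra].
  rewrite -subr_ge0 (_ : _ - _ = p * (s * c)); first by rewrite !mulr_ge0.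
  by ring.
have pN : 0 < normc (partial_prod a N).
  by rewrite normc_gt0; apply/prodf_neq0 => k _.
apply/negP => /eqP l0; move/cvgC_P: al; rewrite l0.
have h : 0 < normc (partial_prod a N) / 2 by lra.
move=> /(_ _ h)[N1 hN1]; have := hN1 (N + N1)%N (leq_addl _ _).
rewrite sub0r normcN; have := lower N1; have := hN N1.
move: pN; set p := normc (partial_prod a N); set s := \sum_(k < _) _; nra.
Qed.

End Convergence.
End InfiniteProducts.

(** * Absolutely convergent sums over arbitrary index types *)

Section AbsoluteSums.
Context (R : realType).
Local Notation C := (Cx R).

(** Convergence along finite sets, with a uniform bound on the absolute sums; the bound is what
    controls products of two such sums. *)
Definition asum (Y : choiceType) (w : Y -> C) (S : C) : Prop :=
  (exists B : R, forall F : {fset Y}, \sum_(y <- F) normc (w y) <= B) /\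
  forall e : R, 0 < e -> exists F0 : {fset Y}, forall F : {fset Y},
    (F0 `<=` F)%fset -> normc (\sum_(y <- F) w y - S) < e.

Lemma sum_fset_sub (V : zmodType) (Y : choiceType) (F G : {fset Y}) (f : Y -> V) :
  (F `<=` G)%fset ->
  \sum_(y <- G) f y - \sum_(y <- F) f y = \sum_(y <- (G `\` F)%fset) f y.
Proof.
move=> FG; rewrite (big_fsetID _ (mem F) G) /=.
have -> : [fset x in G | x \in F]%fset = F.
  by apply/fsetP => x; rewrite !inE andbC; apply: andb_idr; move/fsubsetP: FG; apply.
have -> : [fset x in G | x \notin F]%fset = (G `\` F)%fset.
  by apply/fsetP => x; rewrite !inE andbC.
by rewrite addrAC subrr add0r.
Qed.

Lemma ler_sum_fset (Y : choiceType) (F G : {fset Y}) (f : Y -> R) :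
  (forall y, 0 <= f y) -> (F `<=` G)%fset -> \sum_(y <- F) f y <= \sum_(y <- G) f y.
Proof. by move=> f0 FG; rewrite -subr_ge0 sum_fset_sub // sumr_ge0. Qed.

Lemma normc_sum_sub (Y : choiceType) (F G : {fset Y}) (w : Y -> C) :
  (F `<=` G)%fset -> normc (\sum_(y <- G) w y - \sum_(y <- F) w y) <=
  \sum_(y <- G) normc (w y) - \sum_(y <- F) normc (w y).
Proof. by move=> FG; rewrite !sum_fset_sub //; exact: normc_sum. Qed.

Lemma bounded_tail (Y : choiceType) (w : Y -> C) (B : R) :
  (forall F : {fset Y}, \sum_(y <- F) normc (w y) <= B) ->
  forall e : R, 0 < e -> exists F0 : {fset Y}, forall F : {fset Y},
    (F0 `<=` F)%fset -> \sum_(y <- F) normc (w y) - \sum_(y <- F0) normc (w y) < e.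
Proof.
move=> hB e e0; pose E := [set r | exists F : {fset Y}, r = \sum_(y <- F) normc (w y)].
have Es : has_sup E.
  split; first by exists (\sum_(y <- fset0) normc (w y)), fset0.
  by exists B => _ [F ->].
have [_ [F0 ->] hF0] := sup_adherent e0 Es.
exists F0 => F _; have := ub_le_sup (proj2 Es) (ex_intro _ F erefl).
by lra.
Qed.

Lemma asum_scale (Y : choiceType) (w : Y -> C) S c :
  asum w S -> asum (fun y => c * w y) (c * S).
Proof.
move=> [[B hB] h]; split.
  exists (normc c * B) => F; under eq_bigr do rewrite normcM.
  by rewrite -mulr_sumr ler_wpM2l ?normc_ge0.
move=> e e0; have c1 : 0 < normc c + 1 by have := normc_ge0 c; lra.
have [F0 hF0] := h (e / (normc c + 1)) (divr_gt0 e0 c1); exists F0 => F /hF0 hF.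
rewrite -mulr_sumr -mulrBr normcM.
rewrite ltr_pdivlMr // in hF; apply: le_lt_trans hF.
by rewrite mulrC ler_wpM2l ?normc_ge0 // lerDl.
Qed.

Lemma sum_fset_mul (K : comRingType) (Y Z : choiceType) (F : {fset Y}) (G : {fset Z})
    (f : Y -> K) (g : Z -> K) :
  \sum_(p <- (F `*` G)%fset) f p.1 * g p.2 = (\sum_(y <- F) f y) * (\sum_(z <- G) g z).
Proof.
have e : perm_eq (F `*` G)%fset [seq (y, z) | y <- F, z <- G].
  apply: uniq_perm => //; first by apply: allpairs_uniq => // -[? ?] [? ?].
  move=> [y z]; rewrite inE /=; apply/andP/allpairsP => [[yF zG]|].
    by exists (y, z).
  by move=> [[y' z'] [/= ? ? [-> ->]]].
by rewrite (perm_big _ e) /= big_allpairs_dep big_distrlr.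
Qed.

(** A finite set F of pairs containing the rectangle F1 x F2 lies in a larger rectangle H1 x H2, and
    its sum differs from that over F1 x F2 by at most the absolute sum over the difference of the
    two rectangles. *)
Lemma asum_mul (Y Z : choiceType) (f : Y -> C) (g : Z -> C) S T :
  asum f S -> asum g T -> asum (fun p => f p.1 * g p.2) (S * T).
Proof.
move=> [[B1 hB1] h1] [[B2 hB2] h2].
have B10 : 0 <= B1 by have := hB1 fset0; rewrite big_seq_fset0.
have B20 : 0 <= B2 by have := hB2 fset0; rewrite big_seq_fset0.
have cover (F : {fset Y * Z}) : (F `<=` [fset p.1 | p in F] `*` [fset p.2 | p in F])%fset.
  apply/fsubsetP => p pF; rewrite inE; apply/andP; split; apply/imfsetP; exists p => //.
have nsum (F : {fset Y}) (G : {fset Z}) :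
    \sum_(p <- (F `*` G)%fset) normc (f p.1 * g p.2) =
    (\sum_(y <- F) normc (f y)) * (\sum_(z <- G) normc (g z)).
  by under eq_bigr do rewrite normcM; exact: sum_fset_mul.
split.
  exists (B1 * B2) => F; apply: le_trans (ler_sum_fset _ (cover F)) _ => [y|].
    exact: normc_ge0.
  by rewrite nsum ler_pM // sumr_ge0 // => y _; exact: normc_ge0.
move=> e e0; pose D := 2 * B1 + B2 + normc T + 1.
have D0 : 0 < D by have := normc_ge0 T; rewrite /D; lra.
have d0 : 0 < e / D by rewrite divr_gt0.
set d := e / D in d0; have eD : d * D = e by rewrite /d divfK // gt_eqF.
have [E1 t1] := bounded_tail hB1 d0; have [E2 t2] := bounded_tail hB2 d0.
have [G1 c1] := h1 d d0; have [G2 c2] := h2 d d0.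
pose F1 := (E1 `|` G1)%fset; pose F2 := (E2 `|` G2)%fset.
exists (F1 `*` F2)%fset => F FF.
pose H1 := (F1 `|` [fset p.1 | p in F])%fset; pose H2 := (F2 `|` [fset p.2 | p in F])%fset.
have FH : (F `<=` H1 `*` H2)%fset.
  apply/fsubsetP => p /(fsubsetP (cover F)); rewrite !in_fsetM => /andP[h3 h4].
  by rewrite !inE /= h3 h4 !orbT.
have mono (Q : choiceType) (A B : {fset Q}) (k : Q -> C) : (A `<=` B)%fset ->
    \sum_(q <- A) normc (k q) <= \sum_(q <- B) normc (k q).
  by move=> AB; apply: ler_sum_fset => // q; exact: normc_ge0.
have sub1 : (E1 `<=` H1)%fset by rewrite /H1 /F1 -fsetUA fsubsetUl.
have sub2 : (E2 `<=` H2)%fset by rewrite /H2 /F2 -fsetUA fsubsetUl.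
have a1 := t1 H1 sub1; have a2 := t2 H2 sub2.
have a1' := mono _ _ _ f (fsubsetUl E1 G1); have a2' := mono _ _ _ g (fsubsetUl E2 G2).
have b1 := hB1 F1; have b2 := hB2 F2; have b1' := hB1 H1; have b2' := hB2 H2.
have p1 := c1 F1 (fsubsetUr _ _); have p2 := c2 F2 (fsubsetUr _ _).
have q1 : normc (\sum_(p <- F) f p.1 * g p.2 - \sum_(p <- (F1 `*` F2)%fset) f p.1 * g p.2)
    <= (\sum_(y <- H1) normc (f y)) * (\sum_(z <- H2) normc (g z))
       - (\sum_(y <- F1) normc (f y)) * (\sum_(z <- F2) normc (g z)).
  apply: le_trans (normc_sum_sub _ FF) _; rewrite nsum lerD2r -nsum.
  exact: (mono _ _ _ (fun p => f p.1 * g p.2) FH).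
have n1 : 0 <= \sum_(y <- F1) normc (f y) by apply: sumr_ge0 => y _; exact: normc_ge0.
have n2 : 0 <= \sum_(z <- F2) normc (g z) by apply: sumr_ge0 => y _; exact: normc_ge0.
have m1 := normc_sum F1 xpredT f.
rewrite sum_fset_mul in q1.
move: q1 p1 p2 a1 a2 a1' a2' b1 b2 b1' b2' n1 n2 m1; rewrite -/F1 -/F2.
set s1 := \sum_(y <- F1) f y; set s2 := \sum_(z <- F2) g z.
set A1 := \sum_(y <- H1) normc (f y); set A2 := \sum_(z <- H2) normc (g z).
set N1 := \sum_(y <- F1) normc (f y); set N2 := \sum_(z <- F2) normc (g z).
set s := \sum_(p <- F) _; set M1 := \sum_(y <- E1) _; set M2 := \sum_(y <- E2) _.
move=> q1 p1 p2 a1 a2 a1' a2' b1 b2 b1' b2' n1 n2 m1.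
have -> : s - S * T = (s - s1 * s2) + (s1 * (s2 - T) + T * (s1 - S)) by ring.
apply: le_lt_trans (normcD _ _) _; apply: le_lt_trans (lerD q1 (normcD _ _)) _.
rewrite !normcM.
have r1 : normc s1 * normc (s2 - T) <= B1 * d.
  by apply: ler_pM; rewrite ?normc_ge0 //; [exact: le_trans m1 b1|exact: ltW].
have r2 : normc T * normc (s1 - S) <= normc T * d.
  by apply: ler_pM; rewrite ?normc_ge0 //; exact: ltW.
have r3 : A1 * A2 - N1 * N2 <= B1 * d + B2 * d.
  have -> : A1 * A2 - N1 * N2 = A1 * (A2 - N2) + N2 * (A1 - N1) by ring.
  have A10 : 0 <= A1 by apply: sumr_ge0 => y _; exact: normc_ge0.
  apply: lerD.
    apply: (@le_trans _ _ (A1 * d)); first by rewrite ler_wpM2l //; lra.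
    by rewrite ler_wpM2r // ltW.
  apply: (@le_trans _ _ (N2 * d)); first by rewrite ler_wpM2l //; lra.
  by rewrite ler_wpM2r // ltW.
have : d * D = 2 * (B1 * d) + B2 * d + normc T * d + d by rewrite /D; ring.
by rewrite eD => ->; lra.
Qed.

(** Grouping by [d] partitions [D] into finite fibers, so a finite sum of coefficients is a sum over
    a finite union of fibers. *)
Lemma asum_fibers (Y : choiceType) (w : Y -> C) S (d : Y -> int * nat)
    (fib : int -> nat -> {fset Y}) (D : pred Y) :
  (forall m n y, (y \in fib m n) = D y && (d y == (m, n))) ->
  (forall y, ~~ D y -> w y = 0) -> asum w S ->
  double_series_sum (fun m n => \sum_(y <- fib m n) w y) S.
Proof.
move=> hfib w0 [_ hw] e e0; have [F0 hF0] := hw e e0.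
(* Once the images of F0 lie in F, the union of fibers contains F0 up to indices outside [D], where
   the weight is 0. *)
exists [fset d y | y in F0]%fset => F FF.
pose G := (\bigcup_(p <- F) fib p.1 p.2)%fset.
have memG y : (y \in G) = D y && (d y \in F).
  apply/bigfcupP/andP => [[p /andP[pF _]]|[Dy dF]].
    by rewrite hfib => /andP[-> /eqP ->]; rewrite -surjective_pairing.
  by exists (d y); rewrite ?dF //= hfib Dy -surjective_pairing eqxx.
have -> : \sum_(p <- F) \sum_(y <- fib p.1 p.2) w y = \sum_(y <- G) w y.
  have -> : \sum_(y <- G) w y = \sum_(y <- G) \sum_(p <- F) (d y == p)%:R * w y.
    apply: eq_big_seq => y; rewrite memG => /andP[_ dF].
    rewrite (big_fsetD1 (d y)) //= eqxx mul1r big1_seq ?addr0 // => p.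
    by rewrite /= in_fsetD1 eq_sym => /andP[/negPf -> _]; rewrite mul0r.
  rewrite exchange_big /=; apply: eq_big_seq => p pF.
  have sub : (fib p.1 p.2 `<=` G)%fset.
    by apply/fsubsetP => y; rewrite hfib memG -surjective_pairing => /andP[-> /eqP ->].
  rewrite -(big_fset_incl _ sub) => [|y].
    by apply: eq_big_seq => y; rewrite hfib -surjective_pairing => /andP[_ ->]; rewrite mul1r.
  rewrite memG hfib -surjective_pairing => /andP[-> _] /= /negPf ->.
  by rewrite mul0r.
have -> : \sum_(y <- G) w y = \sum_(y <- (G `|` F0)%fset) w y.
  apply: big_fset_incl; first exact: fsubsetUl.
  move=> y; rewrite inE memG => /orP[/andP[-> ->] //|yF0].
  rewrite negb_and => /orP[/w0 //|/negP[]].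
  by move/fsubsetP: FF; apply; apply/imfsetP; exists y.
by rewrite normE ltcR; apply: hF0; exact: fsubsetUr.
Qed.

Lemma double_series_sumD (f g : int -> nat -> C) S T :
  double_series_sum f S -> double_series_sum g T ->
  double_series_sum (fun m n => f m n + g m n) (S + T).
Proof.
move=> hf hg e e0; have e2 : 0 < e / 2 by rewrite divr_gt0.
have [F0 h0] := hf _ e2; have [G0 h1] := hg _ e2; exists (F0 `|` G0)%fset => F FF.
have := h0 F (fsubset_trans (fsubsetUl _ _) FF).
have := h1 F (fsubset_trans (fsubsetUr _ _) FF).
rewrite !normE !ltcR big_split /= => h3 h4; rewrite opprD addrACA.
by apply: le_lt_trans (normcD _ _) _; rewrite [ltRHS](splitr e) ltrD.
Qed.

Lemma double_series_sumN (f : int -> nat -> C) S :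
  double_series_sum f S -> double_series_sum (fun m n => - f m n) (- S).
Proof.
move=> hf e e0; have [F0 h0] := hf e e0; exists F0 => F /h0.
by rewrite !normE !ltcR sumrN -opprD normcN.
Qed.

End AbsoluteSums.

(** * Sums of multiplicative weights over occupation numbers *)

Section StateSums.
Local Notation St := {mset nat}%mset.

(** Here [u k n] is the weight of n copies of the mode k; [u k 0] = 1 is assumed wherever the
    product is extended beyond the support. *)
Definition state_weight (K : comNzRingType) (u : nat -> nat -> K) (A : St) : K :=
  \prod_(k <- finsupp A) u k (A k).

Lemma state_weight_box (K : comNzRingType) (u : nat -> nat -> K) N M (A : St) :
  (forall k, u k 0%N = 1) -> A \in box N M -> state_weight u A = \prod_(k < N) u k (A k).
Proof.
move=> u0 /boxP[_ hN]; pose I := seq_fset tt (iota 0 N).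
have sub : (finsupp A `<=` I)%fset.
  apply/fsubsetP => k; rewrite seq_fsetE mem_iota add0n mem_finsupp leq0n /=.
  by move=> h; rewrite ltnNge; apply/negP => /hN e; rewrite e eqxx in h.
rewrite /state_weight (big_fset_incl _ sub) => [|k _]; last first.
  by rewrite memNfinsupp => /eqP ->.
have e : perm_eq I (iota 0 N).
  by apply: uniq_perm; rewrite ?fset_uniq ?iota_uniq // => k; rewrite seq_fsetE.
by rewrite (perm_big _ e) -{1}[N]subn0 -/(index_iota 0 N) big_mkord.
Qed.

Lemma state_weight_box_sum (K : comNzRingType) (u : nat -> nat -> K) N M :
  (forall k, u k 0%N = 1) ->
  \sum_(A <- box N M) state_weight u A = \prod_(k < N) \sum_(n < M.+1) u k n.
Proof.
move=> u0; rewrite bigA_distr_bigA /= big_imfset /=; last first.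
  by move=> f g _ _; exact: mset_of_ffun_inj.
rewrite big_enum /=; apply: eq_bigr => f _.
rewrite (@state_weight_box _ _ N M) //; last by apply/imfsetP; exists f.
by apply: eq_bigr => k _; rewrite mset_of_ffun_ord.
Qed.

Section Summation.
Context (R : realType).
Local Notation C := (Cx R).
Context (u : nat -> nat -> C) (f : nat -> C) (b : nat -> R) (S : R) (V : C).
Hypotheses (u0 : forall k, u k 0%N = 1).
Hypothesis ub : forall k M, \sum_(n < M.+1) normc (u k n) <= 1 + b k.
Hypothesis uf : forall k, (fun M => \sum_(n < M.+1) u k n) @ \oo --> f k.
Hypothesis bS : forall N, \sum_(k < N) b k <= S.
Hypothesis fV : (fun N => \prod_(k < N) f k) @ \oo --> V.

Let nu k n : R := normc (u k n).
Let nu0 k : nu k 0%N = 1. Proof. by rewrite /nu u0 normc1. Qed.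

Let normc_weight A : normc (state_weight u A) = state_weight nu A.
Proof. exact: normc_prod. Qed.

Let b0 k : 0 <= b k.
Proof.
have := ub k 0; rewrite big_ord1 u0 normc1 => h; lra.
Qed.

Let box_cover (F : {fset St}) : exists N, (F `<=` box N N)%fset.
Proof.
elim/finSet_rect: F => F IH.
have [->|[A AF]] := fset_0Vmem F; first by exists 0%N; exact: fsub0set.
have [N hN] := IH _ (fproperD1 AF); have [N' hN'] := mset_in_box A.
exists (maxn N N'); apply/fsubsetP => B BF; have [->|BA] := eqVneq B A.
  by apply: box_mono hN'; exact: leq_maxr.
apply: (box_mono (leq_maxl N N') (leq_maxl N N')).
by move/fsubsetP: hN; apply; rewrite in_fsetD1 BA.
Qed.

Let weight_bound (F : {fset St}) : \sum_(A <- F) normc (state_weight u A) <= expR S.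
Proof.
have [N FN] := box_cover F.
apply: le_trans (ler_sum_fset _ FN) _ => [A|]; first exact: normc_ge0.
under eq_bigr do rewrite normc_weight.
rewrite state_weight_box_sum //; apply: (@le_trans _ _ (\prod_(k < N) (1 + b k))).
  by apply: ler_prod => k _; rewrite ub sumr_ge0 // => n _; exact: normc_ge0.
by apply: le_trans (prod_le_exp N b0) _; rewrite ler_expR.
Qed.

(** Over a box the sum is exactly a finite product. The absolute sums are at most the product of the
    1 + b k, hence at most exp S, so some finite set E leaves a tail below e / 4. The limits over
    boxes, in the multiplicities and then in the number of modes, stay within e / 4 of the sum over
    E. *)
Lemma state_asum : asum (state_weight u) V.
Proof.
split; first by exists (expR S); exact: weight_bound.
move=> e e0; have e4 : 0 < e / 4 by rewrite divr_gt0.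
have [E hE] := bounded_tail weight_bound e4.
have [N0 EN0] := box_cover E; set s0 := \sum_(A <- E) state_weight u A.
have near (F : {fset St}) : (E `<=` F)%fset ->
    normc (\sum_(A <- F) state_weight u A - s0) <= e / 4.
  by move=> EF; apply: le_trans (normc_sum_sub _ EF) _; exact/ltW/hE.
have h1 N : (N0 <= N)%N -> normc (\prod_(k < N) f k - s0) <= e / 4.
  move=> hN.
  apply: (@cvgC_dist_le _ (fun M => \prod_(k < N) \sum_(n < M.+1) u k n) _ _ _ N0).
    by apply: (cvgC_prod (F := fun k M => \sum_(n < M.+1) u k n)) => k _; exact: uf.
  move=> M hM; rewrite -state_weight_box_sum //; apply: near.
  by apply: fsubset_trans EN0 _; apply/fsubsetP; exact: box_mono.
have h2 : normc (V - s0) <= e / 4 by apply: (cvgC_dist_le fV) h1.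
exists E => F /near h3.
rewrite -(subrK s0 (\sum_(A <- F) _)) -addrA.
apply: le_lt_trans (normcD _ _) _; rewrite (normcB s0).
by lra.
Qed.

End Summation.
End StateSums.

Section LetterSums.
Context (R : realType).
Local Notation C := (Cx R).
Local Notation St := {mset nat}%mset.
Context (z : nat -> C) (b : nat -> R) (S : R).
Hypotheses (zb : forall k, normc (z k) <= b k) (bS : forall N, \sum_(k < N) b k <= S).

Definition boson (k n : nat) : C := z k ^+ n.
(** The predicate serves to remove the zero mode of [e] and the partner modes of [a]. *)
Definition fermion (p : pred nat) (k n : nat) : C :=
  if n is n'.+1 then if p k && (n' == 0)%N then z k else 0 else 1.

Lemma boson_weight A : state_weight boson A = \prod_(k <- A) z k.
Proof.
rewrite big_mset; apply: eq_bigr => k _.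
by rewrite Monoid.iteropE -/(iter _ _ _) /boson -[LHS]mulr1 -iter_mulr.
Qed.

Lemma fermion_weight (p : pred nat) A :
  state_weight (fermion p) A =
  `[< forall k, (A k <= p k)%N >]%:R * \prod_(k <- A) z k.
Proof.
case: asboolP => h; last first.
  rewrite mul0r; have [k /negP hk] : exists k, ~ (A k <= p k)%N by exact/existsNP.
  have kA : k \in finsupp A by rewrite mem_finsupp; case: (A k) hk.
  rewrite /state_weight (big_fsetD1 k) //= /fermion.
  case: (A k) hk => // n; rewrite -ltnNge; case: (p k) => //=; rewrite ?mul0r //.
  by case: n => //= n _; rewrite mul0r.
rewrite mul1r -boson_weight; apply: eq_bigr => k _; have := h k.
rewrite /fermion /boson; case: (A k) => [|[|n]]; rewrite ?expr0 //.
  by case: (p k).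
by case: (p k).
Qed.

Let b0 k : 0 <= b k.
Proof. by apply: le_trans (zb k); exact: normc_ge0. Qed.

Lemma fermion_asum (p : pred nat) (V : C) :
  (fun N => \prod_(k < N) (1 + (if p k then z k else 0))) @ \oo --> V ->
  asum (state_weight (fermion p)) V.
Proof.
have sum2 (K : nmodType) (v : nat -> nat -> K) k M : (forall n, v k n.+2 = 0) ->
    \sum_(n < M.+1) v k n = v k 0%N + (if M is 0%N then 0 else v k 1%N).
  move=> v0; case: M => [|M]; first by rewrite big_ord1 addr0.
  by rewrite !big_ord_recl big1 ?addr0 //= => i _; rewrite v0.
move=> hV.
apply: (@state_asum R (fermion p) (fun k => 1 + (if p k then z k else 0)) b S V).
- by [].
- move=> k M; rewrite (sum2 _ (fun k n => normc (fermion p k n))) => [|n]; last first.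
    by rewrite /fermion andbF normc0.
  rewrite /fermion normc1 lerD2l; case: M => [|M]; first exact: b0.
  by rewrite andbT; case: (p k); rewrite ?normc0 ?b0.
- move=> k; apply/cvgC_P => e e0; exists 1%N => -[//|M] _.
  rewrite (sum2 _ (fermion p)) => [|n]; last by rewrite /fermion andbF.
  by rewrite /fermion andbT subrr normc0.
- exact: bS.
exact: hV.
Qed.

Lemma sum_geometric (K : fieldType) (x : K) M : x != 1 ->
  \sum_(n < M.+1) x ^+ n = (1 - x)^-1 - x ^+ M.+1 / (1 - x).
Proof.
move=> x1; have h : 1 - x != 0 by rewrite subr_eq0 eq_sym.
have := subrX1 x M.+1; rewrite -[x - 1]opprB mulNr => /(canLR opprK) e.
by apply: (mulfI h); rewrite -e mulrBr mulrCA divff // mulr1 opprB.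
Qed.

(** The uniform bound [rho] keeps 1 / (1 - |z k|) at most 1 / (1 - rho), so the absolute geometric
    series are dominated by 1 + b k / (1 - rho). *)
Lemma boson_asum (rho : R) (V : C) : rho < 1 -> (forall k, normc (z k) <= rho) ->
  (fun N => \prod_(k < N) (1 - z k)^-1) @ \oo --> V ->
  asum (state_weight boson) V.
Proof.
move=> rho1 zrho hV; have r0 : 0 < 1 - rho by rewrite subr_gt0.
have zlt k : normc (z k) < 1 by exact: le_lt_trans rho1.
have z1 k : 1 - z k != 0.
  rewrite subr_eq0; apply/eqP => e; have := zlt k; rewrite -e.
  by rewrite normc1 ltxx.
apply: (@state_asum R boson (fun k => (1 - z k)^-1) (fun k => b k / (1 - rho))
  (S / (1 - rho)) V).
- by move=> k; rewrite /boson expr0.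
- move=> k M; under eq_bigr do rewrite /boson normcX.
  have n1 : normc (z k) != 1 by rewrite lt_eqF.
  rewrite sum_geometric //; have zk := zlt k; have zr := zrho k; have zb' := zb k.
  have nz := normc_ge0 (z k); move: nz zk zr zb' n1; set t := normc (z k).
  move=> nz zk zr zb' n1; have t0 : 0 < 1 - t by rewrite subr_gt0.
  apply: (@le_trans _ _ (1 - t)^-1).
    by rewrite lerBlDr lerDl divr_ge0 ?exprn_ge0 // ltW.
  have -> : (1 - t)^-1 = 1 + t / (1 - t) by field; rewrite gt_eqF.
  rewrite lerD2l ler_pM ?invr_ge0 ?(ltW t0) // lef_pV2 ?posrE //; lra.
- move=> k; apply/cvgC_P => e e0; have d0 : 0 < normc (1 - z k) by rewrite normc_gt0.
  have : (fun n => normc (z k) ^+ n) @ \oo --> (0 : R).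
    by apply: cvg_expr; rewrite ger0_norm ?normc_ge0.
  move/cvgrPdist_lt => /(_ _ (mulr_gt0 e0 d0))[N _ hN]; exists N => M NM.
  rewrite sum_geometric; last by rewrite eq_sym -subr_eq0.
  rewrite opprB addrCA subrr addr0 normcM normcV normcX ltr_pdivrMr //.
  have := hN M.+1 (leq_trans NM (leqnSn _)).
  by rewrite /= sub0r normrN ger0_norm ?exprn_ge0 ?normc_ge0.
- by move=> N; rewrite -mulr_suml ler_wpM2r // invr_ge0 ltW.
exact: hV.
Qed.

End LetterSums.

(** * Theta products and the sum of the trace *)

Section PointwiseLimits.
Context (R : realType).
Local Notation C := (Cx R).
Implicit Types (f g : C -> C) (x l m : C).

Lemma cst_cvgC (x0 : C) l : (fun _ : C => l) @ x0 --> l.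
Proof. exact: (@cvg_cst C l C (nbhs x0)). Qed.

Lemma inv_cvgC (x0 : C) f l : l != 0 -> f @ x0 --> l -> (fun x => (f x)^-1) @ x0 --> l^-1.
Proof. by move=> l0 h; exact: (cvgV l0 h). Qed.

Lemma opp_cvgC (x0 : C) f l : f @ x0 --> l -> (fun x => - f x) @ x0 --> - l.
Proof. by move=> h; exact: (cvgN h). Qed.

Lemma add_cvgC (x0 : C) f g l m : f @ x0 --> l -> g @ x0 --> m ->
  (fun x => f x + g x) @ x0 --> l + m.
Proof. by move=> h k; exact: (cvgD h k). Qed.

Lemma mul_cvgC (x0 : C) f g l m : f @ x0 --> l -> g @ x0 --> m ->
  (fun x => f x * g x) @ x0 --> l * m.
Proof. by move=> h k; exact: (cvgM h k). Qed.

Lemma nearC_P (x0 : C) f l : f @ x0 --> l <->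
  (forall e : R, 0 < e -> \forall x \near x0, normc (l - f x) < e).
Proof.
split=> [/cvgrPdist_lt h e e0|h].
  have := h e%:C%C; rewrite ltcR => /(_ e0); apply: filterS => x.
  by rewrite normE ltcR.
apply/(@cvgrPdist_lt _ C _ (nbhs x0)) => e e0; have ee := gt0_complexE e0.
have := h (complex.Re e); rewrite -ltcR -ee => /(_ e0); apply: filterS => x hx.
by rewrite [X in _ < X]ee normE ltcR.
Qed.

End PointwiseLimits.

Section ThetaProducts.
Context (R : realType).
Local Notation C := (Cx R).
Implicit Types (x q : C) (p : pred nat).

(* The factors of T(x; q): letz x q (2n - 2) = x^-1 q^(n-1) and
   letz x q (2n - 1) = x q^n. *)
Definition letz x q (k : nat) : C := (if odd k then x else x^-1) * q ^+ uphalf k.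

Lemma letzN x q k : letz (- x) q k = - letz x q k.
Proof. by rewrite /letz invrN; case: ifP => _; rewrite mulNr. Qed.

Lemma letz_sqr x q k : letz (x ^+ 2) (q ^+ 2) k = letz x q k ^+ 2.
Proof.
rewrite /letz [RHS]exprMn; congr (_ * _); last by rewrite -!exprM mulnC.
by case: ifP => // _; rewrite exprVn.
Qed.

Lemma letz_partner x q k : letz x q (partner k) = letz x (q ^+ 2) k.
Proof.
rewrite /letz /partner oddD mul2n odd_double /= -exprM; case: (boolP (odd k)) => ok /=.
  by congr (_ * _ ^+ _); have := odd_double_half k; rewrite !uphalf_half oddD odd_double ok /=; lia.
by congr (_ * _ ^+ _); have := odd_double_half k; rewrite !uphalf_half addn0 odd_double (negPf ok) /=; lia.
Qed.

Definition letz_bound (M r : R) (k : nat) : R := M * r ^+ uphalf k.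

Lemma letz_le x q M k : normc x <= M -> normc x^-1 <= M ->
  normc (letz x q k) <= letz_bound M (normc q) k.
Proof.
move=> h1 h2; rewrite /letz normcM normcX ler_wpM2r ?exprn_ge0 ?normc_ge0 //.
by case: ifP.
Qed.

(** Each exponent n > 0 is hit twice, by 2n - 1 and 2n, so the sum telescopes like two geometric
    series. *)
Lemma sum_uphalf (r : R) N : (1 - r) * (\sum_(k < N) r ^+ uphalf k) =
  1 + r - r ^+ uphalf N - r ^+ uphalf N.+1.
Proof.
elim: N => [|N IH]; first by rewrite big_ord0 mulr0 /= expr0 expr1; ring.
rewrite big_ord_recr mulrDr IH (_ : uphalf N.+2 = (uphalf N).+1) // exprS.
by move: (r ^+ uphalf N.+1) => t; rewrite /=; ring.
Qed.

Lemma letz_bound_sum (M r : R) N : 0 <= M -> 0 <= r -> r < 1 ->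
  \sum_(k < N) letz_bound M r k <= M * (2 / (1 - r)).
Proof.
move=> M0 r0 r1; rewrite /letz_bound -mulr_sumr ler_wpM2l //.
rewrite ler_pdivlMr ?subr_gt0 // mulrC sum_uphalf.
have := exprn_ge0 (uphalf N) r0; have := exprn_ge0 (uphalf N.+1) r0; lra.
Qed.

(** With [predT] the resulting product is T(x; q), with [predC has_partner] it is O(x; q), and with
    [odd] and x = 1 it is the Euler product of the 1 - q^n. *)
Definition tfactor p x q (k : nat) : C := if p k then - letz x q k else 0.

Definition tprod p x q : C := lim (partial_prod (tfactor p x q) @ \oo).

Let size x : R := normc x + normc x^-1.
Let size1 x : normc x <= size x. Proof. by rewrite lerDl normc_ge0. Qed.
Let size2 x : normc x^-1 <= size x. Proof. by rewrite lerDr normc_ge0. Qed.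
Let size0 x : 0 <= size x. Proof. by rewrite addr_ge0 ?normc_ge0. Qed.

Lemma letz_size x q k : normc (letz x q k) <= letz_bound (size x) (normc q) k.
Proof. exact: letz_le. Qed.

Lemma letz_size_sum x q N : normc q < 1 ->
  \sum_(k < N) letz_bound (size x) (normc q) k <= size x * (2 / (1 - normc q)).
Proof. by move=> q1; apply: letz_bound_sum; rewrite ?normc_ge0. Qed.

Let tfactor_le p x q M k : normc x <= M -> normc x^-1 <= M ->
  normc (tfactor p x q k) <= letz_bound M (normc q) k.
Proof.
move=> h1 h2; rewrite /tfactor; case: ifP => _; first by rewrite normcN letz_le.
by rewrite normc0; apply: le_trans (letz_le q k h1 h2); exact: normc_ge0.
Qed.

Lemma tprod_cvg p x q : normc q < 1 -> partial_prod (tfactor p x q) @ \oo --> tprod p x q.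
Proof.
move=> q1; have [l hl] := partial_prod_cvg
  (fun k => tfactor_le p q k (size1 x) (size2 x)) (fun N => letz_size_sum x N q1).
by rewrite /tprod (limC hl).
Qed.

Lemma tprod_neq0 p x q : normc q < 1 -> (forall k, p k -> letz x q k != 1) ->
  tprod p x q != 0.
Proof.
move=> q1 h; apply: (partial_prod_lim_neq0
  (fun k => tfactor_le p q k (size1 x) (size2 x)) (fun N => letz_size_sum x N q1)).
  move=> k; rewrite /tfactor; case: ifP => [/h pk|_]; last by rewrite addr0 oner_neq0.
  by rewrite subr_eq0 eq_sym.
exact: tprod_cvg.
Qed.

Lemma tprod_lim p x q (f : nat -> nat) (v : nat -> C) : normc q < 1 ->
  (forall N, (N <= f N)%N) -> (forall N, partial_prod (tfactor p x q) (f N) = v N) ->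
  v @ \oo --> tprod p x q.
Proof.
move=> q1 hf e; have -> : v = partial_prod (tfactor p x q) \o f by apply/funext => N /=.
by apply: (cvgC_subseq (u := partial_prod _) hf); exact: tprod_cvg.
Qed.

Lemma normc_sqr_lt1 q : normc q < 1 -> normc (q ^+ 2) < 1.
Proof. by move=> q1; rewrite normcX exprn_ilt1 ?normc_ge0. Qed.

Local Notation T := (tprod predT).

Lemma tprod_mulN x q : normc q < 1 -> T x q * T (- x) q = T (x ^+ 2) (q ^+ 2).
Proof.
move=> q1; apply: (cvgC_unique (u := partial_prod (tfactor predT (x ^+ 2) (q ^+ 2))));
  last by apply: tprod_cvg; exact: normc_sqr_lt1.
have -> : partial_prod (tfactor predT (x ^+ 2) (q ^+ 2)) =
    fun N => partial_prod (tfactor predT x q) N * partial_prod (tfactor predT (- x) q) N.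
  apply/funext => N; rewrite /partial_prod -big_split /=; apply: eq_bigr => k _.
  by rewrite /tfactor /= letzN letz_sqr; ring.
by apply: cvgM; exact: tprod_cvg.
Qed.

Definition has_partner k : bool := partner k./2 == k.

Lemma has_partnerP k : reflect (exists j, partner j = k) (has_partner k).
Proof.
apply: (iffP eqP) => [<-|[j <-]]; first by exists k./2.
by congr partner; rewrite /partner; case: (odd j); rewrite mul2n ?addn0 ?addn1 /= ?uphalf_double ?doubleK.
Qed.

(** Since [partner j] is 2j or 2j + 1 according to the parity of j, each block {2j, 2j + 1} contains
    exactly one partner. *)
Lemma prod_partner (F : nat -> C) N : \prod_(k < 2 * N) F k =
  (\prod_(j < N) F (partner j)) * \prod_(k < 2 * N) (if has_partner k then 1 else F k).
Proof.
elim: N => [|N IH]; first by rewrite !big_ord0 mulr1.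
have -> : (2 * N.+1 = (2 * N).+2)%N by lia.
rewrite !big_ord_recr /= IH /has_partner.
have -> : ((2 * N)./2 = N)%N by rewrite mul2n doubleK.
have -> : ((2 * N).+1./2 = N)%N by rewrite mul2n /= uphalf_double.
rewrite /partner; case: (odd N) => /=.
  by rewrite !addn1 eqxx ifF; [ring|lia].
by rewrite !addn0 eqxx ifF; [ring|lia].
Qed.

Lemma tprod_partner x q : normc q < 1 ->
  T x q = T x (q ^+ 2) * tprod (predC has_partner) x q.
Proof.
move=> q1; have f2 N : (N <= 2 * N)%N by lia.
apply/esym/(cvgC_unique (u := fun N => partial_prod (tfactor predT x q) (2 * N))); last first.
  exact: tprod_lim f2 _.
have -> : (fun N => partial_prod (tfactor predT x q) (2 * N)) = fun N =>
    partial_prod (tfactor predT x (q ^+ 2)) N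
    * partial_prod (tfactor (predC has_partner) x q) (2 * N).
  apply/funext => N; rewrite /partial_prod (prod_partner (fun k => 1 + tfactor predT x q k)).
  congr (_ * _); apply: eq_bigr => k _; first by rewrite /tfactor /= letz_partner.
  by rewrite /tfactor /=; case: ifP => //= _; rewrite addr0.
apply: cvgM; first exact: tprod_cvg (normc_sqr_lt1 q1).
exact: tprod_lim f2 _.
Qed.

Lemma partial_prod_continuous p q x0 N : x0 != 0 ->
  (fun x => partial_prod (tfactor p x q) N) @ x0 --> partial_prod (tfactor p x0 q) N.
Proof.
move=> x00; elim: N => [|N IH].
  have -> : (fun x => partial_prod (tfactor p x q) 0) = fun=> 1.
    by apply/funext => x; rewrite /partial_prod big_ord0.
  by rewrite /partial_prod big_ord0; exact: cst_cvgC.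
have -> : (fun x => partial_prod (tfactor p x q) N.+1) =
    fun x => partial_prod (tfactor p x q) N * (1 + tfactor p x q N).
  by apply/funext => x; rewrite partial_prodS.
have idc : (fun x : C => x) @ x0 --> x0 by exact: cvg_id.
have h : (fun x => tfactor p x q N) @ x0 --> tfactor p x0 q N.
  rewrite /tfactor; case: (p N); last exact: cst_cvgC.
  suff h : (fun x => letz x q N) @ x0 --> letz x0 q N by exact: (opp_cvgC h).
  rewrite /letz; case: (odd N); first exact: (mul_cvgC idc (@cst_cvgC _ x0 (q ^+ uphalf N))).
  exact: (mul_cvgC (inv_cvgC x00 idc) (@cst_cvgC _ x0 (q ^+ uphalf N))).
by rewrite partial_prodS; exact: (mul_cvgC IH (add_cvgC (@cst_cvgC _ x0 1) h)).
Qed.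

(** Partial products are continuous, and near x0 the letters share the majorant with M = |x0| +
    |x0^-1| + 1, so the tails are uniformly small. *)
Lemma tprod_continuous p q x0 : normc q < 1 -> x0 != 0 ->
  (fun x => tprod p x q) @ x0 --> tprod p x0 q.
Proof.
move=> q1 x00; pose M := size x0 + 1.
have M0 : 0 <= M by have := size0 x0; rewrite /M; lra.
have near_le (f : C -> C) : f x @[x --> x0] --> f x0 -> normc (f x0) <= size x0 ->
    \forall x \near x0, normc (f x) <= M.
  move=> /nearC_P /(_ 1 ltr01) fc fM; apply: filterS fc => x h.
  rewrite -[f x](subrK (f x0)) /M; apply: le_trans (normcD _ _) _; rewrite normcB.
  by rewrite addrC lerD // ltW.
have S0 N : \sum_(k < N) letz_bound M (normc q) k <= M * (2 / (1 - normc q)).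
  by apply: letz_bound_sum; rewrite ?normc_ge0.
(* [prod_tail_small] asks for a dominated sequence; the letters at x = 0 serve, as both 0 and its
   formal inverse 0 are at most M. *)
have bnd k : normc (tfactor p 0 q k) <= letz_bound M (normc q) k.
  by apply: tfactor_le; rewrite ?invr0 normc0.
apply/nearC_P => e e0; have e4 : 0 < e / 4 by rewrite divr_gt0.
have [N hN] := prod_tail_small bnd S0 e4.
have close x : normc x <= M -> normc x^-1 <= M ->
    normc (tprod p x q - partial_prod (tfactor p x q) N) <= e / 4.
  move=> h1 h2; apply: (cvgC_dist_le (n0 := N) (@tprod_cvg p x q q1)) => N' NN'.
  apply: le_trans (partial_prod_dist (fun k => tfactor_le p q k h1 h2) NN') _.
  exact/ltW/hN.
have n1 : \forall x \near x0, normc x <= M by apply: (near_le id) => //; exact: cvg_id.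
have n2 : \forall x \near x0, normc x^-1 <= M.
  by apply: (near_le (fun x => x^-1)) => //; exact: (inv_cvgC x00 (@cvg_id _ (nbhs x0))).
have n3 := proj1 (nearC_P _ _ _) (@partial_prod_continuous p q x0 N x00) _ e4.
have M1 : size x0 <= M by rewrite lerDl.
have c0 := close x0 (le_trans (size1 x0) M1) (le_trans (size2 x0) M1).
near=> x.
have m1 : normc x <= M by near: x.
have m2 : normc x^-1 <= M by near: x.
have m3 : normc (partial_prod (tfactor p x0 q) N - partial_prod (tfactor p x q) N)
  < e / 4 by near: x.
have := close x m1 m2; rewrite normcB => m4; move: c0 m3 m4.
set t := tprod p x q; set t0 := tprod p x0 q.
set u := partial_prod (tfactor p x q) N; set u0 := partial_prod _ N => c0 m3 m4.
have -> : t0 - t = (t0 - u0) + ((u0 - u) + (u - t)) by ring.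
apply: le_lt_trans (normcD _ _) _.
apply: le_lt_trans (lerD c0 (normcD _ _)) _.
by lra.
Unshelve. all: by end_near.
Qed.

End ThetaProducts.

(** * Summation over the reduced states *)

Section TraceSum.
Context (R : realType).
Local Notation C := (Cx R).
Local Notation St := {mset nat}%mset.
Local Notation X := (St * St * St * St)%type.
Local Notation T := (tprod predT).

Definition positive_mode : pred nat := fun k => (0 < k)%N.

(* The closed form of the trace of gamma^k J_e(0) (-1)^F y^J(0) q^L(0), with
   s = i^k; the four factors come from e, a, b and b'. *)
Definition trace_value (s y q : C) : C :=
  y * (tprod positive_mode 1 q * tprod (predC has_partner) (s ^+ 2 * y ^+ 6) q
       * (T (s * y) q)^-1 * T (- (s * y ^+ 3)) q).

Lemma letter_weight_letz (c w q : C) (A : St) : w != 0 ->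
  letter_weight c A * w ^ mcharge A * q ^+ mlevel A = \prod_(k <- A) letz (c * w) q k.
Proof.
move=> w0; elim/mset_ind: A => [|k A IH].
  by rewrite /letter_weight /mcharge /mlevel enum_mset0 !big_nil !mul1r.
rewrite big_mset_cons letter_weight_cons mcharge_cons mlevel_cons -IH.
rewrite expfzDr // exprD /letz /lsign; case: ifP => _ /=; first by rewrite expr1z; ring.
by rewrite invfM exprN1; ring.
Qed.

(** The letters are (s y)^-1 q^n and s y q^(n+1) with n >= 0, of absolute value at most |y|^-1 and
    |y q|; both are below 1 precisely in the domain. *)
Lemma unit_letz_bound (s y q : C) : normc s = 1 -> 1 < normc y -> normc (y * q) < 1 ->
  exists2 rho : R, rho < 1 & forall k, normc (letz (s * y) q k) <= rho.
Proof.
move=> s1 y1 yq1; have y0 : 0 < normc y by lra.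
have q1 : normc q < 1.
  by move: yq1; rewrite normcM; have := normc_ge0 q; nra.
have r1 j : normc q ^+ j <= 1 by rewrite exprn_ile1 ?normc_ge0 // ltW.
exists (Num.max (normc y)^-1 (normc (y * q))).
  by rewrite gt_max yq1 invf_lt1 // y1.
move=> k; rewrite /letz normcM normcX le_max; case: (boolP (odd k)) => ok; apply/orP.
  right; case: k ok => // k _; rewrite normcM s1 mul1r /= exprS mulrA -normcM.
  by rewrite ler_piMr ?normc_ge0.
left; rewrite invfM normcM !normcV s1 invr1 mul1r.
by apply: ler_piMr; [rewrite invr_ge0 normc_ge0|exact: r1].
Qed.

Section Values.
Context (s y q : C).
Hypotheses (s1 : normc s = 1) (y1 : 1 < normc y) (yq1 : normc (y * q) < 1).

Let s0 : s != 0. Proof. by rewrite -normc_gt0 s1. Qed.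
Let y0 : y != 0. Proof. by rewrite -normc_gt0; exact: lt_trans ltr01 y1. Qed.
Let q1 : normc q < 1.
Proof.
by apply: le_lt_trans yq1; rewrite normcM ler_peMl ?normc_ge0 // ltW.
Qed.

Lemma letz_neq1 k : letz (s * y) q k != 1.
Proof.
have [rho rho1 h] := unit_letz_bound s1 y1 yq1.
apply/eqP => e; have := h k; rewrite e normc1; lra.
Qed.

(** A fermionic letter u contributes 1 + u, while the factors of [tprod p c q] are 1 - letz c q k;
    hence the argument - c. *)
Let fermion_letz (p : pred nat) (c : C) :
  asum (state_weight (fermion (letz (- c) q) p)) (tprod p c q).
Proof.
apply: (fermion_asum (fun k => letz_size (- c) q k) (fun N => letz_size_sum (- c) N q1)).
have -> : (fun N => \prod_(k < N) (1 + (if p k then letz (- c) q k else 0))) =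
    partial_prod (tfactor p c q).
  apply/funext => N; apply: eq_bigr => k _; rewrite /tfactor letzN.
  by [].
exact: tprod_cvg.
Qed.

Let boson_letz : asum (state_weight (boson (letz (s * y) q))) (T (s * y) q)^-1.
Proof.
have [rho rho1 h] := unit_letz_bound s1 y1 yq1.
apply: (boson_asum (fun k => letz_size (s * y) q k) (fun N => letz_size_sum (s * y) N q1)
  rho1 h).
have -> : (fun N => \prod_(k < N) (1 - letz (s * y) q k)^-1) =
    fun N => (partial_prod (tfactor predT (s * y) q) N)^-1.
  by apply/funext => N; rewrite prodfV.
apply: (@cvgV C _ _ _ (partial_prod (tfactor predT (s * y) q))).
  by apply: tprod_neq0 => // k _; exact: letz_neq1.
exact: tprod_cvg.
Qed.

(** The doubled sign keeps the form [letz (- c)] of [fermion_letz], with c = - (s * y ^+ 3). The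
    Weyl factor [b'] carries a fermionic weight because a reduced state repeats none of its
    modes. *)
Definition state_term (x : X) : C :=
  y * (state_weight (fermion (letz (- 1) q) positive_mode) x.1.1.1
       * state_weight (fermion (letz (- (s ^+ 2 * y ^+ 6)) q) (predC has_partner)) x.1.1.2
       * state_weight (boson (letz (s * y) q)) x.1.2
       * state_weight (fermion (letz (- - (s * y ^+ 3)) q) predT) x.2).

Lemma state_term_asum : asum state_term (trace_value s y q).
Proof.
apply: asum_scale; apply: (asum_mul (Z := St) (f := fun p : St * St * St =>
  state_weight (fermion (letz (- 1) q) positive_mode) p.1.1
  * state_weight (fermion (letz (- (s ^+ 2 * y ^+ 6)) q) (predC has_partner)) p.1.2
  * state_weight (boson (letz (s * y) q)) p.2)); last exact: fermion_letz.
apply: (asum_mul (Z := St) (f := fun p : St * St =>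
  state_weight (fermion (letz (- 1) q) positive_mode) p.1
  * state_weight (fermion (letz (- (s ^+ 2 * y ^+ 6)) q) (predC has_partner)) p.2));
  last exact: boson_letz.
by apply: asum_mul; exact: fermion_letz.
Qed.

(** The bound 2 A2(partner k) + A4(k) <= 1 says that [a] has no partner mode and [b'] no repeated
    mode. Together with admissibility and the empty zero mode of [e], these are the conditions in
    the fermionic weights. *)
Lemma state_term_reduced x : state_term x =
  (admissible4 x)%:R * (reduced_weight s x * y ^ charge4 x * q ^+ level4 x).
Proof.
case: x => [[[A1 A2] A3] A4]; rewrite /state_term /= !fermion_weight boson_weight.
rewrite opprK; have -> : - 1 = - 1 * 1 :> C by rewrite mulr1.
have -> : - (s ^+ 2 * y ^+ 6) = - s ^+ 2 * y ^+ 6 by rewrite mulNr.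
rewrite -!letter_weight_letz ?oner_neq0 ?expf_neq0 // exp1rz mulr1.
rewrite /reduced_weight /weight4 /charge4 /level4 /=.
rewrite !expfzDr // expr1z !exprD.
have -> : y ^ (6 * mcharge A2) = (y ^+ 6) ^ mcharge A2 by rewrite -exprz_exp.
have -> : y ^ (3 * mcharge A4) = (y ^+ 3) ^ mcharge A4 by rewrite -exprz_exp.
set i1 := `[< forall k, (A1 k <= _)%N >]; set i2 := `[< forall k, (A2 k <= _)%N >].
set i4 := `[< forall k, (A4 k <= _)%N >].
have e : [&& i1, i2 & i4] =
    admissible4 (A1, A2, A3, A4) && ((A1 0%N == 0%N) && reduced_state (A1, A2, A3, A4)).
  rewrite /admissible4 /admissible /= andbT /reduced_state /pair_load /=.
  apply/and3P/andP => [[/asboolP h1 /asboolP h2 /asboolP h4]|].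
    split; apply/andP; split.
    - by apply/uniq_msetP => k; apply: leq_trans (h1 k) (leq_b1 _).
    - by apply/uniq_msetP => k; apply: leq_trans (h2 k) (leq_b1 _).
    - by have := h1 0%N; rewrite leqn0.
    apply/asboolP => k; have := h2 (partner k); have := h4 k.
    rewrite /= (_ : has_partner (partner k)) /=; last by apply/has_partnerP; exists k.
    by lia.
  move=> [/andP[/uniq_msetP u1 /uniq_msetP u2] /andP[/eqP h1 /asboolP h]].
  split; apply/asboolP => k.
  - by case: k => [|k]; rewrite ?h1 ?u1.
  - rewrite /=; case: has_partnerP => [[j <-]|_]; rewrite ?u2 //=.
    by have := h j; lia.
  - by have := h k; rewrite /=; lia.
have {}e : i1%:R * i2%:R * i4%:R = (admissible4 (A1, A2, A3, A4))%:R *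
    ((A1 0%N == 0%N) && reduced_state (A1, A2, A3, A4))%:R :> C.
  by rewrite -!natrM !mulnb -e andbA.
by ring: e.
Qed.

Lemma trace_sum : double_series_sum
  (fun m n => (\sum_(x <- sector m n) traced s x) * y ^ m * q ^+ n) (trace_value s y q).
Proof.
have -> : (fun m n => (\sum_(x <- sector m n) traced s x) * y ^ m * q ^+ n) =
    fun m n => \sum_(x <- sector m n) state_term x.
  apply/funext => m; apply/funext => n; rewrite reduced_sum // !mulr_suml.
  apply: eq_big_seq => x; rewrite mem_sector state_term_reduced.
  by move=> /and3P[-> /eqP -> /eqP ->]; rewrite mul1r.
apply: (asum_fibers (D := admissible4) (d := fun x => (charge4 x, level4 x))).
- by move=> m n x; rewrite mem_sector xpair_eqE.
- by move=> x /negPf h; rewrite state_term_reduced h mul0r.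
exact: state_term_asum.
Qed.

End Values.
End TraceSum.

(** * Theta functions and the Jacobi forms *)

Section Exponential.
Context (R : realType).
Local Notation C := (Cx R).
Implicit Types (u v w z : C).

Lemma cexpD u v : cexp (u + v) = cexp u * cexp v.
Proof.
case: u v => a b [c d]; rewrite /cexp /= expRD cosD sinD; simpc.
by congr (_ +i* _)%C; ring.
Qed.

Lemma normc_cexp u : normc (cexp u) = expR (complex.Re u).
Proof.
rewrite /cexp /= !exprMn -mulrDr cos2Dsin2 mulr1 sqrtr_sqr ger0_norm //.
Qed.

Lemma e2pii_cexp w :
  e2pii w = cexp ((- (2 * pi * complex.Im w)) +i* (2 * pi * complex.Re w))%C.
Proof.
rewrite /e2pii -complexiE; congr cexp; case: w => a b /=.
have -> : (2 : C) = (2 : R)%:C%C by rewrite rmorph_nat.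
by simpc.
Qed.

Lemma e2piiD u v : e2pii (u + v) = e2pii u * e2pii v.
Proof. by rewrite /e2pii mulrDr cexpD. Qed.

Lemma normc_e2pii w : normc (e2pii w) = expR (- (2 * pi * complex.Im w)).
Proof. by rewrite e2pii_cexp normc_cexp. Qed.

Lemma e2pii_neq0 w : e2pii w != 0.
Proof. by rewrite -normc_gt0 normc_e2pii expR_gt0. Qed.

Lemma e2pii0 : e2pii 0 = 1 :> C.
Proof. by apply: (mulfI (e2pii_neq0 0)); rewrite -e2piiD addr0 mulr1. Qed.

Lemma e2piiMn n w : e2pii (n%:R * w) = e2pii w ^+ n.
Proof.
elim: n => [|n IH]; first by rewrite mul0r e2pii0.
by rewrite -natr1 mulrDl mul1r e2piiD IH exprSr.
Qed.

Lemma e2piiN w : e2pii (- w) = (e2pii w)^-1.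
Proof. by apply: (mulfI (e2pii_neq0 w)); rewrite -e2piiD subrr e2pii0 divff ?e2pii_neq0. Qed.

Lemma e2pii_quarter : e2pii 4^-1 = 'i :> C.
Proof.
have -> : 4^-1 = (4^-1 : R)%:C%C :> C by rewrite fmorphV /= rmorph_nat.
rewrite e2pii_cexp /= mulr0 oppr0 -complexiE /cexp /= expR0 !mul1r.
have -> : 2 * pi / 4 = pi / 2 :> R by field.
by rewrite cos_pihalf sin_pihalf.
Qed.

(** The modulus makes w a real number a, and cos(2 pi a) = 1 gives sin(pi a) = 0 with |pi a| < pi,
    hence a = 0. *)
Lemma e2pii_eq1 w : e2pii w = 1 -> normc w < 1 -> w = 0.
Proof.
move=> e w1; have pi0 := pi_gt0 R.
have Iw : complex.Im w = 0.
  have := normc_e2pii w; rewrite e normc1 -expR0 => /expR_inj /esym/eqP.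
  by rewrite oppr_eq0 mulf_eq0 gt_eqF ?mulr_gt0 //= => /eqP.
move: (Re_normc w) e; rewrite e2pii_cexp Iw; case: w Iw w1 => a b /= -> w1 h.
have {}w1 : `|a| < 1 by apply: le_lt_trans h w1.
rewrite /cexp /= mulr0 oppr0 expR0 !mul1r => -[hc _].
have s0 : sin (pi * a) = 0.
  have := cos_mulr2n (pi * a); rewrite -[pi * a *+ 2]mulr_natl mulrA hc => h1.
  have := cos2Dsin2 (pi * a); move: h1; rewrite -mulr_natl => h1 h2.
  by apply/eqP; rewrite -sqrf_eq0; apply/eqP; lra.
suff -> : a = 0 by [].
move: w1; rewrite ltr_norml => /andP[w1 w2].
case: (ltgtP a 0) => // a0.
  have : 0 < sin (pi * - a) by apply: sin_gt0_pi; apply/andP; split; nra.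
  by rewrite mulrN sinN s0 oppr0 ltxx.
have : 0 < sin (pi * a) by apply: sin_gt0_pi; apply/andP; split; nra.
by rewrite s0 ltxx.
Qed.

Lemma e2pii_continuous w0 : (fun w => e2pii w : C) @ w0 --> (e2pii w0 : C).
Proof.
have near0 (f : C -> R) : (forall z, `|f z| <= normc z) ->
    (forall z z', f (z - z') = f z - f z') -> f @ w0 --> f w0.
  move=> fn fB; apply/(@cvgrPdist_lt _ R _ (nbhs w0)) => e e0.
  have := proj1 (nearC_P w0 id w0) (@cvg_id _ (nbhs w0)) e e0.
  by apply: filterS => w; apply: le_lt_trans; rewrite -fB.
have cRe : (fun z : C => complex.Re z) @ w0 --> complex.Re w0.
  by apply: near0; [exact: Re_normc|case=> a b [c d]].
have cIm : (fun z : C => complex.Im z) @ w0 --> complex.Im w0.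
  by apply: near0; [exact: Im_normc|case=> a b [c d]].
have scale (f : C -> R) l c : f @ w0 --> l -> (fun z => c * f z) @ w0 --> c * l.
  by move=> h; exact: (cvgM (@cvg_cst R c C (nbhs w0) _) h).
have cE : (fun w : C => expR (- (2 * pi * complex.Im w))) @ w0 -->
    expR (- (2 * pi * complex.Im w0)).
  exact: (cvg_comp _ _ (cvgN (scale _ _ (2 * pi) cIm)) (@continuous_expR R _)).
have cC := cvg_comp _ _ (scale _ _ (2 * pi) cRe) (@continuous_cos R _).
have cS := cvg_comp _ _ (scale _ _ (2 * pi) cRe) (@continuous_sin R _).
have h1 := cvgM cE cC; have h2 := cvgM cE cS.
apply/nearC_P => e e0; have e2 : 0 < e / 2 by rewrite divr_gt0.
have n1 : \forall w \near w0, `|expR (- (2 * pi * complex.Im w0)) * cos (2 * pi * complex.Re w0)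
    - expR (- (2 * pi * complex.Im w)) * cos (2 * pi * complex.Re w)| < e / 2.
  exact: (proj1 (@cvgrPdist_lt _ R _ (nbhs w0) _ _ _) (h1 _) _ e2).
have n2 : \forall w \near w0, `|expR (- (2 * pi * complex.Im w0)) * sin (2 * pi * complex.Re w0)
    - expR (- (2 * pi * complex.Im w)) * sin (2 * pi * complex.Re w)| < e / 2.
  exact: (proj1 (@cvgrPdist_lt _ R _ (nbhs w0) _ _ _) (h2 _) _ e2).
apply: filterS2 n1 n2 => w; rewrite !e2pii_cexp => m1 m2.
by apply: le_lt_trans (normc_ReIm _) _; move: m1 m2; rewrite /=; lra.
Qed.

End Exponential.

Section ThetaFunctions.
Context (R : realType).
Local Notation C := (Cx R).
Local Notation T := (tprod predT).
Local Notation Q := (tprod odd 1).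
Implicit Types (x q s y tau z w : C).

Let partial_prod0 (a : nat -> C) : partial_prod a 0 = 1.
Proof. by rewrite /partial_prod big_ord0. Qed.

Let letz_even x q n : letz x q n.*2 = x^-1 * q ^+ n.
Proof. by rewrite /letz odd_double uphalf_double. Qed.

Let letz_odd x q n : letz x q n.*2.+1 = x * q ^+ n.+1.
Proof. by rewrite /letz /= odd_double doubleK. Qed.

Lemma euler_cvg q : normc q < 1 ->
  (fun N => \prod_(1 <= n < N.+1) (1 - q ^+ n)) @ \oo --> Q q.
Proof.
move=> q1; apply: (tprod_lim (f := double)) => // [N|N]; first by rewrite -addnn leq_addr.
elim: N => [|N IH]; first by rewrite partial_prod0 big_geq.
rewrite doubleS !partial_prodS IH [RHS]big_nat_recr //= /tfactor /= odd_double /=.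
by rewrite letz_odd mul1r addr0 mulr1.
Qed.

Lemma theta_cvg x q : normc q < 1 ->
  (fun N => \prod_(1 <= n < N.+1) ((1 - x^-1 * q ^+ n.-1) * (1 - x * q ^+ n) * (1 - q ^+ n)))
  @ \oo --> T x q * Q q.
Proof.
move=> q1; under eq_fun do rewrite big_split /=.
apply: cvgM; last exact: euler_cvg.
apply: (tprod_lim (f := double)) => // [N|N]; first by rewrite -addnn leq_addr.
elim: N => [|N IH]; first by rewrite partial_prod0 big_geq.
rewrite doubleS !partial_prodS IH [RHS]big_nat_recr //= /tfactor /=.
by rewrite letz_odd letz_even mulrA.
Qed.

(** With x = 1 the modes 2n - 1 and 2n both give q^n, so without mode 0 each factor 1 - q^n occurs
    twice. *)
Lemma tprod_positive_mode q : normc q < 1 -> tprod positive_mode 1 q = Q q ^+ 2.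
Proof.
move=> q1; rewrite expr2.
apply: (cvgC_unique (u := fun N =>
  (\prod_(1 <= n < N.+1) (1 - q ^+ n)) * (\prod_(1 <= n < N.+1) (1 - q ^+ n)))).
  apply: (tprod_lim (f := fun N => N.*2.+1)) => // [N|N].
    by rewrite leqW // -addnn leq_addr.
  elim: N => [|N IH].
    by rewrite partial_prodS partial_prod0 !big_geq // /tfactor /= addr0 mul1r.
  rewrite doubleS 2!partial_prodS IH [in RHS](big_nat_recr N.+1) //= /tfactor /=.
  by rewrite -doubleS letz_odd letz_even invr1 !mul1r; ring.
by apply: cvgM; exact: euler_cvg.
Qed.

Lemma euler_neq0 q : normc q < 1 -> Q q != 0.
Proof.
move=> q1; apply: tprod_neq0 => // k ok; rewrite /letz ok mul1r.
apply/eqP => /(congr1 (@normc R)); rewrite normc1 normcX => e.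
suff : normc q ^+ uphalf k < 1 by rewrite e ltxx.
by rewrite exprn_ilt1 ?normc_ge0 //; case: k ok {e}.
Qed.

Lemma etaE tau : normc (e2pii tau) < 1 ->
  Defs.eta tau = e2pii (tau / 24) * Q (e2pii tau).
Proof. by move=> q1; rewrite /Defs.eta /infprod (limC (euler_cvg q1)). Qed.

Lemma theta1E tau z : normc (e2pii tau) < 1 ->
  theta1 tau z = - 'i * e2pii (tau / 8) * e2pii (z / 2)
                 * (T (e2pii z) (e2pii tau) * Q (e2pii tau)).
Proof. by move=> q1; rewrite /theta1 /infprod (limC (@theta_cvg _ _ q1)). Qed.

Lemma theta2E tau z : normc (e2pii tau) < 1 ->
  theta2 tau z = e2pii (tau / 8) * e2pii (z / 2)
                 * (T (- e2pii z) (e2pii tau) * Q (e2pii tau)).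
Proof.
move=> q1; rewrite /theta2 /infprod; congr (_ * _).
rewrite -(limC (@theta_cvg (- e2pii z) _ q1)); congr (lim (_ @ \oo)); apply/funext => N.
by apply: eq_bigr => n _; rewrite invrN !mulNr !opprK.
Qed.

(** The product over the modes of [a] without partner is completed by T(s^2 y^6; q^2) = T(s y^3; q)
    T(- s y^3; q). The identity avoids a division by T(s y^3; q), which can vanish in the domain. *)
Lemma trace_value_mul s y q : normc q < 1 -> T (s * y) q != 0 ->
  trace_value s y q * (T (s * y) q * T (s * y ^+ 3) q) =
  y * Q q ^+ 2 * T (s ^+ 2 * y ^+ 6) q.
Proof.
move=> q1 T0; rewrite /trace_value tprod_positive_mode //.
have e1 := tprod_mulN (s * y ^+ 3) q1; have e2 := tprod_partner (s ^+ 2 * y ^+ 6) q1.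
have e3 : (s * y ^+ 3) ^+ 2 = s ^+ 2 * y ^+ 6 by ring.
rewrite e3 in e1; rewrite e2 -e1; by field.
Qed.

End ThetaFunctions.

Section JacobiForms.
Context (R : realType).
Local Notation C := (Cx R).
Local Notation T := (tprod predT).
Local Notation Q := (tprod odd 1).
Implicit Types (q s y tau z w : C).

(* The scalars i^k by which g and its inverse act, for g of the given order. *)
Definition eigenpair (k : nat) s s' : Prop :=
  [\/ k = 1%N /\ (s = 1 /\ s' = 1), k = 2%N /\ (s = -1 /\ s' = -1)
    | k = 4%N /\ ((s = 'i /\ s' = - 'i) \/ (s = - 'i /\ s' = 'i))].

Lemma e2pii_half z n : e2pii (n%:R * z / 2) = e2pii (z / 2) ^+ n.
Proof. by rewrite -e2piiMn mulrA. Qed.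

Lemma e2pii_sqr_half z : e2pii z = e2pii (z / 2) ^+ 2.
Proof. by rewrite -e2pii_half mulrAC divff ?mul1r // pnatr_eq0. Qed.

(** The cross-multiplied form of the quotient, so that it holds at the zeros of the denominator as
    well. *)
Lemma psi13_identity k s s' tau z : normc (e2pii tau) < 1 ->
  let q := e2pii tau in let y := e2pii z in
  T (s * y) q != 0 -> T (s' * y) q != 0 -> eigenpair k s s' ->
  psi13_num k tau z = - (trace_value s y q + trace_value s' y q) * psi13_den k tau z.
Proof.
move=> q1 q y t0 t0'.
(* The exponentials in z and tau become powers of e(z/2) and e(tau/24), which turns the claim into a
   polynomial identity in the theta products. *)
pose b : C := e2pii (z / 2); pose c : C := e2pii (tau / 24).
have yb : y = b ^+ 2 by exact: e2pii_sqr_half.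
have c3 : e2pii (tau / 8) = c ^+ 3 :> C.
  by rewrite -e2piiMn; congr e2pii; field.
have y6 : e2pii (6 * z) = y ^+ 6 :> C by rewrite -e2piiMn.
have y3 : e2pii (3 * z) = y ^+ 3 :> C by rewrite -e2piiMn.
have b6 : e2pii (6 * z / 2) = b ^+ 6 :> C by exact: e2pii_half.
have b3 : e2pii (3 * z / 2) = b ^+ 3 :> C by exact: e2pii_half.
have F := trace_value_mul q1 t0; have F' := trace_value_mul q1 t0'.
have ii : 'i * 'i = -1 :> C by rewrite -expr2 sqrCi.
case=> [[-> [es es']]|[-> [es es']]|[-> e]].
- rewrite /psi13_num /psi13_den /= etaE // !theta1E // b6 b3 c3 y6 y3.
  rewrite es' -es; move: F; rewrite es !mul1r expr1n mul1r -/q -/y -/b -/c.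
  move: (trace_value _ _ _) (Q q) (T y q) (T (y ^+ 3) q) (T (y ^+ 6) q) => f Q0 T1 T3 T6.
  by rewrite yb => F; ring: ii F.
- rewrite /psi13_num /psi13_den /= etaE // !theta1E // !theta2E // b6 b3 c3 y6 y3.
  rewrite es' -es; move: F; rewrite es !mulN1r sqrrN expr1n mul1r -/q -/y -/b -/c.
  move: (trace_value _ _ _) (Q q) (T (- y) q) (T (- y ^+ 3) q) (T (y ^+ 6) q) => f Q0 T1 T3 T6.
  by rewrite yb => F; ring: ii F.
have q2 : e2pii (2 * tau) = q ^+ 2 :> C by rewrite -e2piiMn.
have q21 : normc (e2pii (2 * tau)) < 1 by rewrite q2; exact: normc_sqr_lt1.
have y2 : e2pii (2 * z) = y ^+ 2 :> C by rewrite -e2piiMn.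
have b2 : e2pii (2 * z / 2) = b ^+ 2 :> C by exact: e2pii_half.
have c6 : e2pii (2 * tau / 8) = c ^+ 6 :> C by rewrite -e2piiMn; congr e2pii; field.
have c2 : e2pii (2 * tau / 24) = c ^+ 2 :> C by rewrite -e2piiMn; congr e2pii; field.
(* The shifts by 1/4 enter the half-power e(z/2) in [theta1] as e(1/8), a square root of i. *)
pose r : C := e2pii (8^-1).
have r2 : r ^+ 2 = 'i by rewrite -e2piiMn -e2pii_quarter; congr e2pii; field.
have r0 : r != 0 by exact: e2pii_neq0.
have A w : e2pii (w + 4^-1) = 'i * e2pii w :> C by rewrite e2piiD e2pii_quarter mulrC.
have A' w : e2pii (w - 4^-1) = - 'i * e2pii w :> C.
  by rewrite e2piiD e2piiN e2pii_quarter mulrC invCi.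
have B w : e2pii ((w + 4^-1) / 2) = r * e2pii (w / 2) :> C.
  by rewrite -e2piiD; congr e2pii; field.
have B' w : e2pii ((w - 4^-1) / 2) = r^-1 * e2pii (w / 2) :> C.
  by rewrite -e2piiN -e2piiD; congr e2pii; field.
have m1 := tprod_mulN ('i * y) q1; have m3 := tprod_mulN ('i * y ^+ 3) q1.
rewrite /psi13_num /psi13_den /= !etaE // !theta1E // !theta2E // q2.
rewrite !A !A' !B !B' b6 b3 b2 c6 c2 c3 y6 y3 y2 -/q -/y -/b -/c.
have r2' : r^-1 ^+ 2 = - 'i by rewrite exprVn r2 invCi.
have i2 : ('i : C) ^+ 2 = -1 by exact: sqrCi.
have i6 : 'i ^+ 2 * y ^+ 6 = - y ^+ 6 :> C by rewrite sqrCi mulN1r.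
have i6' : (- 'i) ^+ 2 * y ^+ 6 = - y ^+ 6 :> C by rewrite sqrrN i6.
have {}m1 : T ('i * y) q * T (- 'i * y) q = T (- y ^+ 2) (q ^+ 2).
  by rewrite mulNr m1 exprMn i2 mulN1r.
have {}m3 : T ('i * y ^+ 3) q * T (- 'i * y ^+ 3) q = T (- y ^+ 6) (q ^+ 2).
  by rewrite mulNr m3 exprMn i2 mulN1r -exprM.
have [G G'] : trace_value 'i y q * (T ('i * y) q * T ('i * y ^+ 3) q) =
      y * Q q ^+ 2 * T (- y ^+ 6) q /\
    trace_value (- 'i) y q * (T (- 'i * y) q * T (- 'i * y ^+ 3) q) =
      y * Q q ^+ 2 * T (- y ^+ 6) q.
  by case: e F F' => -[-> ->]; rewrite i6 i6'.
have -> : trace_value s y q + trace_value s' y q =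
    trace_value 'i y q + trace_value (- 'i) y q.
  by case: e => -[-> ->] //; rewrite addrC.
rewrite -m1 -m3; move: G G'.
move: (trace_value (- _) _ _) (trace_value _ _ _) (Q (q ^+ 2)) (Q q) => f' f Q2 Q1.
move: (T ('i * y) q) (T ('i * y ^+ 3) q) (T (- 'i * y) q) (T (- 'i * y ^+ 3) q) (T (- y ^+ 6) q).
move=> A1 A3 B1 B3 T6.
rewrite [in X in X -> _ -> _]yb [in X in _ -> X -> _]yb => G G'.

(* Since r^2 = i and r^-2 = - i, the difference of the two theta products becomes i times a sum,
   which matches the sum of the two traces. *)
transitivity (- 'i * ('i ^+ 2) * (c ^+ 13 * b ^+ 8 * Q1 * Q2 ^+ 2 *
    ((b ^+ 2 * Q1 ^+ 2 * T6) * (r ^+ 2 * (A1 * A3) - r^-1 ^+ 2 * (B1 * B3))))); first by ring.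
rewrite r2 r2' i2.
transitivity (- (c ^+ 13 * b ^+ 8 * Q1 * Q2 ^+ 2 * ((b ^+ 2 * Q1 ^+ 2 * T6) * (B1 * B3)
    + (b ^+ 2 * Q1 ^+ 2 * T6) * (A1 * A3)))); first by ring: ii.
by rewrite -{1}G -G'; ring.
Qed.

End JacobiForms.

(** * Continuity of the trace value and zeros of the theta products *)

Section Values.
Context (R : realType).
Local Notation C := (Cx R).
Local Notation T := (tprod predT).
Local Notation Q := (tprod odd 1).
Implicit Types (q s y tau z w : C).

Lemma exp_cvgC (x0 : C) (f : C -> C) (l : C) n : f @ x0 --> l ->
  (fun x => f x ^+ n) @ x0 --> l ^+ n.
Proof.
move=> h; elim: n => [|n IH]; first exact: cst_cvgC.
rewrite exprS; have -> : (fun x => f x ^+ n.+1) = fun x => f x * f x ^+ n.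
  by apply/funext => x; rewrite exprS.
exact: (mul_cvgC h IH).
Qed.

Lemma e2pii_im_inj z w : e2pii z = e2pii w -> complex.Im z = complex.Im w.
Proof.
move=> /(congr1 (@normc R)); rewrite !normc_e2pii => /expR_inj/oppr_inj.
by apply: mulfI; rewrite mulf_neq0 ?gt_eqF ?pi_gt0.
Qed.

Lemma e2piiMz (l : int) w : e2pii (l%:~R * w) = e2pii w ^ l.
Proof.
case: l => n; first exact: e2piiMn.
by rewrite NegzE -exprnN mulrNz mulNr e2piiN; congr (_^-1); exact: e2piiMn.
Qed.

Lemma letz_eq1 x q k : q != 0 -> letz x q k = 1 -> exists l : int, x = q ^ l.
Proof.
move=> q0; rewrite /letz; case: (odd k) => h.
  exists (- (uphalf k)%:Z); rewrite -exprnN; apply: (mulIf (expf_neq0 (uphalf k) q0)).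
  by rewrite h mulVf // expf_neq0.
exists (uphalf k)%:Z; rewrite -exprnP; have [x0|x0] := eqVneq x 0.
  by move/eqP: h; rewrite x0 invr0 mul0r eq_sym oner_eq0.
by rewrite -[LHS]mulr1 -h mulrA divff // mul1r.
Qed.

Lemma tprod_eq0 x q : q != 0 -> normc q < 1 -> T x q = 0 -> exists l : int, x = q ^ l.
Proof.
move=> q0 q1 t0; have [k h] : exists k, letz x q k = 1.
  apply: contrapT => h; move/eqP: t0; apply/negP/tprod_neq0 => // k _.
  by apply/eqP => e; apply: h; exists k.
exact: letz_eq1 h.
Qed.

Lemma tprod_cvg_comp p q (f : C -> C) (z l : C) : normc q < 1 -> l != 0 -> f @ z --> l ->
  (fun w => tprod p (f w) q) @ z --> tprod p l q.
Proof.
by move=> q1 l0 h; exact: (cvg_comp _ _ h (@tprod_continuous _ p q l q1 l0)).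
Qed.

Lemma trace_value_continuous s q z : normc s = 1 -> normc q < 1 -> T (s * e2pii z) q != 0 ->
  (fun w => trace_value s (e2pii w) q) @ z --> trace_value s (e2pii z) q.
Proof.
move=> s1 q1 t0; have s0 : s != 0 by rewrite -normc_gt0 s1.
have cy : (fun w => e2pii w : C) @ z --> (e2pii z : C) by exact: e2pii_continuous.
have y0 := e2pii_neq0 z.
have c n : (fun w => s ^+ n * e2pii w ^+ (3 * n) : C) @ z --> (s ^+ n * e2pii z ^+ (3 * n) : C).
  exact: (mul_cvgC (@cst_cvgC _ z (s ^+ n)) (@exp_cvgC _ _ _ (3 * n)%N cy)).
have c0 n : s ^+ n * e2pii z ^+ (3 * n) != 0 by rewrite mulf_neq0 ?expf_neq0.
have c1 : (fun w => s * e2pii w : C) @ z --> (s * e2pii z : C).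
  exact: (mul_cvgC (@cst_cvgC _ z s) cy).
have h1 := @tprod_cvg_comp (predC has_partner) _ _ _ _ q1 (c0 2) (c 2).
have h2 := inv_cvgC t0 (@tprod_cvg_comp predT _ _ _ _ q1 (mulf_neq0 s0 y0) c1).
have c3 := opp_cvgC (c 1%N).
have n3 : - (s ^+ 1 * e2pii z ^+ (3 * 1)) != 0 by rewrite oppr_eq0.
have h3 := @tprod_cvg_comp predT _ _ _ _ q1 n3 c3.
exact: (mul_cvgC cy (mul_cvgC (mul_cvgC (mul_cvgC
  (@cst_cvgC _ z (tprod positive_mode 1 q)) h1) h2) h3)).
Qed.

Lemma near_normc z (e : R) : 0 < e -> \forall w \near z, normc (z - w) < e.
Proof. by move=> e0; exact: (proj1 (nearC_P z id z) (@cvg_id _ (nbhs z)) e e0). Qed.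

(* A zero of w |-> T(s y^3; q) is a point where s y^3 is a power of q, and
   the absolute values of distinct powers of q are separated. *)
Lemma tprod_isolated s tau z : s != 0 -> 0 < complex.Im tau ->
  \forall w \near z, w != z -> T (s * e2pii w ^+ 3) (e2pii tau) != 0.
Proof.
move=> s0 it; have q0 := e2pii_neq0 tau.
have q1 : normc (e2pii tau) < 1.
  by rewrite normc_e2pii expR_lt1 oppr_lt0 mulr_gt0 // mulr_gt0 ?pi_gt0.
have [t0|t0] := eqVneq (T (s * e2pii z ^+ 3) (e2pii tau)) 0; last first.
  have cy : (fun w => e2pii w : C) @ z --> (e2pii z : C) by exact: e2pii_continuous.
  have n0 : s * e2pii z ^+ 3 != 0 by rewrite mulf_neq0 ?expf_neq0 ?e2pii_neq0.
  have h := @tprod_cvg_comp predT _ _ _ _ q1 n0 (mul_cvgC (@cst_cvgC _ z s) (@exp_cvgC _ _ _ 3 cy)).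
  have t1 : 0 < normc (T (s * e2pii z ^+ 3) (e2pii tau)) by rewrite normc_gt0.
  have := proj1 (nearC_P _ _ _) h _ t1; apply: filterS => w hw _.
  by apply/eqP => tw; move: hw; rewrite tw subr0 ltxx.
(* The radius makes |3 (w - z)| less than Im tau, which forces equal powers of q, and less than the
   period 1, which then forces w = z. *)
have e0 : 0 < Num.min 1 (complex.Im tau) / 3 by rewrite divr_gt0 // lt_min ltr01 it.
have := near_normc z e0; apply: filterS => w hw; apply: contraNN => /eqP tw.
have [l el] := tprod_eq0 q0 q1 t0; have [l' el'] := tprod_eq0 q0 q1 tw.
have y0 := e2pii_neq0 z.
have e : e2pii (3 * (w - z)) = e2pii ((l' - l)%:~R * tau) :> C.
  rewrite e2piiMz expfzDr // -invr_expz -el -el' -[3]/(3%:R) e2piiMn e2piiD e2piiN.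
  by field; rewrite s0 y0.
have [m1 m2] : normc (3 * (w - z)) < 1 /\ normc (3 * (w - z)) < complex.Im tau.
  have e3 : normc (3 * (w - z)) = 3 * normc (z - w).
    rewrite normcM normcB; congr (_ * _); apply: (complexI (R := R)).
    by rewrite -normE normr_nat rmorph_nat.
  by move: hw; rewrite e3 ltr_pdivlMr // mulrC lt_min => /andP.
have l0 : l' - l = 0.
  have := e2pii_im_inj e; have := Im_normc (3 * (w - z)).
  have -> : complex.Im ((l' - l)%:~R * tau) = (l' - l)%:~R * complex.Im tau.
    have -> : (l' - l)%:~R = ((l' - l)%:~R : R)%:C%C :> C by rewrite rmorph_int.
    by case: (tau) => a b /=; rewrite mul0r addr0.
  move=> h1 h2; move: h1; rewrite h2 normrM (gtr0_norm it) => h1.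
  have h3 : `|(l' - l)%:~R : R| * complex.Im tau < 1 * complex.Im tau.
    by rewrite mul1r; apply: le_lt_trans m2.
  move: h3; rewrite ltr_pM2r // -intr_norm -[1]/(1%:~R) ltr_int.
  lia.
have : 3 * (w - z) = 0 :> C by apply: e2pii_eq1; rewrite // e l0 mul0r e2pii0.
by move/eqP; rewrite mulf_eq0 pnatr_eq0 /= subr_eq0.
Qed.

End Values.

(** * Removable poles *)

Section Poles.
Context (R : realType).
Local Notation C := (Cx R).
Local Notation T := (tprod predT).
Local Notation Q := (tprod odd 1).
Implicit Types (q s y tau z w : C).

Lemma domain_bounds tau z : 0 < - complex.Im z -> - complex.Im z < complex.Im tau ->
  1 < normc (e2pii z) /\ normc (e2pii z * e2pii tau) < 1.
Proof.
move=> h1 h2; have p2 : 0 < 2 * pi :> R by rewrite mulr_gt0 ?pi_gt0.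
rewrite normcM !normc_e2pii -expRD expR_gt1 expR_lt1; split; nra.
Qed.

Lemma eigenpair_norm k s s' : eigenpair k s s' -> normc s = 1 /\ normc s' = 1.
Proof.
have ni : normc ('i : C) = 1 by rewrite -complexiE /= expr0n expr1n add0r sqrtr1.
by case=> [[_ [-> ->]]|[_ [-> ->]]|[_ [[-> ->]|[-> ->]]]]; rewrite ?normcN ?ni ?normc1.
Qed.

(** For order 4 the products at 2 tau split as T(- y^2; q^2) = T(i y; q) T(- i y; q), and likewise
    with y^3, so the denominator consists of the four factors assumed nonzero and of units. *)
Lemma psi13_den_neq0 k s s' tau z : normc (e2pii tau) < 1 -> eigenpair k s s' ->
  let T w := T w (e2pii tau) in let y := e2pii z in
  T (s * y) != 0 -> T (s' * y) != 0 -> T (s * y ^+ 3) != 0 -> T (s' * y ^+ 3) != 0 ->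
  psi13_den k tau z != 0.
Proof.
move=> q1 hs T' y t1 t2 t3 t4; have Q0 := euler_neq0 q1.
have i0 : 'i != 0 :> C by exact: neq0Ci.
have y3 : e2pii (3 * z) = y ^+ 3 :> C by rewrite -e2piiMn.
case: hs t1 t2 t3 t4 => [[-> [-> ->]]|[-> [-> ->]]|[-> e]] t1 t2 t3 t4; rewrite /psi13_den /=.
- rewrite !theta1E // y3; move: t1 t3; rewrite !mul1r /T' => t1 t3.
  by rewrite !mulf_neq0 ?oppr_eq0 ?e2pii_neq0.
- rewrite !theta2E // y3; move: t1 t3; rewrite !mulN1r /T' => t1 t3.
  by rewrite !mulf_neq0 ?oppr_eq0 ?e2pii_neq0.
have q2 : e2pii (2 * tau) = e2pii tau ^+ 2 :> C by rewrite -e2piiMn.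
have q21 : normc (e2pii (2 * tau)) < 1 by rewrite q2; exact: normc_sqr_lt1.
have y2 : e2pii (2 * z) = y ^+ 2 :> C by rewrite -e2piiMn.
have y6 : e2pii (6 * z) = y ^+ 6 :> C by rewrite -e2piiMn.
have i2 : ('i : C) ^+ 2 = -1 by exact: sqrCi.
have m1 := tprod_mulN ('i * y) q1; have m3 := tprod_mulN ('i * y ^+ 3) q1.
rewrite etaE // !theta2E // y2 y6 q2.
have -> : - y ^+ 2 = ('i * y) ^+ 2 by rewrite exprMn i2 mulN1r.
have -> : - y ^+ 6 = ('i * y ^+ 3) ^+ 2 by rewrite exprMn i2 mulN1r -exprM.
rewrite -m1 -m3 -!mulNr.
have Q20 : Q (e2pii tau ^+ 2) != 0 by apply: euler_neq0; exact: normc_sqr_lt1.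
have [u1 u2 u3 u4] : [/\ T' ('i * y) != 0, T' (- 'i * y) != 0, T' ('i * y ^+ 3) != 0
    & T' (- 'i * y ^+ 3) != 0] by case: e t1 t2 t3 t4 => -[-> ->].
move: u1 u2 u3 u4 Q0 Q20; rewrite /T'.
move: (Q (e2pii tau)) (Q (e2pii tau ^+ 2)) (T ('i * y) _) (T (- 'i * y) _)
  (T ('i * y ^+ 3) _) (T (- 'i * y ^+ 3) _) => Q1 Q2 A1 B1 A3 B3 *.
by rewrite !mulf_neq0 ?e2pii_neq0.
Qed.

(** The factors T(s y; q) never vanish in the domain, so only those in y^3 can produce poles, and
    the sum of the two traces is continuous there. *)
Lemma psi13_valueP k s s' tau z :
  0 < - complex.Im z -> - complex.Im z < complex.Im tau -> eigenpair k s s' ->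
  psi13_value k tau z (- (trace_value s (e2pii z) (e2pii tau)
                          + trace_value s' (e2pii z) (e2pii tau))).
Proof.
move=> h1 h2 hs; have [ns ns'] := eigenpair_norm hs.
have it : 0 < complex.Im tau by exact: lt_trans h2.
have q1 : normc (e2pii tau) < 1.
  by rewrite normc_e2pii expR_lt1 oppr_lt0 mulr_gt0 // mulr_gt0 ?pi_gt0.
have tn w : 0 < - complex.Im w -> - complex.Im w < complex.Im tau -> forall s0 : C,
    normc s0 = 1 -> T (s0 * e2pii w) (e2pii tau) != 0.
  move=> k1 k2 s0 n0; have [b1 b2] := domain_bounds k1 k2.
  by apply: tprod_neq0 => // j _; exact: letz_neq1.
have id w k1 k2 := psi13_identity q1 (tn w k1 k2 _ ns) (tn w k1 k2 _ ns') hs.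
rewrite /psi13_value; case: ifPn => den0; last by rewrite id // mulfK.
pose f w : C := - (trace_value s (e2pii w) (e2pii tau) + trace_value s' (e2pii w) (e2pii tau)).
have fc : f @ z --> f z.
  exact: (opp_cvgC (add_cvgC (trace_value_continuous ns q1 (tn z h1 h2 _ ns))
    (trace_value_continuous ns' q1 (tn z h1 h2 _ ns')))).
have s0 : s != 0 by rewrite -normc_gt0 ns.
have s0' : s' != 0 by rewrite -normc_gt0 ns'.
(* The distance of Im z to the boundary of the domain, so that points closer than [d] stay
   inside. *)
pose d := Num.min (- complex.Im z) (complex.Im tau + complex.Im z).
have d0 : 0 < d by rewrite lt_min h1 /=; lra.
apply/(@cvgrPdist_lt _ C _ (dnbhs z)) => e e0; have ee := gt0_complexE e0.
have e1 : 0 < complex.Re e by rewrite -ltcR -ee.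
have n1 := proj1 (nearC_P _ _ _) fc _ e1.
have n2 := tprod_isolated z s0 it; have n3 := tprod_isolated z s0' it.
have n4 := near_normc z d0.
suff : \forall w \near z, w != z -> `|f z - psi13_num k tau w / psi13_den k tau w| < e by [].
near=> w => wz.
have m1 : normc (f z - f w) < complex.Re e by near: w.
have m2 : T (s * e2pii w ^+ 3) (e2pii tau) != 0.
  have : w != z -> T (s * e2pii w ^+ 3) (e2pii tau) != 0 by near: w.
  exact.
have m3 : T (s' * e2pii w ^+ 3) (e2pii tau) != 0.
  have : w != z -> T (s' * e2pii w ^+ 3) (e2pii tau) != 0 by near: w.
  exact.
have m4 : normc (z - w) < d by near: w.
have [k1 k2] : 0 < - complex.Im w /\ - complex.Im w < complex.Im tau.
  have := le_lt_trans (Im_normc (z - w)) m4; rewrite /d lt_min.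
  case: (z) (w) => a b [a' b'] /=; rewrite !ltr_norml => /andP[/andP[? ?] /andP[? ?]].
  by split; lra.
have dn := psi13_den_neq0 q1 hs (tn w k1 k2 _ ns) (tn w k1 k2 _ ns') m2 m3.
by rewrite id // mulfK // -/(f w) [X in _ < X]ee normE ltcR.
Unshelve. all: by end_near.
Qed.

End Poles.

(** The inverse of gamma^j is written gamma^(3j), which keeps exponents in the natural numbers; its
    scalar is i^(3j). *)
Lemma eigenpair_order (R : realType) (gT : finGroupType) (gamma : gT) j : (j < 4)%N ->
  #[gamma]%g = 4%N ->
  eigenpair #[(gamma ^+ j)%g]%g ('i ^+ j : Cx R) ('i ^+ (3 * j) : Cx R).
Proof.
move=> j4 og; rewrite orderXgcd og.
have i2 : 'i ^+ 2 = -1 :> Cx R by exact: sqrCi.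
have i3 : 'i ^+ 3 = - 'i :> Cx R by rewrite exprS i2 mulrN1.
have i6 : 'i ^+ 6 = -1 :> Cx R by rewrite (exprM _ 2 3) i2; ring.
have i9 : 'i ^+ 9 = 'i :> Cx R by rewrite (exprM _ 3 3) i3 exprNn i3; ring.
case: j j4 => [|[|[|[|//]]]] _.
- by apply: Or31.
- by apply: Or33; split => //; left; rewrite expr1 i3.
- by apply: Or32; rewrite i2 i6.
- by apply: Or33; split => //; right; rewrite i3 i9.
Qed.

Theorem theorem4p2 (R : realType)
    (e a : free_field (Cx R) false 2) (b b' : free_field (Cx R) true 2)
    (gT : finGroupType) (G13 : umbral_group13 gT)
    (* gT is cyclic of order 4, and gamma is the chosen generator *)
    (gT_order : #|gT| = 4%N) (gamma : gT) (gamma_order : #[gamma]%g = 4%N)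
    (act : gT -> W13tw e a b b' -> W13tw e a b b')
    (act1 : forall w, act 1%g w = w)
    (actM : forall g h w, act (g * h)%g w = act g (act h w))
    (act_gamma : forall w, act gamma w = generator13 w)
    (g : gT) :
  exists c : int -> nat -> Cx R,
    trace_series
      (fun w => - (act g (Je0 (fermion_sign w)) + act g^-1%g (Je0 (fermion_sign w))))
      (@J0 _ e a b b') (@L0 _ e a b b') c /\
    forall tau z : Cx R,
      0 < - complex.Im z -> - complex.Im z < complex.Im tau ->
      exists2 s : Cx R, psi13_value #[g]%g tau z s &
        double_series_sum
          (fun m n => c m n * e2pii z ^ m * e2pii tau ^+ n) s.
Proof.
have act_iter k w : act (gamma ^+ k)%g w = iter k (@generator13 _ e a b b') w.
  by elim: k => [|k IH]; rewrite ?expg0 // expgS actM IH act_gamma.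
have [j j4 ->] : exists2 j, (j < 4)%N & g = (gamma ^+ j)%g.
  have : g \in <[gamma]>%g.
    have e4 : #|<[gamma]>%g| = #|gT| by rewrite -orderE gamma_order gT_order.
    by rewrite (subset_cardP e4 (subset_predT _)).
  by case/cyclePmin => j j4 ->; exists j; rewrite // -gamma_order.
have inv_g : (gamma ^+ j)^-1%g = (gamma ^+ (3 * j))%g.
  apply/eqP; rewrite eq_invg_mul -expgD -[(j + 3 * j)%N]/(4 * j)%N expgM -gamma_order.
  by rewrite expg_order expg1n.
exists (fun m n => \sum_(x <- sector m n)
  - (traced ('i ^+ j : Cx R) x + traced ('i ^+ (3 * j) : Cx R) x)); split.
  by apply: twisted_trace => w; rewrite inv_g !act_iter.
move=> tau z h1 h2; have hs := eigenpair_order R j4 gamma_order.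
have [n1 n2] := eigenpair_norm hs; have [y1 yq1] := domain_bounds h1 h2.
exists (- (trace_value ('i ^+ j) (e2pii z) (e2pii tau)
           + trace_value ('i ^+ (3 * j)) (e2pii z) (e2pii tau))).
  exact: psi13_valueP.
have := double_series_sumN (double_series_sumD (trace_sum n1 y1 yq1) (trace_sum n2 y1 yq1)).
congr double_series_sum; apply/funext => m; apply/funext => n.
by rewrite sumrN big_split /= !mulNr !mulrDl.
Qed.
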